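(* Let $n,m$ be positive integers, $p\in[1,n)$, $Q\in\mathcal{K}_o^{1,m}$, and let $K$ be a compact subset of $M_{n,1}(\mathbb{R})$. The $m$th order $p$-affine capacity of $K$, defined by $$C_{p,Q}(K)=\inf_{f\in\mathscr{A}(K)}\Big(\int_{S^{nm-1}}\|h_Q(\nabla_u f)\|_p^{-nm}\,du\Big)^{-\frac{p}{nm}},\qquad \mathscr{A}(K)=\{f\in W_0^{1,p}: f\ge \mathbf{1}_K\},$$ can be equivalently formulated as follows. i) Let $\mathscr{B}(K)$ be the set of $f\in W_0^{1,p}$ such that $f\ge 1$ on $K$. Then $$C_{p,Q}(K)=\inf_{f\in\mathscr{B}(K)}\Big(\int_{S^{nm-1}}\|h_Q(\nabla_u f)\|_p^{-nm}\,du\Big)^{-\frac{p}{nm}}.$$ ii) Let $\mathscr{D}(K)$ be the set of $f\in W_0^{1,p}$ such that $0\le f\le 1$ on $M_{n,1}(\mathbb{R})$ and $f=1$ in a neighborhood of $K$. Then $$C_{p,Q}(K)=\inf_{f\in\mathscr{D}(K)}\Big(\int_{S^{nm-1}}\|h_Q(\nabla_u f)\|_p^{-nm}\,du\Big)^{-\frac{p}{nm}}.$$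
   Context: $M_{n,m}(\mathbb{R})$ is the space of real $n\times m$ matrices with inner product $x\cdot y=\mathrm{tr}(x^{\mathrm T}y)$ and the induced norm; $S^{nm-1}$ is its unit sphere and $du$ the spherical (Hausdorff) measure on it. $M_{n,1}(\mathbb{R})$ and $M_{1,m}(\mathbb{R})$ are identified with $\mathbb{R}^n$ and $\mathbb{R}^m$. $\mathcal{K}_o^{1,m}$ is the set of convex bodies (compact convex sets with nonempty interior) in $M_{1,m}(\mathbb{R})$ containing the origin $o$. The support function of $Q$ is $h_Q(x)=\max\{x\cdot y:y\in Q\}$. $L_p$ is the space of Lebesgue measurable $f:M_{n,1}(\mathbb{R})\to\mathbb{R}$ with $\|f\|_p=(\int|f(x)|^p\,dx)^{1/p}<\infty$. $W^{1,p}$ is the Sobolev space of $f\in L_p$ whose weak partial derivatives are all in $L_p$, with norm $\|f\|_{1,p}=\|f\|_p+\|\nabla f\|_p$, where $\nabla f$ is the weak gradient; $W_0^{1,p}$ is the completion in $W^{1,p}$, under this norm, of the space $C_c^\infty$ of smooth compactly supported functions on $M_{n,1}(\mathbb{R})$. For $f\in W_0^{1,p}$ and $u\in S^{nm-1}$, $\nabla_u f=(\nabla f)^{\mathrm T}u$ (matrix product, with values in $M_{1,m}(\mathbb{R})$) and $\|h_Q(\nabla_u f)\|_p=\big(\int_{M_{n,1}(\mathbb{R})}h_Q(\nabla_u f(x))^p\,dx\big)^{1/p}$. $\mathbf{1}_K$ is the indicator function of $K$.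
   Formalization: The conditions f ≥ 1_K, f ≥ 1 on K, 0 ≤ f ≤ 1 and f = 1 near K are imposed everywhere on the precise representative of f (limit of ball averages, 0 where none exists); read literally or a.e., ii) fails for K = S^{n-1}, where 1_K is admissible with zero energy. *)

(* Defs.v *)
From HB Require Import structures.
From mathcomp Require Import all_boot all_order all_algebra.
From mathcomp Require Import all_classical all_reals all_analysis.

Set Implicit Arguments.
Unset Strict Implicit.
Unset Printing Implicit Defensive.
Import Order.TTheory GRing.Theory Num.Theory.
Import numFieldNormedType.Exports.

Local Open Scope classical_set_scope.
Local Open Scope ring_scope.

(* The library norm on matrices is the sup norm, hence [euclid]; the two norms
   induce the same topology. *)
Definition dotmx (R : realType) (n m : nat) (x y : 'M[R]_(n, m)) : R :=
  \tr (x^T *m y).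

Definition euclid (R : realType) (n m : nat) (x : 'M[R]_(n, m)) : R :=
  Num.sqrt (dotmx x x).

Section covering_outer_measure.
Context (R : realType) (T : Type) (I : choiceType).
Variables (P : set I) (S : I -> set T) (w : I -> \bar R).

(* Caratheodory's construction (Method I), with indexed covering sets so that
   the weight of a box can be read off its corners. *)
Definition covering (A : set T) : \bar R :=
  ereal_inf [set (\esum_(i in J) w i)%E | J in
    [set J : set I |
      [/\ J `<=` P, countable J & A `<=` \bigcup_(i in J) S i]]].

Hypothesis w_ge0 : forall i, (0 <= w i)%E.

Lemma covering_ge0 A : (0 <= covering A)%E.
Proof. by apply: le_ereal_inf_tmp => _ [J _ <-]; exact: esum_ge0. Qed.

Lemma covering0 : covering set0 = 0%E.
Proof.
apply/eqP; rewrite eq_le covering_ge0 andbT.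
by apply: ereal_inf_lbound; exists set0; [split|rewrite esum_set0].
Qed.

Lemma le_covering : {homo covering : A B / A `<=` B >-> (A <= B)%E}.
Proof.
move=> A B AB; apply: ereal_inf_le_tmp => _ [J [JP cJ BJ] <-].
by exists J => //; split => //; exact: subset_trans BJ.
Qed.

Lemma covering_sigma_subadditive : sigma_subadditive covering.
Proof.
move=> A.
have [[i Aioo]|] := pselect (exists i, covering (A i) = +oo%E).
  rewrite (eseries_pinfty _ _ Aioo)// ?leey// => n _.
  by rewrite -ltNye (lt_le_trans _ (covering_ge0 _)).
rewrite -forallNE => Aoo.
suff add2e (e : {posnum R}) :
    (covering (\bigcup_n A n) <= \sum_(i <oo) covering (A i) + e%:num%:E)%E.
  by apply/lee_addgt0Pr => _/posnumP[].
rewrite (le_trans _ (epsilon_trick _ _ _))//; last first.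
  by move=> n; exact: covering_ge0.
have [G PG] : {G : nat -> set I & forall n,
    [/\ G n `<=` P, countable (G n), A n `<=` \bigcup_(i in G n) S i &
     (\esum_(i in G n) w i <= covering (A n) + (e%:num / (2 ^ n.+1)%:R)%:E)%E]}.
  apply: (@choice _ _ (fun n J => [/\ J `<=` P, countable J,
    A n `<=` \bigcup_(i in J) S i &
    (\esum_(i in J) w i <= covering (A n) + (e%:num / (2 ^ n.+1)%:R)%:E)%E])).
  move=> n; have en1 : 0 < e%:num / (2 ^ n.+1)%:R by [].
  have fA : covering (A n) \is a fin_num.
    by rewrite ge0_fin_numE ?covering_ge0// ltey; apply/eqP; exact: Aoo.
  have [_ [J [JP cJ AJ] <-] Jlt] := lb_ereal_inf_adherent en1 fA.
  by exists J; split => //; exact: ltW.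
apply: (@le_trans _ _ (\esum_(i in \bigcup_n G n) w i)%E).
  apply: ereal_inf_lbound; exists (\bigcup_n G n) => //; split.
  - by move=> i [n _]; have [+ _ _ _] := PG n; apply.
  - by apply: bigcup_countable => // n _; have [] := PG n.
  - move=> x [n _ Anx]; have [_ _ /(_ _ Anx) [i Gi Six] _] := PG n.
    by exists i => //; exists n.
rewrite seqDU_bigcup_eq (esum_bigcupT _ _ (@trivIset_seqDU _ G) w_ge0).
have sum_ge0 n : (0 <= \esum_(i in seqDU G n) w i)%E by exact: esum_ge0.
rewrite -(nneseries_esumT sum_ge0).
apply: lee_nneseries => n _; first by move=> _; exact: esum_ge0.
have [_ _ _] := PG n; apply: le_trans.
rewrite esum_mkcond [leRHS]esum_mkcond; apply: le_esum => i _.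
have [iG|_] := boolP (i \in seqDU G n); last by case: ifP.
by rewrite (mem_set (@subset_seqDU _ G n _ (set_mem iG))).
Qed.

End covering_outer_measure.

Section lebesgue.
Context (R : realType) (n : nat).

(* A pair [(a, b)] stands for the closed box with opposite corners [a], [b],
   empty unless [a <= b] coordinatewise. *)
Definition box (ab : 'cV[R]_n * 'cV[R]_n) : set 'cV[R]_n :=
  [set x | forall i, ab.1 i 0 <= x i 0 <= ab.2 i 0].

Definition box_volume (ab : 'cV[R]_n * 'cV[R]_n) : \bar R :=
  (\prod_(i < n) Num.max 0 (ab.2 i 0 - ab.1 i 0))%:E.

Definition lebesgue_covering : set 'cV[R]_n -> \bar R :=
  covering setT box box_volume.

Lemma box_volume_ge0 ab : (0 <= box_volume ab)%E.
Proof. by rewrite lee_fin; apply: prodr_ge0 => i _; rewrite le_max lexx. Qed.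

HB.instance Definition _ := isOuterMeasure.Build R 'cV[R]_n lebesgue_covering
  (covering0 _ _ box_volume_ge0) (covering_ge0 _ _ box_volume_ge0)
  (@le_covering _ _ _ _ _ _) (covering_sigma_subadditive _ _ box_volume_ge0).

Definition lebesgue_outer : {outer_measure set 'cV[R]_n -> \bar R} :=
  lebesgue_covering.

(* The measurable sets of [leb] are the Caratheodory measurable ones, that is,
   all Lebesgue measurable sets. *)
Definition leb : {measure set (caratheodory_type lebesgue_outer) -> \bar R} :=
  lebesgue_outer.

End lebesgue.
Arguments lebesgue_outer : clear implicits.
Arguments leb : clear implicits.

Section hausdorff.
Context (R : realType) (n m k : nat).

Definition diam (A : set 'M[R]_(n, m)) : R :=
  sup [set euclid (x - y) | x in A & y in A].

Definition unit_ball_volume : \bar R := leb R k [set x | euclid x <= 1].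

Definition hausdorff_weight (A : set 'M[R]_(n, m)) : \bar R :=
  (unit_ball_volume * ((diam A / 2) ^+ k)%:E)%E.

Definition hausdorff_delta (delta : R) : set 'M[R]_(n, m) -> \bar R :=
  covering [set A : set 'M[R]_(n, m) |
      forall x y, A x -> A y -> euclid (x - y) <= delta]
    id hausdorff_weight.

(* The weights are normalized so that the k-dimensional Hausdorff measure on R^k
   is the Lebesgue measure. *)
Definition hausdorff_sup (A : set 'M[R]_(n, m)) : \bar R :=
  ereal_sup [set hausdorff_delta delta A | delta in [set delta | 0 < delta]].

Lemma diam_ge0 A : 0 <= diam A.
Proof.
rewrite /diam; set E := [set _ | _ in _ & _ in _].
have [supE|supE] := pselect (has_sup E); last by rewrite sup_out.
have [_ [x Ax [y Ay _]]] := supE.1.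
apply: (@le_trans _ _ (euclid (x - y))); first exact: sqrtr_ge0.
by apply: ub_le_sup; [exact: supE.2|exists x => //; exists y].
Qed.

Lemma hausdorff_weight_ge0 A : (0 <= hausdorff_weight A)%E.
Proof.
by rewrite mule_ge0 ?measure_ge0// lee_fin exprn_ge0// divr_ge0// diam_ge0.
Qed.

Lemma hausdorff_sup_ge0 A : (0 <= hausdorff_sup A)%E.
Proof.
apply: le_trans (covering_ge0 _ _ hausdorff_weight_ge0 A) _.
by apply: ereal_sup_ubound; exists 1 => //=.
Qed.

Lemma hausdorff_sup0 : hausdorff_sup set0 = 0%E.
Proof.
apply/eqP; rewrite eq_le hausdorff_sup_ge0 andbT.
apply: ge_ereal_sup => _ [delta _ <-].
by rewrite /hausdorff_delta (covering0 _ _ hausdorff_weight_ge0).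
Qed.

Lemma le_hausdorff_sup :
  {homo hausdorff_sup : A B / A `<=` B >-> (A <= B)%E}.
Proof.
move=> A B AB; apply: ge_ereal_sup => _ [delta delta0 <-].
apply: (@le_trans _ _ (hausdorff_delta delta B)); first exact: le_covering.
by apply: ereal_sup_ubound; exists delta.
Qed.

Lemma hausdorff_sup_sigma_subadditive : sigma_subadditive hausdorff_sup.
Proof.
move=> F; apply: ge_ereal_sup => _ [delta delta0 <-].
apply: le_trans (covering_sigma_subadditive _ _ hausdorff_weight_ge0 F) _.
apply: lee_nneseries => i _; first by move=> _; exact: (covering_ge0 _ _ hausdorff_weight_ge0).
by apply: ereal_sup_ubound; exists delta.
Qed.

HB.instance Definition _ := isOuterMeasure.Build R 'M[R]_(n, m) hausdorff_sup
  hausdorff_sup0 hausdorff_sup_ge0 le_hausdorff_sup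
  hausdorff_sup_sigma_subadditive.

Definition hausdorff_outer : {outer_measure set 'M[R]_(n, m) -> \bar R} :=
  hausdorff_sup.

Definition hausdorff :
  {measure set (caratheodory_type hausdorff_outer) -> \bar R} :=
  hausdorff_outer.

End hausdorff.
Arguments hausdorff : clear implicits.

Section sobolev.
Context (R : realType) (n : nat).
Implicit Types f g phi : 'cV[R]_n -> R.

Definition partial (i : 'I_n) f : 'cV[R]_n -> R := 'D_(delta_mx i 0) f.

Definition smooth f : Prop :=
  forall s : seq 'I_n,
    continuous (foldr partial f s) /\
    forall i x, derivable (foldr partial f s) x (delta_mx i 0).

Definition test_function phi : Prop :=
  smooth phi /\ compact (closure [set x | phi x != 0]).

Definition in_Lp (p : R) f : Prop :=
  (f : caratheodory_type (lebesgue_outer R n) -> R) \in Lfun (leb R n) p%:E.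

Definition weak_partial (i : 'I_n) f g : Prop :=
  forall phi, test_function phi ->
    \int[leb R n]_x (f x * partial i phi x) = - \int[leb R n]_x (g x * phi x).

Definition is_weak_gradient (p : R) f (G : 'cV[R]_n -> 'cV[R]_n) : Prop :=
  forall i, in_Lp p (fun x => G x i 0) /\ weak_partial i f (fun x => G x i 0).

Definition W1p (p : R) : set ('cV[R]_n -> R) :=
  [set f | in_Lp p f /\ exists G, is_weak_gradient p f G].

(* The weak gradient of [f] in [W1p p], determined up to a Lebesgue null set;
   the value outside [W1p p] is junk. *)
Definition weak_gradient (p : R) f : 'cV[R]_n -> 'cV[R]_n :=
  xget (fun=> 0) [set G | is_weak_gradient p f G].

Definition normW1p (p : R) f : \bar R :=
  ('N[leb R n]_p%:E[EFin \o f] +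
   'N[leb R n]_p%:E[(fun x => (euclid (weak_gradient p f x))%:E)])%E.

(* The completion of the space of test functions, realized as its closure in
   [W1p p]. *)
Definition W01p (p : R) : set ('cV[R]_n -> R) :=
  [set f | W1p p f /\ forall eps : R, 0 < eps ->
    exists2 phi, test_function phi & (normW1p p (f \- phi)%R < eps%:E)%E].

Definition ball_average f (x : 'cV[R]_n) (r : R) : R :=
  let B := [set y | euclid (y - x) < r] in
  (\int[leb R n]_(y in B) f y) / fine (leb R n B).

(* The precise representative of [f]: the limit of its averages over shrinking
   balls where this limit exists, and [0] elsewhere. *)
Definition precise f (x : 'cV[R]_n) : R :=
  if pselect (cvg (ball_average f x @ 0^'+)) then
    lim (ball_average f x @ 0^'+)
  else 0.

End sobolev.

Section capacity.
Context (R : realType) (n m : nat).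
Implicit Types (p : R) (Q : set 'rV[R]_m) (K : set 'cV[R]_n).

Definition convex_body_with_origin Q : Prop :=
  [/\ compact Q, convex_set Q, interior Q !=set0 & Q 0].

(* The supremum is a maximum, [Q] being compact and nonempty. *)
Definition support_function Q (x : 'rV[R]_m) : R := sup [set dotmx x y | y in Q].

Definition sphere : set 'M[R]_(n, m) := [set u | euclid u = 1].

Definition directional_gradient p (u : 'M[R]_(n, m)) (f : 'cV[R]_n -> R)
    (x : 'cV[R]_n) : 'rV[R]_m :=
  (weak_gradient p f x)^T *m u.

(* [Lnorm] takes absolute values, which changes nothing here: the support
   function is nonnegative because [Q] contains the origin. *)
Definition gradient_norm p Q (f : 'cV[R]_n -> R) (u : 'M[R]_(n, m)) : \bar R :=
  'N[leb R n]_p%:E[(fun x =>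
    (support_function Q (directional_gradient p u f x))%:E)]%E.

(* Negative powers are inverses of positive ones: in [\bar R] the library has
   [0^-1 = +oo] and [+oo^-1 = 0], whereas its [0 `^ r] is [0] and its
   [+oo `^ r] is [+oo] for negative [r]. *)
Definition affine_energy p Q (f : 'cV[R]_n -> R) : \bar R :=
  (((\int[hausdorff R n m (n * m).-1]_(u in sphere)
       (gradient_norm p Q f u `^ (n * m)%:R)^-1)
    `^ (p / (n * m)%:R))^-1)%E.

(* Elements of [W01p p] are classes of functions modulo null sets; they are
   evaluated at points through their precise representative. If arbitrary
   representatives were allowed in [classA], or if the inequality were only
   required almost everywhere, the capacity of every null set would be 0 (the
   indicator of a null set is a representative of the zero class), whereas
   [classD] gives a sphere the positive capacity of the ball it bounds. *)
Definition classA p K : set ('cV[R]_n -> R) :=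
  [set f | W01p p f /\ forall x, \1_K x <= precise f x].

Definition classB p K : set ('cV[R]_n -> R) :=
  [set f | W01p p f /\ forall x, K x -> 1 <= precise f x].

Definition classD p K : set ('cV[R]_n -> R) :=
  [set f | [/\ W01p p f, forall x, 0 <= precise f x <= 1 &
    exists U, [/\ open U, K `<=` U & forall x, U x -> precise f x = 1]]].

Definition affine_capacity p Q K : \bar R :=
  ereal_inf [set affine_energy p Q f | f in classA p K].

End capacity.

(* Main.v *)
Require Import Defs.
From mathcomp Require Import all_boot all_order all_algebra.
From mathcomp Require Import all_classical all_reals all_analysis.
From mathcomp Require Import measurable_realfun ring lra.
Import Order.TTheory GRing.Theory Num.Theory.
Import numFieldNormedType.Exports.
Local Open Scope classical_set_scope.
Local Open Scope ring_scope.

Set Implicit Arguments.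
Unset Strict Implicit.
Unset Printing Implicit Defensive.

(* As classD is contained in classA and classA in classB, only the infimum over
   classD must be compared with the one over classB. Given [f] in classB, pick a
   test function [phi] close to [f] in the Sobolev norm. Where [phi] is not
   almost 1 on [K], the averages of [f - phi] over small balls are bounded below,
   uniformly on each member of a sequence of sets increasing to this part of [K].
   Convex combinations of translates of a test function close to [f - phi] are
   then large on these sets and have small Dirichlet energy; since this energy
   is submodular for the lattice operations, the capacity is continuous along
   increasing sequences of sets, which gives one test function [w] of small
   energy that is large on the whole part. The maximum of [phi] and [w],
   truncated to [0, 1], is the competitor in classD. Maxima and truncations are
   smoothed, so that all competitors remain test functions, for which precise
   representatives and weak gradients are explicit. Passing to the limit in the
   integral over the sphere requires no measurability in [u], because this
   integral is a supremum over bounded simple functions. *)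
(** * Smooth functions *)

(** The obstacle is that [1 <= precise f x] on [K] concerns limits of averages at points, while
    closeness in the Sobolev norm controls no point values and [f] satisfies no bound near [K].
    Averages over balls of one fixed radius, in contrast, depend continuously on [f] in [L_p],
    uniformly in the center; the exhausting sets are defined so that one radius serves each of them.
    These radii may tend to 0, so the energy estimates must not see them: averaging is a convex
    combination of translates, and convexity with translation invariance keeps the energy below that
    of the averaged function. Two degrees of precision coexist. For the correction [w] only
    smallness counts, hence a Dirichlet energy summed over coordinates and crude constants. In front
    of the gradient of [f], the factor must tend to 1, uniformly in [u]; hence a smoothing parameter
    and a smooth positive part with derivative in [[0, 1]]. Finally, [weak_gradient] is a choice
    among weak gradients: even for a test function it is known only almost everywhere, through the
    fundamental lemma of the calculus of variations. *)

Section smooth_calculus.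
Context (R : realType) (n : nat).
Implicit Types (f g : 'cV[R]_n -> R) (b : R -> R) (i : 'I_n).

Definition smooth1 b : Prop := forall k x, derivable (derive1n k b) x 1.

Lemma smooth1_derivable b : smooth1 b -> forall x, derivable b x 1.
Proof. by move=> sb x; exact: (sb 0%N x). Qed.

Lemma smooth1_continuous b : smooth1 b -> continuous b.
Proof.
move=> sb x; have /derivable1_diffP := @smooth1_derivable _ sb x.
exact: differentiable_continuous.
Qed.

Lemma smooth1_derive b : smooth1 b -> smooth1 (derive1 b).
Proof. by move=> sb k x; rewrite -derive1Sn; exact: sb. Qed.

(** Only a directional derivative of [f] is available, not differentiability, so the chain rule is
    taken on the line [h *: v + x], where it is one-dimensional. *)
Lemma derivable_compr (b : R -> R) f x v :
  derivable f x v -> derivable b (f x) 1 ->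
  derivable (b \o f) x v /\ 'D_v (b \o f) x = derive1 b (f x) * 'D_v f x.
Proof.
move=> df db; set F := fun h : R => f (h *: v + x).
have F0 : F 0 = f x by rewrite /F scale0r add0r.
have dF : derivable F 0 1 by exact: (derivable1P f x v).1 df.
have {}db : derivable b (F 0) 1 by rewrite F0; exact: db.
have dbF : derivable (b \o F) 0 1.
  apply/derivable1_diffP/differentiable_comp; first exact/derivable1_diffP.
  exact/derivable1_diffP.
split; first exact: (derivable1P _ _ _).2 dbF.
have E g : 'D_v g x = derive1 (fun h : R => g (h *: v + x)) 0.
  rewrite derive1E /derive; set F1 := fun h => _; set F2 := fun h => _ : R.
  suff -> : F1 = F2 by [].
  by apply/funext => h; rewrite /F1 /F2/= scale0r !add0r addr0 [h *: 1]mulr1.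
rewrite (E f) -/F -F0; apply: etrans (derive1_comp dF db).
exact: E.
Qed.

Lemma derivable_translate f a x v :
  derivable f (x + a) v -> derivable (fun y => f (y + a)) x v.
Proof.
rewrite /derivable; set F1 := fun h => _ : R; set F2 := fun h => _ : R.
suff -> : F1 = F2 by [].
by apply/funext => h; rewrite /F1 /F2/= addrA.
Qed.

Lemma derive_translate f a x v : 'D_v (fun y => f (y + a)) x = 'D_v f (x + a).
Proof.
rewrite /derive; set F1 := fun h => _ : R; set F2 := fun h => _ : R.
suff -> : F1 = F2 by [].
by apply/funext => h; rewrite /F1 /F2/= addrA.
Qed.

Lemma continuous_translate (a : 'cV[R]_n) : continuous (fun x : 'cV[R]_n => x + a).
Proof. by move=> x; exact: (cvgD cvg_id (cvg_cst a)). Qed.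

(** Smoothness quantifies over all iterated partial derivatives, so closing it under products or
    compositions directly would require formulas of every order. This inductive class is stable
    under one partial derivative and its members are continuous and derivable; smoothness then
    follows by induction on the list of directions. *)
Inductive smooth_closure : ('cV[R]_n -> R) -> Prop :=
| closure_base f : smooth f -> smooth_closure f
| closure_cst c : smooth_closure (fun=> c)
| closure_coord i : smooth_closure (fun x => x i 0)
| closure_translate f a : smooth_closure f -> smooth_closure (fun x => f (x + a))
| closure_add f g :
    smooth_closure f -> smooth_closure g -> smooth_closure (fun x => f x + g x)
| closure_mul f g :
    smooth_closure f -> smooth_closure g -> smooth_closure (fun x => f x * g x)
| closure_comp b f :
    smooth1 b -> smooth_closure f -> smooth_closure (fun x => b (f x)).

Lemma smooth_partial f i : smooth f -> smooth (partial i f).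
Proof. by move=> sf s; rewrite -foldr_rcons; exact: sf. Qed.

Lemma smooth_closure_step f : smooth_closure f ->
  [/\ continuous f, forall i x, derivable f x (delta_mx i 0) &
      forall i, smooth_closure (partial i f)].
Proof.
elim=> {f}.
- move=> f sf; have [cf df] := sf [::].
  by split => // i; exact/closure_base/smooth_partial.
- move=> c; split=> [|i x|i]; [exact: cst_continuous|exact: derivable_cst|].
  rewrite (_ : partial i _ = fun=> 0); first exact: closure_cst.
  by apply/funext => x; exact: derive_cst.
- move=> j; have dj i (x : 'cV[R]_n) : is_derive x (delta_mx i 0 : 'cV[R]_n)
      (fun x : 'cV[R]_n => x j 0) ((j == i)%:R).
    have : is_derive x (delta_mx i 0 : 'cV[R]_n) id (delta_mx i 0).
      exact: is_derive_id.
    case=> dx Dx; have /derivable_mxP/(_ j 0) dxj := dx.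
    apply: DeriveDef => //.
    have := derive_mx dx; rewrite Dx => /matrixP/(_ j 0).
    by rewrite !mxE eqxx andbT => <-.
  split=> [|i x|i]; [exact: coord_continuous|by have [] := dj i x|].
  rewrite (_ : partial i _ = fun=> (j == i)%:R); first exact: closure_cst.
  by apply/funext => x; have [_] := dj i x.
- move=> f a _ [cf df sf]; split=> [x|i x|i].
  + by apply: (continuous_comp (@continuous_translate a x)); exact: cf.
  + exact/derivable_translate/df.
  + rewrite (_ : partial i _ = fun x => partial i f (x + a)).
      exact: closure_translate.
    by apply/funext => x; exact: derive_translate.
- move=> f g _ [cf df sf] _ [cg dg sg]; split=> [x|i x|i].
  + exact: (cvgD (cf x) (cg x)).
  + exact: derivableD.
  + rewrite (_ : partial i _ = fun x => partial i f x + partial i g x).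
      exact: closure_add.
    by apply/funext => x; exact: deriveD.
- move=> f g af [cf df sf] ag [cg dg sg]; split=> [x|i x|i].
  + exact: (cvgM (cf x) (cg x)).
  + exact: derivableM.
  + rewrite (_ : partial i _ = fun x => f x * partial i g x + g x * partial i f x).
      by apply: closure_add; apply: closure_mul.
    by apply/funext => x; rewrite /partial deriveM.
- move=> b f sb af [cf df sf]; split=> [x|i x|i].
  + exact: (continuous_comp (cf x) (@smooth1_continuous _ sb (f x))).
  + by have [] := derivable_compr (df i x) (@smooth1_derivable _ sb (f x)).
  + rewrite (_ : partial i _ = fun x => derive1 b (f x) * partial i f x).
      apply: closure_mul => //; apply: closure_comp => //.
      exact: smooth1_derive.
    apply/funext => x.
    by have [] := derivable_compr (df i x) (@smooth1_derivable _ sb (f x)).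
Qed.

Lemma smooth_closureW f : smooth_closure f -> smooth f.
Proof.
move=> sf s; have : smooth_closure (foldr (@partial R n) f s).
  by elim: s => //= i s ih; have [_ _] := smooth_closure_step ih.
by case/smooth_closure_step.
Qed.

End smooth_calculus.

(** * A smooth positive part built from flat functions *)

Section smooth_positive_part.
Context (R : realType) (e : R).
Hypothesis e_gt0 : 0 < e.

Definition flat (p : {poly R}) (t : R) : R :=
  if 0 < t then p.[t^-1] * expR (- (e * t^-1)) else 0.

Lemma expR_ge_pow (k : nat) (x : R) : 0 <= x -> (x / k.+1%:R) ^+ k.+1 <= expR x.
Proof.
move=> x0; have -> : expR x = expR (x / k.+1%:R) ^+ k.+1.
  by rewrite -expRM_natl -mulr_natl mulrC divfK.
rewrite lerXn2r ?nnegrE ?expR_ge0 ?divr_ge0//.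
by apply: le_trans (expR_ge1Dx _); rewrite lerDr.
Qed.

(** Against the monomial of degree [i], the exponential is bounded below by [expR_ge_pow] with
    exponent [i.+1], one more than the degree: one factor [t] remains, with constant [c i]. *)
Lemma flat_bound p : exists C, forall t, `|flat p t| <= C * `|t|.
Proof.
pose c (i : nat) : R := (i.+1%:R / e) ^+ i.+1.
exists (\sum_(i < size p) `|p`_i| * c i) => t.
rewrite /flat; case: ifPn => [t0|_]; last first.
  rewrite normr0 mulr_ge0// sumr_ge0// => i _.
  by rewrite mulr_ge0// exprn_ge0// divr_ge0// ltW.
rewrite normrM (ger0_norm (expR_ge0 _)) (gtr0_norm t0) horner_coef.
apply: (@le_trans _ _ ((\sum_(i < size p) `|p`_i| * t^-1 ^+ i) * expR (- (e * t^-1)))).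
  rewrite ler_wpM2r ?expR_ge0// (le_trans (ler_norm_sum _ _ _))//.
  apply: ler_sum => i _.
  by rewrite normrM (ger0_norm (_ : 0 <= t^-1 ^+ i))// exprn_ge0// invr_ge0 ltW.
rewrite !mulr_suml ler_sum// => i _; rewrite -!mulrA ler_wpM2l//.
rewrite expRN ler_pdivrMr ?expR_gt0//.
have et0 : 0 <= e * t^-1 by rewrite mulr_ge0 ?invr_ge0// ltW.
have := expR_ge_pow i et0; set E := expR _ => HE.
have c0 : 0 <= c i * t by rewrite mulr_ge0 ?exprn_ge0 ?divr_ge0// ltW.
apply: le_trans (ler_wpM2l c0 HE).
rewrite /c mulrAC -exprMn.
have -> : i.+1%:R / e * (e * t^-1 / i.+1%:R) = t^-1.
  have : (i.+1%:R : R) != 0 by rewrite pnatr_eq0.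
  have : e != 0 by rewrite gt_eqF.
  have : t != 0 by rewrite gt_eqF.
  by move: (i.+1%:R : R) => a t0' e0 a0; field; apply/and3P.
by rewrite exprS mulrAC mulVf ?mul1r// gt_eqF.
Qed.

(** The difference quotient at 0 is [flat p h], which tends to 0 by [flat_bound]. The factor [t] is
    no restriction for flat functions, as [flat p t] equals [flat ('X * p) t * t]. *)
Lemma derive_at0 (f : R -> R) (p : {poly R}) :
  (forall t, f t = flat p t * t) -> is_derive (0 : R) 1 f 0.
Proof.
move=> fE; suff H : h^-1 *: ((f \o shift 0) (h *: 1) - f 0) @[h --> 0^'] --> (0 : R).
  by apply: DeriveDef; [apply/cvg_ex; exists 0|exact/cvg_lim].
have [C hC] := flat_bound p.
have C0 : 0 < `|C| + 1 by rewrite ltr_wpDl.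
apply/cvgr0Pnorm_le => eps eps0; near=> h.
have h0 : h != 0 by near: h; exact: nbhs_dnbhs_neq.
rewrite /= addr0 [h%:A]mulr1 !fE mulr0 subr0 [_ *: _]mulrC mulfK//.
apply: (le_trans (hC h)); apply: (@le_trans _ _ ((`|C| + 1) * `|h|)).
  by rewrite ler_wpM2r// (le_trans (ler_norm _))// lerDl.
rewrite -ler_pdivlMl//; near: h; apply: dnbhs0_le.
by apply: mulr_gt0; [rewrite invr_gt0|exact: eps0].
Unshelve. all: by end_near. Qed.

Lemma is_derive_flat p (t : R) :
  is_derive t 1 (flat p) (flat ('X^2 * (e *: p - p^`())) t).
Proof.
have [t0|t0|->] := ltgtP t 0.
- have -> : flat ('X^2 * (e *: p - p^`())) t = 0 by rewrite /flat ltNge (ltW t0).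
  apply: (@near_eq_is_derive _ _ _ (cst 0)); rewrite ?oner_eq0//.
  near=> x; rewrite /flat ifF//.
  by apply/negbTE; rewrite -leNgt; apply/ltW; near: x; exact: lt_nbhsl.
- pose g (x : R) := p.[x^-1] * expR (- (e * x^-1)).
  apply: (@near_eq_is_derive _ _ _ g); rewrite ?oner_eq0//.
    by near=> x; rewrite /flat ifT//; near: x; exact: lt_nbhsr.
  have tn0 : t != 0 by rewrite gt_eqF.
  have di : is_derive t (1 : R) (fun x : R => x^-1) (- t^-1 ^+ 2).
    apply: DeriveDef; first exact: derivableV.
    by rewrite deriveV// derive_id [_ *: _]mulr1 exprVn.
  have dp : is_derive t (1 : R) (fun x => p.[x^-1]) (- t^-1 ^+ 2 * p^`().[t^-1]).
    have := @is_derive1_comp _ (horner p) (fun x : R => x^-1) t _ _ _ di.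
    move=> /(_ (p^`().[t^-1]) (is_derive_poly p _)) h.
    by apply: is_derive_eq h _; rewrite mulrC.
  have de : is_derive t (1 : R) (fun x : R => expR (- (e * x^-1)))
      (e * t^-1 ^+ 2 * expR (- (e * t^-1))).
    have d1 : is_derive t (1 : R) (fun x : R => - (e * x^-1)) (e * t^-1 ^+ 2).
      have h : is_derive t (1 : R) (- (e \*: (fun x : R => x^-1))) (- (e * - t^-1 ^+ 2)).
        by apply: is_deriveN; exact: is_deriveZ.
      by apply: is_derive_eq h _; rewrite mulrN opprK.
    have := @is_derive1_comp _ expR _ t _ _ (is_derive_expR _) d1.
    by move=> h; apply: is_derive_eq h _; rewrite mulrC.
  have := is_deriveM dp de => h; apply: is_derive_eq h _.
  rewrite /flat t0 !hornerE /= /GRing.scale/=; ring.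
- have -> : flat ('X^2 * (e *: p - p^`())) 0 = 0 by rewrite /flat ltxx.
  apply: (@derive_at0 _ ('X * p)) => s; rewrite /flat.
  case: ifPn => [s0|]; last by rewrite mul0r.
  by rewrite hornerM hornerX; field; rewrite gt_eqF.
Unshelve. all: by end_near. Qed.

Lemma smooth1_flat p : smooth1 (flat p).
Proof.
move=> k x; suff [q ->] : exists q, derive1n k (flat p) = flat q.
  by have [] := is_derive_flat q x.
elim: k => [|k [q ih]]; first by exists p.
exists ('X^2 * (e *: q - q^`())); rewrite derive1nS ih; apply/funext => t.
by rewrite derive1E; have [_] := is_derive_flat q t.
Qed.

(* A smooth substitute for the positive part. *)
Definition smooth_pos (t : R) : R :=
  if 0 < t then t * expR (- (e * t^-1)) else 0.

Lemma is_derive_smooth_pos (t : R) :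
  is_derive t 1 smooth_pos (flat (1 + e *: 'X) t).
Proof.
have E : smooth_pos = (fun t => flat 1 t * t).
  apply/funext => s; rewrite /smooth_pos /flat; case: ifP; last by rewrite mul0r.
  by rewrite hornerE mul1r mulrC.
have [->|t0] := eqVneq t 0.
  have -> : flat (1 + e *: 'X) 0 = 0 by rewrite /flat ltxx.
  by apply: (@derive_at0 _ 1) => s; rewrite E.
rewrite E; have h := is_deriveM (is_derive_flat 1 t) (is_derive_id t 1).
apply: is_derive_eq h _; rewrite /flat; case: ifP => _; rewrite /GRing.scale/= ?mulr0 ?addr0 ?mul0r//.
by rewrite !hornerE derivC !hornerE /=; field.
Qed.

Lemma smooth1_smooth_pos : smooth1 smooth_pos.
Proof.
move=> [|k] x; first by have [] := is_derive_smooth_pos x.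
rewrite derive1Sn (_ : derive1 smooth_pos = flat (1 + e *: 'X)).
  exact: smooth1_flat.
by apply/funext => t; rewrite derive1E; have [_] := is_derive_smooth_pos t.
Qed.

(** For [t > 0] the derivative is [(1 + x) * expR (- x)] with [x = e / t], and [1 + x <= expR x].
    This range turns gradients of smoothed maxima and minima into convex combinations. *)
Lemma derive_smooth_pos t : 0 <= derive1 smooth_pos t <= 1.
Proof.
have [_] := is_derive_smooth_pos t; rewrite derive1E => ->; rewrite /flat.
case: ifPn => [t0|_]; last by rewrite lexx ler01.
rewrite !hornerE expRN.
have x0 : 0 <= e * t^-1 by rewrite mulr_ge0 ?invr_ge0// ltW.
rewrite divr_ge0 ?expR_ge0 ?addr_ge0//=.
by rewrite ler_pdivrMr ?expR_gt0// mul1r expR_ge1Dx.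
Qed.

Lemma smooth_pos_ge0 t : 0 <= smooth_pos t.
Proof. by rewrite /smooth_pos; case: ifPn => // t0; rewrite mulr_ge0 ?expR_ge0 ?ltW. Qed.

Lemma smooth_pos_le0 t : t <= 0 -> smooth_pos t = 0.
Proof. by rewrite /smooth_pos ltNge => ->. Qed.

Lemma smooth_pos_le t : 0 <= t -> smooth_pos t <= t.
Proof.
rewrite /smooth_pos; case: ifPn => // t0 _.
rewrite ler_piMr ?(ltW t0)// expR_le1 oppr_le0.
by rewrite mulr_ge0 ?invr_ge0// ltW.
Qed.

Lemma smooth_pos_geB t : t - e <= smooth_pos t.
Proof.
rewrite /smooth_pos; case: ifPn => [t0|]; last first.
  by rewrite -leNgt => t0; rewrite subr_le0 (le_trans t0)// ltW.
have := expR_ge1Dx (- (e * t^-1)); rewrite -(ler_pM2l t0).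
by apply: le_trans; rewrite mulrDr mulr1 mulrN mulrCA divff ?mulr1// gt_eqF.
Qed.

Lemma smooth_pos_gt0 t : 0 < t -> 0 < smooth_pos t.
Proof. by rewrite /smooth_pos => t0; rewrite t0 mulr_gt0 ?expR_gt0. Qed.

Lemma smooth_pos_nondecreasing : {homo smooth_pos : x y / x <= y}.
Proof.
move=> x y xy; apply: (@ger0_derive1_ndecr _ _ x y) => //.
- by move=> z _; exact: (@smooth1_derivable _ _ smooth1_smooth_pos z).
- by move=> z _; have /andP[] := derive_smooth_pos z.
- apply: continuous_subspaceT; exact: smooth1_continuous smooth1_smooth_pos.
Qed.

End smooth_positive_part.

(** * Lebesgue measure *)

Section esum_subset.
Context (R : realType) (I : choiceType).

Lemma esum_subset (J K : set I) (w : I -> \bar R) :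
  (forall i, 0 <= w i)%E -> J `<=` K ->
  (\esum_(i in J) w i <= \esum_(i in K) w i)%E.
Proof.
move=> w0 JK; rewrite esum_mkcond [leRHS]esum_mkcond; apply: le_esum => i _.
have [iJ|_] := boolP (i \in J); last by case: ifP.
by rewrite (mem_set (JK _ (set_mem iJ))).
Qed.

(** [g] need not be injective: a choice [s] of preimages rewrites the sum over the image as a sum
    over a subset of [J]. *)
Lemma esum_image_le (J : set I) (g : I -> I) (w : I -> \bar R) :
  (forall i, 0 <= w i)%E ->
  (\esum_(i in g @` J) w i <= \esum_(j in J) w (g j))%E.
Proof.
move=> w0.
have /choice[s sP] : forall c, exists j, (g @` J) c -> J j /\ g j = c.
  by move=> c; have [[j Jj <-]|?] := pselect ((g @` J) c); [exists j|exists c].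
have -> : \esum_(c in g @` J) w c = \esum_(c in g @` J) w (g (s c)).
  by apply: eq_esum => c gJc; rewrite (sP c gJc).2.
rewrite -(@esum_image _ _ _ (g @` J) s (w \o g)); last first.
  by move=> c d; rewrite !inE => /sP[_ {2}<-] /sP[_ {2}<-] ->.
by apply: esum_subset => [j|_ [c /sP[Jc _] <-]//]; exact: w0.
Qed.

End esum_subset.

Section lebesgue_measure_facts.
Context (R : realType) (n : nat).
Local Notation E := 'cV[R]_n.
Local Notation T := (caratheodory_type (lebesgue_outer R n)).
Local Notation mu := (leb R n).
Implicit Types (a b t x y : E) (A : set E).

(** Covers are sets of corner pairs, so transforming every box of a cover may identify some of them;
    this can only decrease the total volume. *)
Lemma lebesgue_covering_le (J : set (E * E)) (g : E * E -> E * E) A :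
  countable J -> A `<=` \bigcup_(j in J) box (g j) ->
  (lebesgue_covering A <= \esum_(j in J) box_volume (g j))%E.
Proof.
move=> cJ AJ.
apply: le_trans (esum_image_le J g (@box_volume_ge0 R n)).
apply: ereal_inf_lbound; exists (g @` J) => //; split => //.
  exact: card_le_trans (card_image_le _ _) cJ.
by move=> x /AJ[j Jj gjx]; exists (g j) => //; exists j.
Qed.

Lemma box_volume_split (i : 'I_n) (t : R) (ab : E * E) :
  box_volume ab =
  (box_volume (ab.1, (\col_k (if k == i then Num.min (ab.2 k 0) t else ab.2 k 0))%R) +
   box_volume ((\col_k (if k == i then Num.max (ab.1 k 0) t else ab.1 k 0))%R, ab.2))%E.
Proof.
rewrite /box_volume -EFinD; congr EFin; rewrite /=.
rewrite (bigD1 i)//= [in X in _ = X + _](bigD1 i)//= [in X in _ = _ + X](bigD1 i)//=.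
rewrite !mxE eqxx.
rewrite [in X in _ = X + _](eq_bigr (fun k => Num.max 0 (ab.2 k 0 - ab.1 k 0))); last first.
  by move=> k /negbTE ki; rewrite mxE ki.
rewrite [in X in _ = _ + X](eq_bigr (fun k => Num.max 0 (ab.2 k 0 - ab.1 k 0))); last first.
  by move=> k /negbTE ki; rewrite mxE ki.
rewrite -mulrDl; congr (_ * _); set a := ab.1 i 0; set b := ab.2 i 0.
rewrite /Num.max /Num.min /Order.max /Order.min; do ![case: ifP]; lra.
Qed.

(* The hyperplane cuts a box into two boxes whose volumes add up. *)
Lemma halfspace_caratheodory (i : 'I_n) (t : R) (H : set E) :
  (forall x, x i 0 < t -> H x) -> (forall x, H x -> x i 0 <= t) ->
  (lebesgue_outer R n).-caratheodory H.
Proof.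
move=> ltH Hle; apply: le_caratheodory_measurable => X.
apply: le_ereal_inf_tmp => _ [J [_ cJ XJ] <-].
pose f (ab : E * E) : E * E :=
  (ab.1, (\col_k (if k == i then Num.min (ab.2 k 0) t else ab.2 k 0))%R).
pose g (ab : E * E) : E * E :=
  ((\col_k (if k == i then Num.max (ab.1 k 0) t else ab.1 k 0))%R, ab.2).
have -> : (\esum_(j in J) box_volume j =
    \esum_(j in J) box_volume (f j) + \esum_(j in J) box_volume (g j))%E.
  rewrite -esumD//; last 2 first.
  - by move=> *; exact: box_volume_ge0.
  - by move=> *; exact: box_volume_ge0.
  by apply: eq_esum => j _; exact: box_volume_split.
apply: leeD; apply: lebesgue_covering_le => //.
- move=> x [/XJ[j Jj jx] /Hle xt]; exists j => // k /=; have /andP[-> jk] := jx k.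
  by rewrite mxE; case: ifP => [/eqP ->|_]//=; rewrite le_min xt andbT; have /andP[] := jx i.
- move=> x [/XJ[j Jj jx] /= nHx]; exists j => // k /=; have /andP[jk ->] := jx k.
  rewrite mxE andbT; case: ifP => [/eqP ->|_]//=; rewrite ge_max.
  have /andP[-> _] := jx i; rewrite leNgt; apply/negP => /ltH; exact: nHx.
Qed.

Lemma measurable_coord_le (i : 'I_n) (t : R) :
  measurable ([set x : E | x i 0 <= t] : set T).
Proof. by apply: (@halfspace_caratheodory i t) => // x /ltW. Qed.

Lemma measurable_coord_lt (i : 'I_n) (t : R) :
  measurable ([set x : E | x i 0 < t] : set T).
Proof. by apply: (@halfspace_caratheodory i t) => // x /ltW. Qed.

Lemma measurable_box (ab : E * E) : measurable (box ab : set T).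
Proof.
rewrite (_ : box ab = \bigcap_(i in [set: 'I_n])
    (~` [set x : E | x i 0 < ab.1 i 0] `&` [set x : E | x i 0 <= ab.2 i 0])).
  apply: fin_bigcap_measurable => // i _; apply: measurableI.
    by apply: measurableC; exact: measurable_coord_lt.
  exact: measurable_coord_le.
apply/seteqP; split => x.
  move=> xab i _ /=; have /andP[ax xb] := xab i; split => //.
  by apply/negP; rewrite -leNgt.
by move=> xab i; have [/= /negP] := xab i Logic.I; rewrite -leNgt => -> ->.
Qed.

Lemma open_rat_box (U : set E) x : open U -> U x ->
  exists q : 'cV[rat]_n * 'cV[rat]_n,
    box (map_mx ratr q.1, map_mx ratr q.2) x /\
    box (map_mx ratr q.1, map_mx ratr q.2) `<=` U.
Proof.
move=> oU Ux; have /nbhs_ballP[e /= e0 eU] : nbhs x U by exact: open_nbhs_nbhs.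
have /choice[p pP] : forall i, exists p, ratr p \in `](x i 0 - e), (x i 0)[%R.
  by move=> i; have [p pP] := @rat_in_itvoo R (x i 0 - e) (x i 0) ltac:(lra); exists p.
have /choice[q qP] : forall i, exists q, ratr q \in `](x i 0), (x i 0 + e)[%R.
  by move=> i; have [q qP] := @rat_in_itvoo R (x i 0) (x i 0 + e) ltac:(lra); exists q.
exists ((\col_i p i)%R, (\col_i q i)%R); split => [i|y xy].
  by have := pP i; have := qP i; rewrite !mxE !in_itv/= => /andP[? _] /andP[_ ?]; rewrite !ltW.
apply: eU; split => // i j; rewrite ord1 /ball/= ltr_norml.
have := xy i; have := pP i; have := qP i; rewrite !mxE !in_itv/= => /andP[? ?] /andP[? ?] /andP[? ?].
by apply/andP; split; lra.
Qed.

Lemma open_measurable_leb (U : set E) : open U -> measurable (U : set T).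
Proof.
move=> oU; pose B (q : 'cV[rat]_n * 'cV[rat]_n) : set E :=
  box (map_mx ratr q.1, map_mx ratr q.2).
rewrite (_ : U = \bigcup_q (if `[< B q `<=` U >] then B q else set0)).
  apply: countable_bigcupT_measurable => [|q]; first exact: countableP.
  by case: ifP => _; [exact: measurable_box|exact: measurable0].
apply/seteqP; split=> [x Ux|x [q _]]; last first.
  by case: ifPn => // /asboolP; apply.
have [q [Bx BU]] := open_rat_box oU Ux; exists q => //.
by case: ifPn => // /asboolP.
Qed.

Lemma continuous_measurable_leb (f : E -> R) :
  continuous f -> measurable_fun setT (f : T -> R).
Proof.
move=> cf; apply: (measurability _ (RGenOInfty.measurableE R)) => //.
move=> _ [_ [t ->] <-]; rewrite setTI; apply: open_measurable_leb.
by apply: open_comp => // x _; exact: cf.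
Qed.

Lemma leb_box_lty (ab : E * E) : (mu (box ab) < +oo)%E.
Proof.
apply: (@le_lt_trans _ _ (box_volume ab)); last by rewrite ltry.
have := @lebesgue_covering_le [set ab] id (box ab) (countable1 _).
rewrite esum_set1 ?box_volume_ge0//; apply.
by move=> x xab; exists ab.
Qed.

Lemma leb_bounded_lty A ab : A `<=` box ab -> (mu A < +oo)%E.
Proof.
by move=> Aab; apply: le_lt_trans (leb_box_lty ab); exact: le_outer_measure.
Qed.

Definition translate (a : E) : T -> T := fun x => x + a.

Lemma leb_translate a A : mu (translate a @^-1` A) = mu A.
Proof.
suff le1 (c : E) (B : set E) : (mu (translate c @^-1` B) <= mu B)%E.
  apply/eqP; rewrite eq_le le1/=.
  apply: le_trans (le1 (- a) (translate a @^-1` A)); apply: le_outer_measure => x Ax.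
  by rewrite /translate/= subrK.
apply: le_ereal_inf_tmp => _ [J [_ cJ BJ] <-].
have := @lebesgue_covering_le J (fun ab => (ab.1 - c, ab.2 - c)) (translate c @^-1` B) cJ.
rewrite (_ : esum _ _ = \esum_(j in J) box_volume j)%E.
  apply=> x /BJ[j Jj jx]; exists j => // i /=.
  by have /andP[h1 h2] := jx i; rewrite /translate !mxE in h1 h2 *; rewrite lerBlDr h1 lerBrDr h2.
apply: eq_esum => j _; congr EFin; apply: eq_bigr => i _ /=; rewrite !mxE.
by congr Num.max; ring.
Qed.

Lemma measurable_translate a : measurable_fun setT (translate a).
Proof.
move=> _ B mB; rewrite setTI.
have {}mB : (lebesgue_outer R n).-caratheodory B := mB.
suff : (lebesgue_outer R n).-caratheodory (translate a @^-1` B) by [].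
move=> X; have shift (C : set E) :
  lebesgue_outer R n C = lebesgue_outer R n (translate (- a) @^-1` C).
  by rewrite [RHS]leb_translate.
rewrite (shift X) (shift (X `&` _)) (shift (X `&` ~` _)) !preimage_setI.
have tK (C : set E) : translate (- a) @^-1` (translate a @^-1` C) = C.
  by apply/seteqP; split => x; rewrite /translate/= subrK.
by rewrite preimage_setC !tK; exact: mB.
Qed.

Lemma leb_pushforward_translate a (A : set T) :
  pushforward mu (translate a) A = mu A.
Proof. exact: leb_translate. Qed.

Lemma ge0_integral_translate a (f : T -> \bar R) (D : set T) :
  measurable D -> measurable_fun D f -> (forall x, D x -> 0 <= f x)%E ->
  (\int[mu]_(x in translate a @^-1` D) f (x + a)%R = \int[mu]_(x in D) f x)%E.
Proof.
move=> mD mf f0.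
have f0' : {in D, forall y, 0 <= f y}%E by move=> x; rewrite inE; exact: f0.
have := ge0_integral_pushforward (measurable_translate a) mu mD mf f0'.
rewrite /comp => <-.
apply: eq_measure_integral => [|mt A _ _]; first exact: measurable_translate.
exact: leb_pushforward_translate.
Qed.

End lebesgue_measure_facts.

(** * Positivity of the measure of the unit box and of open sets *)

Section lebesgue_positive.
Context (R : realType).

(* Induction on the dimension: integrate over the last coordinate the inequality
   for the slices. *)
Lemma box_cover_volume n (S : set nat) (a b : nat -> nat -> R) :
  (forall x : nat -> R, (forall i, (i < n)%N -> 0 <= x i <= 1) ->
     exists2 k, S k & forall i, (i < n)%N -> a k i <= x i <= b k i) ->
  (1 <= \sum_(k <oo)
     ((k \in S)%:R * \prod_(i < n) Num.max 0 (b k i - a k i))%:E)%E.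
Proof.
elim: n S => [|n ih] S cover.
  have [//|k Sk _] := cover (fun=> 0).
  rewrite nneseries_esumT; last by move=> j; rewrite big_ord0 mulr1 lee_fin.
  apply: esum_ge; exists [set k]; first by split.
  by rewrite fsbig_set1 big_ord0 mulr1 mem_set.
pose c k := (k \in S)%:R * \prod_(i < n) Num.max 0 (b k i - a k i).
have c0 k : 0 <= c k.
  by rewrite mulr_ge0// prodr_ge0// => i _; rewrite le_max lexx.
pose A k : set R := `[a k n, b k n]%classic.
have mA k : measurable (A k) by exact: measurable_itv.
have mi (D : set R) k : measurable_fun D (fun t => (\1_(A k) t)%:E : \bar R).
  apply/measurable_EFinP; apply: measurable_funTS; exact: measurable_indic.
have mh (D : set R) k : measurable_fun D (fun t => ((c k)%:E * (\1_(A k) t)%:E)%E).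
  by apply: emeasurable_funM => //; exact: mi.
pose D : set R := `[0, 1]%classic.
have mD : measurable D by exact: measurable_itv.
have step t : D t -> (1 <= \sum_(k <oo) ((c k)%:E * (\1_(A k) t)%:E))%E.
  rewrite /D/= in_itv/= => t01.
  (* At height [t] only the boxes whose last side contains [t] cover the slice. The index set [S] of
     the statement serves to discard the others. *)
  have {ih} := ih (S `&` [set k | A k t]) _.
  have cov : forall x : nat -> R, (forall i, (i < n)%N -> 0 <= x i <= 1) ->
      exists2 k, (S `&` [set k | A k t]) k & forall i, (i < n)%N -> a k i <= x i <= b k i.
    move=> x x01; have [|k Sk kx] := cover (fun i => if i == n then t else x i).
      move=> i; rewrite ltnS leq_eqVlt => /orP[/eqP->|ilt]; first by rewrite eqxx.
      by rewrite ltn_eqF// x01.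
    exists k; first by split => //; have := kx _ (ltnSn n); rewrite eqxx /A/= in_itv.
    by move=> i ilt; have := kx i (ltnW ilt); rewrite ltn_eqF.
  move=> /(_ cov)/le_trans; apply; apply: lee_nneseries => k _.
    by move=> _; rewrite lee_fin mulr_ge0// prodr_ge0// => i _; rewrite le_max lexx.
  rewrite -EFinM lee_fin /c in_setI indicE.
  have -> : (k \in [set k | A k t]) = (t \in A k) by apply/idP/idP; rewrite !inE.
  by case: (k \in S); case: (t \in A k); rewrite /= ?mul0r ?mul1r ?mulr0 ?mulr1.
have <- : (\int[lebesgue_measure]_(t in D) 1 = 1 :> \bar R)%E.
  rewrite integral_cst//= lebesgue_measure_itv/= lte_fin ltr01 mul1e.
  by rewrite oppr0 adde0.
apply: (@le_trans _ _ (\int[lebesgue_measure]_(t in D)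
    \sum_(k <oo) ((c k)%:E * (\1_(A k) t)%:E))%E).
  apply: ge0_le_integral => //.
  apply: (@ge0_emeasurable_sum _ _ _ _ (fun k t => (c k)%:E * (\1_(A k) t)%:E)%E xpredT) => [k t _ _|k _].
    by rewrite mule_ge0 ?lee_fin.
  exact: mh.
rewrite integral_nneseries//; last 2 first.
- by move=> k; exact: mh.
- by move=> *; rewrite mule_ge0 ?lee_fin.
apply: lee_nneseries => k _.
  by move=> _; apply: integral_ge0 => t _; rewrite mule_ge0 ?lee_fin.
rewrite ge0_integralZl//; last 2 first.
- exact: mi.
- by rewrite lee_fin.
have -> := integral_indic lebesgue_measure mD (mA k).
rewrite [leRHS](_ : _ = (c k)%:E * (Num.max 0 (b k n - a k n))%:E)%E; last first.
  by rewrite /c -EFinM big_ord_recr/= mulrA.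
rewrite lee_wpmul2l ?lee_fin//.
apply: (@le_trans _ _ (lebesgue_measure (A k))).
  apply: le_measure; rewrite ?inE; last exact: subIsetl.
    exact: (measurableI _ _ (mA k) mD).
  exact: mA.
rewrite lebesgue_measure_itv/= lte_fin; case: ifPn => ab.
  by rewrite -EFinB lee_fin le_max lexx orbT.
by rewrite lee_fin le_max lexx.
Qed.

(** A countable cover is enumerated by a set of natural numbers, and corners are padded by 0 beyond
    the dimension, because the inductive volume bound speaks of points of type [nat -> R] in order
    to keep one type for all dimensions. *)
Lemma leb_unit_box n : (1 <= leb R n (box (const_mx 0%R : 'cV[R]_n, const_mx 1%R : 'cV[R]_n)))%E.
Proof.
apply: le_ereal_inf_tmp => _ [J [_ cJ QJ] <-].
have /countable_bijP[S /card_esym/card_set_bijP[f bijf]] := cJ.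
rewrite (reindex_esum _ _ _ _ bijf).
have := @box_cover_volume n S (fun k i => if insub i is Some j then (f k).1 j 0 else 0)
  (fun k i => if insub i is Some j then (f k).2 j 0 else 0).
have E (F : 'I_n -> R) (i : 'I_n) : (if insub (val i) is Some j then F j else 0) = F i.
  by rewrite valK.
move=> /(_ _)/le_trans; apply.
  move=> x x01; have [|j Jj jx] := QJ (\col_i x i).
    by move=> i; rewrite !mxE x01.
  have [_ _ surj] := bijf; have [k Sk kj] := surj j Jj; exists k => // i ilt.
  by have := jx (Ordinal ilt); rewrite -kj mxE insubT.
rewrite esum_mkcond nneseries_esumT => [|k]; last first.
  by rewrite lee_fin mulr_ge0// prodr_ge0// => i _; rewrite le_max lexx.
apply: le_esum => k _; case: ifP => kS; last by rewrite mul0r.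
rewrite mul1r lee_fin; apply: ler_prod => i _.
by rewrite le_max lexx/= (E (fun j => (f k).1 j 0)) (E (fun j => (f k).2 j 0)).
Qed.

Lemma leb_setT_gt0 n : (0 < leb R n setT)%E.
Proof.
apply: lt_le_trans (_ : 1 <= _)%E; first exact: lte01.
by apply: le_trans (leb_unit_box n) _; exact: le_outer_measure.
Qed.

(** The translates of [U] by rational vectors are countably many and cover the space; if [U] were
    null, so would be the whole space. *)
Lemma leb_open_gt0 n (U : set 'cV[R]_n) : open U -> U !=set0 -> (0 < leb R n U)%E.
Proof.
move=> oU [x Ux]; rewrite lt_neqAle measure_ge0 andbT eq_sym; apply/eqP => U0.
have := leb_setT_gt0 n; rewrite lt_neqAle => /andP[/eqP + _]; apply; apply/esym.
pose V (q : 'cV[rat]_n) : set (caratheodory_type (lebesgue_outer R n)) :=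
  translate (map_mx ratr q) @^-1` U.
have mV q : measurable (V q).
  rewrite -[V q]setTI; apply: measurable_translate => //; exact: open_measurable_leb.
suff -> : setT = \bigcup_k oapp V set0 (unpickle k).
  apply: measure_negligible; last first.
    apply: negligible_bigcup => k; case: unpickle => [q|]; last exact: negligible_set0.
    apply/negligibleP; first exact: mV.
    by have := leb_translate (map_mx ratr q) U; rewrite U0.
  by apply: bigcupT_measurable => k; case: unpickle => [q|]; [exact: mV|exact: measurable0].
apply/seteqP; split => // y _.
suff [q Vqy] : exists q, V q y by exists (pickle q) => //; rewrite pickleK.
have /nbhs_ballP[e /= e0 eU] : nbhs x U by exact: open_nbhs_nbhs.
have /choice[p pP] : forall i, exists p, ratr p \in `](x i 0 - y i 0), (x i 0 - y i 0 + e)[%R.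
  by move=> i; have [p pP] := @rat_in_itvoo R (x i 0 - y i 0) (x i 0 - y i 0 + e) ltac:(lra); exists p.
exists (\col_i p i); apply: eU; split => // i j; rewrite ord1 /ball/= !mxE ltr_norml.
by have := pP i; rewrite in_itv/= => /andP[? ?]; apply/andP; split; lra.
Qed.
End lebesgue_positive.

(** * Test functions *)

Section test_functions.
Context (R : realType) (n : nat).
Local Notation E := 'cV[R]_n.
Local Notation T := (caratheodory_type (lebesgue_outer R n)).
Local Notation mu := (leb R n).
Implicit Types (f g phi psi : E -> R) (M : R) (x y : E) (i : 'I_n).

Definition cube M : set E := box (const_mx (- M), const_mx M).

Lemma cubeP M x : cube M x <-> forall i, `|x i 0| <= M.
Proof.
by split=> h i; have := h i; rewrite !mxE ler_norml.
Qed.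

Lemma le_cube M N : M <= N -> cube M `<=` cube N.
Proof. by move=> MN x /cubeP xM; apply/cubeP => i; exact: le_trans MN. Qed.

Lemma compact_cube M : compact (cube M).
Proof.
have tc : continuous (fun x : 'rV[R]_n => x^T : E).
  move=> x A [P /= Pn PA]; exists (fun k l => P l k) => [k l|y Py].
    by have := Pn l k; rewrite mxE.
  by apply: PA => l k; rewrite mxE; exact: Py.
rewrite (_ : cube M = trmx @` [set x : 'rV[R]_n | forall i, `[- M, M]%classic (x 0 i)]).
  apply: continuous_compact; first exact: continuous_subspaceT.
  apply: (@rV_compact _ _ (fun=> `[- M, M]%classic)) => _.
  exact: segment_compact.
apply/seteqP; split=> [x xM|_ [x xM <-] i].
  exists x^T; last exact: trmxK.
  by move=> i; have := xM i; rewrite /= !mxE in_itv.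
by have := xM i; rewrite /= !mxE in_itv.
Qed.

Lemma compact_sub_cube (K : set E) : compact K -> exists2 M, 0 <= M & K `<=` cube M.
Proof.
move=> /compact_bounded[N [_ KN]]; exists (`|N| + 1); first exact: addr_ge0.
move=> x Kx; apply/cubeP => i.
have := KN (`|N| + 1) _ x Kx; rewrite ltr_pwDr ?ler_norm// => /(_ isT).
by apply: le_trans; rewrite [leRHS]/Num.Def.normr/= mx_normrE; exact: (le_bigmax _ _ (i, 0)).
Qed.

Lemma closed_cube M : closed (cube M).
Proof. by apply: compact_closed; [exact: norm_hausdorff|exact: compact_cube]. Qed.

(** Vanishing outside some cube is the form of compact support that sums, translates, compositions
    and partial derivatives visibly preserve. *)
Lemma test_functionP f : test_function f <->
  smooth f /\ exists M, forall x, ~ cube M x -> f x = 0.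
Proof.
split=> [[sf /compact_sub_cube[M _ KM]]|[sf [M fM]]]; split => //.
  exists M => x xM; apply: contra_notP xM => /eqP fx0.
  by apply: KM; exact: subset_closure.
apply: (@subclosed_compact _ _ (cube M)); [exact: closed_closure|exact: compact_cube|].
rewrite [cube M](closure_id _).1; last exact: closed_cube.
by apply: closure_subset => x /= fx0; apply: contrapT => /fM/eqP; exact/negP.
Qed.

Lemma test_smooth f : test_function f -> smooth f.
Proof. by case. Qed.

Lemma test_continuous f : test_function f -> continuous f.
Proof. by case=> sf _; exact: (sf [::]).1. Qed.

Lemma test_derivable f i x : test_function f -> derivable f x (delta_mx i 0).
Proof. by case=> sf _; exact: (sf [::]).2. Qed.

Lemma test_partial f i : test_function f -> test_function (partial i f).
Proof.
move=> /test_functionP[sf [M fM]]; apply/test_functionP; split.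
  exact: smooth_partial.
exists M => x xM; rewrite /partial -(derive_cst (0 : R) x (delta_mx i 0)).
apply: near_eq_derive; have oM : open (~` cube M) by exact/closed_openC/closed_cube.
by apply: filterS (open_nbhs_nbhs (conj oM xM)) => y; exact: fM.
Qed.

Lemma test_closure f g : smooth_closure f -> test_function g ->
  (forall x, g x = 0 -> f x = 0) -> test_function f.
Proof.
move=> sf /test_functionP[_ [M gM]] fg; apply/test_functionP; split.
  exact: smooth_closureW.
by exists M => x /gM/fg.
Qed.

Lemma test_base f : test_function f -> smooth_closure f.
Proof. by move=> /test_smooth; exact: closure_base. Qed.

Lemma test_mul_smooth f g : smooth f -> test_function g -> test_function (fun x => f x * g x).
Proof.
move=> sf tg; apply: (test_closure _ tg) => [|x ->]; last by rewrite mulr0.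
by apply: closure_mul; [exact: closure_base|exact: test_base].
Qed.

Lemma test_add f g : test_function f -> test_function g ->
  test_function (fun x => f x + g x).
Proof.
move=> tf tg; have [sf [M fM]] := (test_functionP f).1 tf.
have [sg [N gN]] := (test_functionP g).1 tg.
apply/test_functionP; split.
  by apply: smooth_closureW; apply: closure_add; exact: test_base.
exists (Num.max M N) => x xMN; rewrite fM ?gN ?addr0//.
  by apply: contra_not xMN; apply: le_cube; rewrite le_max lexx orbT.
by apply: contra_not xMN; apply: le_cube; rewrite le_max lexx.
Qed.

Lemma test_scale (c : R) f : test_function f -> test_function (fun x => c * f x).
Proof.
move=> tf; apply: test_mul_smooth tf.
exact: (smooth_closureW (closure_cst _ c)).
Qed.

Lemma test_sub f g : test_function f -> test_function g ->
  test_function (fun x => f x - g x).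
Proof.
move=> tf tg; have := test_add tf (test_scale (-1) tg).
by congr test_function; apply/funext => x; rewrite mulN1r.
Qed.

Lemma test_0 : test_function (fun _ : E => 0 : R).
Proof.
apply/test_functionP; split; last by exists 0.
exact: (smooth_closureW (closure_cst _ 0)).
Qed.

Lemma test_translate f (a : E) : test_function f -> test_function (fun x => f (x + a)).
Proof.
move=> /test_functionP[sf [M fM]]; apply/test_functionP; split.
  by apply: smooth_closureW; apply: closure_translate; exact: closure_base.
have [N _ aN] := compact_sub_cube (@compact_set1 _ a).
exists (M + N) => x xMN; apply: fM; apply: contra_not xMN => /cubeP xaM; apply/cubeP => i.
have := xaM i; have /cubeP/(_ i) := aN a erefl; rewrite mxE => h1 h2.
by rewrite -(addrK (a i 0) (x i 0)) (le_trans (ler_normB _ _))// lerD.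
Qed.

Lemma test_bounded f : test_function f -> exists2 M, 0 <= M & forall x, `|f x| <= M.
Proof.
move=> tf; have [sf [N fN]] := (test_functionP f).1 tf.
have /compact_bounded[M [_ fM]] : compact (f @` cube N).
  apply: continuous_compact; last exact: compact_cube.
  exact/continuous_subspaceT/test_continuous.
exists (`|M| + 1) => [|x]; first exact: addr_ge0.
have [xN|/fN->] := pselect (cube N x); last by rewrite normr0 addr_ge0.
by apply: fM; [rewrite ltr_pwDr ?ler_norm|exists x].
Qed.

Lemma measurable_cube M : measurable (cube M : set T).
Proof. exact: measurable_box. Qed.

Lemma integrable_bounded_support (f : T -> R) (B M : R) : measurable_fun setT f ->
  (forall x, `|f x| <= B) -> (forall x, ~ cube M x -> f x = 0) ->
  mu.-integrable setT (EFin \o f).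
Proof.
move=> mf fB fM; have mM := measurable_cube M.
have -> : EFin \o f = (EFin \o f) \_ (cube M).
  apply/funext => x; rewrite patchE; case: ifPn => // /negP xM /=.
  by rewrite fM// => cx; apply: xM; rewrite inE.
apply/(integrable_mkcond _ mM); apply: measurable_bounded_integrable => //.
- exact: leb_box_lty.
- exact: measurable_funTS.
- exists B; split; first exact: num_real.
  by move=> z Bz x _; exact: le_trans (fB x) (ltW Bz).
Qed.

Lemma test_measurable f : test_function f -> measurable_fun setT (f : T -> R).
Proof. by move=> tf; exact/continuous_measurable_leb/test_continuous. Qed.

Lemma test_integrable f : test_function f -> mu.-integrable setT (EFin \o (f : T -> R)).
Proof.
move=> tf; have [B _ fB] := test_bounded tf.
have [_ [M fM]] := (test_functionP f).1 tf.
exact: integrable_bounded_support (test_measurable tf) fB fM.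
Qed.

Lemma in_LpP (p : R) (f : E -> R) : 1 <= p ->
  in_Lp p f <-> measurable_fun setT (f : T -> R) /\
    mu.-integrable setT (fun x : T => (`|f x| `^ p)%:E).
Proof.
move=> p1; have p0 : p != 0 by rewrite gt_eqF// (lt_le_trans ltr01).
split=> [fp|[mf /integrableP[_ If]]].
  split; last exact: Lfun_integrable p1 fp.
  by move: fp => /andP[]; rewrite inE.
apply/andP; split; rewrite inE//= /finite_norm unlock; apply: poweR_lty.
apply: le_lt_trans If; rewrite le_eqVlt; apply/orP; left; apply/eqP.
apply: eq_integral => x _ /=.
by rewrite (ger0_norm (powR_ge0 _ _)).
Qed.

Lemma measurable_normr_powR (p : R) (f : T -> R) : measurable_fun setT f ->
  measurable_fun setT (fun x : T => `|f x| `^ p).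
Proof.
move=> mf; apply: (measurableT_comp (measurable_powR p)).
exact: measurableT_comp.
Qed.

Lemma test_in_Lp (p : R) f : 1 <= p -> test_function f -> in_Lp p f.
Proof.
move=> p1 tf; have p0 : p != 0 by rewrite gt_eqF// (lt_le_trans ltr01).
have [B B0 fB] := test_bounded tf; have [_ [M fM]] := (test_functionP f).1 tf.
apply/(in_LpP _ p1); split; first exact: test_measurable.
apply: (@integrable_bounded_support (fun x : T => `|f x| `^ p) (B `^ p) M).
- exact/measurable_normr_powR/test_measurable.
- by move=> x; rewrite (ger0_norm (powR_ge0 _ _)) ge0_ler_powR ?nnegrE// (le_trans ler01).
- by move=> x /fM ->; rewrite normr0 powR0.
Qed.

Lemma integral_translate (a : E) (f : T -> R) : measurable_fun setT f ->
  (\int[mu]_x (f (x + a))%:E = \int[mu]_x (f x)%:E)%E.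
Proof.
move=> mf; have mfa : measurable_fun setT (EFin \o f) by exact/measurable_EFinP.
rewrite integralE [RHS]integralE; congr (_ - _)%E.
- have := ge0_integral_translate a measurableT (measurable_funepos mfa)
    (fun x _ => funepos_ge0 _ x).
  rewrite preimage_setT => H; apply: etrans (etrans H _);
    by apply: eq_integral => x _; rewrite !funeposE.
- have := ge0_integral_translate a measurableT (measurable_funeneg mfa)
    (fun x _ => funeneg_ge0 _ x).
  rewrite preimage_setT => H; apply: etrans (etrans H _);
    by apply: eq_integral => x _; rewrite !funenegE.
Qed.

Lemma shift_line f (v x : E) (s : R) :
  (fun h : R => h^-1 *: (((fun r : R => f (r *: v + x)) \o shift s) (h *: 1) - f (s *: v + x))) =
  (fun h : R => h^-1 *: ((f \o shift (s *: v + x)) (h *: v) - f (s *: v + x))).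
Proof.
by apply/funext => h; rewrite /= [h *: 1]mulr1 scalerDl addrA.
Qed.

Lemma is_derive_line f (v x : E) (s : R) : derivable f (s *: v + x) v ->
  is_derive s 1 (fun r : R => f (r *: v + x)) ('D_v f (s *: v + x)).
Proof.
move=> df; apply: DeriveDef.
  by rewrite /derivable shift_line; exact: df.
by rewrite /derive shift_line.
Qed.

Lemma test_lipschitz f i : test_function f ->
  exists2 M, 0 <= M & forall x (h : R), `|f (x + h *: delta_mx i 0) - f x| <= M * `|h|.
Proof.
move=> tf; have [M M0 fM] := test_bounded (test_partial i tf).
exists M => // x h; pose v : E := delta_mx i 0.
pose F (s : R) := f (s *: v + x).
have dF (s : R) : is_derive s 1 F (partial i f (s *: v + x)).
  exact/is_derive_line/test_derivable.
have cF : forall a b : R, {within `[a, b], continuous F}.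
  move=> a b; apply: derivable_within_continuous => s _.
  by have [] := dF s.
have key a b : a <= b -> `|F b - F a| <= M * `|b - a|.
  rewrite le_eqVlt => /predU1P[->|ab]; first by rewrite !subrr normr0 mulr0.
  have [c _ ->] := MVT ab (fun s _ => dF s) (cF a b).
  by rewrite normrM ler_wpM2r.
rewrite (_ : _ - _ = F h - F 0); last by rewrite /F scale0r add0r [x + _]addrC.
by have [/key|/ltW/key] := leP 0 h; rewrite ?subr0 ?sub0r ?normrN// distrC.
Qed.

(** By translation invariance every difference quotient has integral 0, and dominated convergence
    passes to the limit. The dominating function is the Lipschitz constant on the cube enlarged by
    1, since the steps [h k] are at most 1. No iterated integration is involved. *)
Lemma integral_partial f i : test_function f ->
  (\int[mu]_x (partial i f x)%:E = 0)%E.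
Proof.
move=> tf; have [B B0 fB] := test_lipschitz i tf.
have [_ [M fM]] := (test_functionP f).1 tf.
pose v : E := delta_mx i 0.
pose h (k : nat) : R := k.+1%:R^-1.
pose q k : T -> R := fun x => (h k)^-1 * (f (x + h k *: v) - f x).
have tq k : test_function (q k).
  exact/test_scale/test_sub/tf/(test_translate (h k *: v) tf).
have q0 k : (\int[mu]_x (q k x)%:E = 0)%E.
  under eq_integral do rewrite EFinM EFinB.
  have I1 := test_integrable (test_translate (h k *: v) tf).
  have I2 := test_integrable tf.
  rewrite integralZl//; last exact: integrableB.
  rewrite integralB//.
  rewrite (integral_translate (h k *: v) (test_measurable tf)) subee ?mule0//.
  exact: integrable_fin_num.
have cvq : (\int[mu]_x (q k x)%:E @[k --> \oo] --> \int[mu]_x (partial i f x)%:E)%E.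
  apply: (@dominated_cvg _ _ _ mu setT measurableT _ _
    (fun x => (B * \1_(cube (M + 1)) x)%:E)); last 1 first.
  - move=> k x _; rewrite lee_fin indicE.
    have h0 : 0 < h k by rewrite invr_gt0.
    have [xM|xM] := boolP (x \in cube (M + 1)).
      rewrite mulr1 /q normrM gtr0_norm ?invr_gt0// ler_pdivrMl//.
      by rewrite (le_trans (fB _ _))// mulrC gtr0_norm.
    have h1 : h k <= 1 by rewrite invf_le1// ler1n.
    move: xM; rewrite notin_setE => xM; rewrite /q !fM ?subrr ?mulr0 ?normr0//.
      by apply: contra_not xM; apply: le_cube; rewrite lerDl.
    apply: contra_not xM => /cubeP xM; apply/cubeP => j; have := xM j.
    rewrite !mxE; set c := h k * _ => xhM.
    have -> : x j 0 = (x j 0 + c) - c by rewrite addrK.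
    rewrite (le_trans (ler_normB _ _))// lerD// normrM (gtr0_norm h0).
    by case: (_ && _); rewrite ?normr1 ?normr0 ?mulr1 ?mulr0.
  - by move=> k; apply/measurable_EFinP; exact: test_measurable (tq k).
  - move=> x _; apply: cvg_EFin; first exact: nearW.
    have /cvg_ex[l fl] := @test_derivable f i x tf.
    have -> : partial i f x = l by exact/cvg_lim.
    under eq_fun do rewrite /= /q [x + _]addrC.
    have := (cvgr_dnbhsP _ _ _).1 fl h; apply; split.
      by move=> k; rewrite invr_eq0 pnatr_eq0.
    exact: cvg_harmonic.
  - by [].
  - apply: (@integrable_bounded_support _ B (M + 1)).
    + apply: measurable_funM; first exact: measurable_cst.
      apply: measurable_indic; exact: measurable_cube.
    + move=> x; rewrite normrM (ger0_norm B0) ler_piMr// indicE.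
      by case: (_ \in _); rewrite /= ?normr1 ?normr0.
    + by move=> x xM; rewrite indicE memNset// mulr0.
by move: cvq; under eq_fun do rewrite q0; move/cvg_lim => <-//; rewrite lim_cst.
Qed.

End test_functions.

(** * Smooth truncation to the unit interval *)

Section truncations.
Context (R : realType) (n : nat).
Local Notation E := 'cV[R]_n.
Variable e : R.
Hypothesis e_gt0 : 0 < e.

(** The smoothing of [1 - (1 - t^+)^+], which is [t] truncated to [[0, 1]]. Dividing by
    [smooth_pos e 1] gives the exact value 0 for [t <= 0], so that compact supports survive. *)
Definition smooth_trunc (t : R) : R :=
  1 - smooth_pos e (1 - smooth_pos e t) / smooth_pos e 1.

Let P1_gt0 : 0 < smooth_pos e 1. Proof. exact: smooth_pos_gt0. Qed.

Lemma smooth_trunc01 t : 0 <= smooth_trunc t <= 1.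
Proof.
apply/andP; split; last by rewrite gerBl divr_ge0 ?smooth_pos_ge0 ?ltW.
rewrite subr_ge0 ler_pdivrMr// mul1r; apply: smooth_pos_nondecreasing => //.
by rewrite gerBl smooth_pos_ge0.
Qed.

Lemma smooth_trunc_le0 t : t <= 0 -> smooth_trunc t = 0.
Proof.
move=> t0; rewrite /smooth_trunc (smooth_pos_le0 _ t0) subr0 divff ?subrr//.
by rewrite gt_eqF.
Qed.

Lemma smooth_trunc_eq1 t : 1 + e <= t -> smooth_trunc t = 1.
Proof.
move=> t1; rewrite /smooth_trunc [X in X / _]smooth_pos_le0 ?mul0r ?subr0//.
have := smooth_pos_geB e_gt0 t; lra.
Qed.

Lemma closure_trunc (f : E -> R) : smooth_closure f ->
  smooth_closure (fun x => smooth_trunc (f x)).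
Proof.
move=> sf; have sP := smooth1_smooth_pos e_gt0.
have s1 : smooth_closure (fun x => 1 + -1 * smooth_pos e (f x)).
  apply: closure_add; first exact: closure_cst.
  by apply: closure_mul; [exact: closure_cst|exact: closure_comp].
have s2 : smooth_closure (fun x => 1 + (- (smooth_pos e 1)^-1) *
    smooth_pos e (1 + -1 * smooth_pos e (f x))).
  apply: closure_add; first exact: closure_cst.
  by apply: closure_mul; [exact: closure_cst|exact: closure_comp].
congr smooth_closure: s2; apply/funext => x.
by rewrite /smooth_trunc mulN1r mulNr [_^-1 * _]mulrC.
Qed.

Lemma test_smooth_trunc (a : R) (f : E -> R) : test_function f ->
  test_function (fun x => smooth_trunc (a * f x)).
Proof.
move=> tf; apply: (test_closure _ tf) => [|x fx0].
  by apply: closure_trunc; apply: test_base; exact: test_scale.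
by rewrite fx0 mulr0 smooth_trunc_le0.
Qed.

(** The chain rule multiplies [a / smooth_pos e 1] by two derivatives of [smooth_pos], each in
    [[0, 1]]. The factor depends on [x] but not on the direction, so the whole gradient is
    scaled. *)
Lemma partial_smooth_trunc (a : R) (f : E -> R) x : 0 <= a -> test_function f ->
  exists2 s, 0 <= s <= a / smooth_pos e 1 &
    forall i, partial i (fun x => smooth_trunc (a * f x)) x = s * partial i f x.
Proof.
move=> a0 tf; have sP := smooth1_smooth_pos e_gt0; have dP := smooth1_derivable sP.
pose d1 := derive1 (smooth_pos e) (1 - smooth_pos e (a * f x)).
pose d2 := derive1 (smooth_pos e) (a * f x).
have /andP[d10 d11] : 0 <= d1 <= 1 by exact: derive_smooth_pos.
have /andP[d20 d21] : 0 <= d2 <= 1 by exact: derive_smooth_pos.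
exists (d1 * d2 * (a / smooth_pos e 1)).
  have q0 : 0 <= a / smooth_pos e 1 by rewrite divr_ge0// ltW.
  move: d1 d2 d10 d11 d20 d21 q0; move: (a / smooth_pos e 1) => q u v u0 u1 v0 v1 q0.
  have uv0 : 0 <= u * v by exact: mulr_ge0.
  have uv1 : u * v <= 1 by rewrite -[leRHS]mulr1; exact: ler_pM.
  by rewrite (mulr_ge0 uv0 q0) -[leRHS]mul1r (ler_wpM2r q0 uv1).
move=> i; have df := @test_derivable _ _ _ i x tf.
have daf := @test_derivable _ _ _ i x (test_scale a tf).
have [d1f D1f] := derivable_compr daf (dP (a * f x)).
have dc : derivable (fun x : E => 1 : R) x (delta_mx i 0) by exact: derivable_cst.
have dB := derivableB dc d1f.
have [d2f D2f] := derivable_compr dB (dP (1 - smooth_pos e (a * f x))).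
set c := smooth_pos e 1; have cN0 : c != 0 by rewrite gt_eqF.
have D1f' : 'D_(delta_mx i 0) (smooth_pos e \o (fun x => a * f x)) x =
    d2 * 'D_(delta_mx i 0) (fun x => a * f x) x := D1f.
have D2f' : 'D_(delta_mx i 0) (smooth_pos e \o ((fun x : E => 1 : R) -
    (smooth_pos e \o (fun x => a * f x)))) x = d1 * 'D_(delta_mx i 0)
    ((fun x : E => 1 : R) - (smooth_pos e \o (fun x => a * f x))) x := D2f.
have Dm := deriveMl a df.
have dk : derivable (fun x : E => c^-1) x (delta_mx i 0) by exact: derivable_cst.
have dM := derivableM dk d2f.
have -> : (fun x => smooth_trunc (a * f x)) = (fun x : E => 1 : R) -
    (fun x : E => c^-1) *
      (smooth_pos e \o ((fun x : E => 1 : R) - (smooth_pos e \o (fun x => a * f x)))).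
  by apply/funext => y; rewrite /smooth_trunc -/c [_ / c]mulrC.
rewrite /partial (deriveB dc dM) derive_cst (deriveM dk d2f) derive_cst D2f' (deriveB dc d1f).
rewrite derive_cst D1f' Dm.
move: d1 d2 ('D_(delta_mx i 0) f x) {D1f' D2f' d10 d11 d20 d21} => u v y.
by rewrite scaler0 addr0 !sub0r /GRing.scale/=; field.
Qed.

End truncations.

(** * Smooth approximation of indicators of boxes *)

Section smooth_bumps.
Context (R : realType) (n : nat).
Local Notation E := 'cV[R]_n.

Lemma closure_prod (I : Type) (r : seq I) (F : I -> E -> R) :
  (forall i, smooth_closure (F i)) -> smooth_closure (fun x => \prod_(i <- r) F i x).
Proof.
move=> sF; elim: r => [|i r ih].
  rewrite (_ : (fun _ => _) = fun=> 1); first exact: closure_cst.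
  by apply/funext => x; rewrite big_nil.
rewrite (_ : (fun _ => _) = fun x => F i x * \prod_(i <- r) F i x).
  exact: closure_mul.
by apply/funext => x; rewrite big_cons.
Qed.

(** [smooth_trunc 1] is 0 up to 0 and 1 from 2 on. With the slope [2 * k.+1%:R] and the offset 2,
    each factor is 1 on the inner side of its face and 0 from distance [k.+1%:R^-1] outwards, whence
    convergence to the indicator of the closed box. *)
Definition box_bump (ab : E * E) (k : nat) (x : E) : R :=
  \prod_(i < n) (smooth_trunc 1 (2 + 2 * k.+1%:R * (x i 0 - ab.1 i 0)) *
                 smooth_trunc 1 (2 + 2 * k.+1%:R * (ab.2 i 0 - x i 0))).

Lemma box_bump01 (ab : E * E) k (x : E) : 0 <= box_bump ab k x <= 1.
Proof.
have mul01 (a b : R) : 0 <= a <= 1 -> 0 <= b <= 1 -> 0 <= a * b <= 1.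
  by move=> /andP[? ?] /andP[? ?]; rewrite mulr_ge0//= mulr_ile1.
apply: (big_ind (fun t : R => 0 <= t <= 1)) => [|a b|i _].
- by rewrite ler01 lexx.
- exact: mul01.
- by apply: mul01; exact: (smooth_trunc01 (@ltr01 R)).
Qed.

Lemma box_bump_in (ab : E * E) k (x : E) : box ab x -> box_bump ab k x = 1.
Proof.
have trunc1 (t : R) : 2 <= t -> smooth_trunc 1 t = 1.
  by move=> t2; apply: smooth_trunc_eq1.
move=> xab; rewrite /box_bump big1// => i _; have /andP[ax xb] := xab i.
by rewrite !trunc1 ?mulr1// lerDl !mulr_ge0// subr_ge0.
Qed.

Lemma box_bump_out (ab : E * E) k (x : E) i :
  x i 0 + k.+1%:R^-1 <= ab.1 i 0 \/ ab.2 i 0 + k.+1%:R^-1 <= x i 0 ->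
  box_bump ab k x = 0.
Proof.
have : 0 < k.+1%:R :> R by rewrite ltr0n.
rewrite /box_bump; move: (k.+1%:R : R) => c c0.
have neg (t : R) : t + c^-1 <= 0 -> 2 + 2 * c * t <= 0.
  move=> h; rewrite (_ : _ + _ = 2 * (c * (t + c^-1))); last by field; rewrite gt_eqF.
  by rewrite pmulr_rle0// pmulr_rle0.
rewrite (bigD1 i)//= => -[h|h].
- have h' : x i 0 - ab.1 i 0 + c^-1 <= 0 by lra.
  by rewrite (smooth_trunc_le0 1 (neg _ h')) !mul0r.
- have h' : ab.2 i 0 - x i 0 + c^-1 <= 0 by lra.
  rewrite (smooth_trunc_le0 1 (neg _ h')).
  by move: (smooth_trunc _ _) (\prod_(_ | _) _) => u v; rewrite mulr0 mul0r.
Qed.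

Lemma box_bump_cvg (ab : E * E) (x : E) : box_bump ab k x @[k --> \oo] --> (\1_(box ab) x : R).
Proof.
have [xab|xab] := pselect (box ab x).
  rewrite indicE mem_set//=.
  by apply: cvg_near_cst; apply: nearW => k; exact: box_bump_in.
rewrite indicE memNset//=; apply: cvg_near_cst.
have [i /negP ] : exists i, ~ (ab.1 i 0 <= x i 0 <= ab.2 i 0) by apply/existsNP.
rewrite negb_and -!ltNge => /orP h.
have [e e0 he] : exists2 e : R, 0 < e & x i 0 + e <= ab.1 i 0 \/ ab.2 i 0 + e <= x i 0.
  case: h => h; [exists (ab.1 i 0 - x i 0)|exists (x i 0 - ab.2 i 0)]; rewrite ?subr_gt0//.
    by left; rewrite addrC subrK.
  by right; rewrite addrC subrK.
near=> k; apply: (box_bump_out (i := i)).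
have ke : k.+1%:R^-1 <= e.
  by apply: ltW; near: k; exact: (near_infty_natSinv_lt (PosNum e0)).
by case: he => he; [left|right]; apply: le_trans he; rewrite lerD2l.
Unshelve. all: by end_near. Qed.

Lemma test_box_bump (ab : E * E) k : test_function (box_bump ab k).
Proof.
apply/test_functionP; split.
  apply: smooth_closureW; apply: closure_prod => i.
  have H (c d e : R) : smooth_closure (fun x : E => 2 + 2 * k.+1%:R * (c + d * (x i 0))).
    apply: closure_add; first exact: closure_cst.
    apply: closure_mul; first exact: closure_cst.
    apply: closure_add; first exact: closure_cst.
    by apply: closure_mul; [exact: closure_cst|exact: closure_coord].
  apply: closure_mul; apply: (closure_trunc (@ltr01 R)).
    have := H (- ab.1 i 0) 1 0; congr smooth_closure; apply/funext => x.
    by rewrite mul1r [- _ + _]addrC.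
  have := H (ab.2 i 0) (-1) 0; congr smooth_closure; apply/funext => x.
  by rewrite mulN1r.
have [M _ abM] : exists2 M, 0 <= M & [set ab.1; ab.2] `<=` cube M.
  by apply: compact_sub_cube; apply: compactU; exact: compact_set1.
exists (M + 1) => x xM.
have [i /negP] : exists i, ~ (`|x i 0| <= M + 1).
  by apply/existsNP => h; apply: xM; exact/cubeP.
rewrite -ltNge => Mx; apply: (box_bump_out (i := i)).
have /cubeP/(_ i) := abM ab.1 (or_introl erefl).
have /cubeP/(_ i) := abM ab.2 (or_intror erefl).
have k1 : k.+1%:R^-1 <= 1 :> R by rewrite invf_le1// ler1n.
rewrite !ler_norml => /andP[a1 a2] /andP[b1 b2].
move: (k.+1%:R^-1 : R) k1 Mx => c c1; rewrite lter_normr => /orP[h|h].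
  by right; lra.
by left; lra.
Qed.

End smooth_bumps.

(** * The fundamental lemma of the calculus of variations *)

Section annihilated.
Context d (T : measurableType d) (R : realType) (mu : {measure set T -> \bar R}).
Variables (tests : set (T -> R)) (h : T -> R).
Hypothesis mtests : forall phi, tests phi -> measurable_fun setT phi.
Hypothesis testsM : forall phi psi, tests phi -> tests psi ->
  tests (fun x => phi x * psi x).
Hypothesis mh : measurable_fun setT h.
Hypothesis Ih : forall phi, tests phi ->
  mu.-integrable setT (fun x => (h x * phi x)%:E).
Hypothesis h0 : forall phi, tests phi -> (\int[mu]_x (h x * phi x)%:E = 0)%E.

(* Weights are tested against [h * phi] rather than [h], which need not be
   integrable. Indicators of approximable sets are limits of tests, so that the
   annihilated indicators are stable under intersection with countable unions of
   approximable sets. *)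
Definition annihilated (g : T -> R) := [/\ measurable_fun setT g,
  forall x, `|g x| <= 1 &
  forall phi, tests phi -> (\int[mu]_x (g x * (h x * phi x))%:E = 0)%E].

Definition approximable (b : set T) := exists chi : nat -> T -> R,
  [/\ forall k, tests (chi k), forall k x, `|chi k x| <= 1 &
      forall x, chi k x @[k --> \oo] --> (\1_b x : R)].

Lemma annihilated_integrable g phi : annihilated g -> tests phi ->
  mu.-integrable setT (fun x => (g x * (h x * phi x))%:E).
Proof.
move=> [mg g1 _] tphi; apply: le_integrable (Ih tphi) => //.
  apply/measurable_EFinP; apply: measurable_funM => //.
  by apply: measurable_funM => //; exact: mtests.
by move=> x _; rewrite lee_fin /= normrM ler_piMl.
Qed.

(** Dominated convergence with bound [|h * phi|], for which [annihilated] carries the condition that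
    [g] be bounded by 1. *)
Lemma annihilated_cvg (g_ : nat -> T -> R) (g : T -> R) :
  (forall k, annihilated (g_ k)) -> (forall x, g_ k x @[k --> \oo] --> g x) ->
  annihilated g.
Proof.
move=> ng cg; have mg : measurable_fun setT g.
  by apply: (@measurable_fun_cvg _ _ _ _ g_) => // k; have [] := ng k.
have g1 x : `|g x| <= 1.
  have gx : `|g_ k x| @[k --> \oo] --> `|g x| by apply: cvg_norm; exact: cg.
  rewrite -(cvg_lim _ gx)//; apply: limr_le; first by apply/cvg_ex; exists `|g x|.
  by apply: nearW => k; have [_ + _] := ng k; exact.
split => // phi tphi.
have : (\int[mu]_x (g_ k x * (h x * phi x))%:E @[k --> \oo] -->
        \int[mu]_x (g x * (h x * phi x))%:E)%E.
  apply: (@dominated_cvg _ _ _ mu setT measurableT _ _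
    (fun x => (`|h x * phi x|)%:E)).
  - by move=> k; have /integrableP[] := annihilated_integrable (ng k) tphi.
  - by move=> x _; apply: cvg_EFin; [exact: nearW|apply: cvgMl; exact: cg].
  - by [].
  - by have := integrable_abse (Ih tphi).
  - move=> k x _; rewrite lee_fin normrM ler_piMl//.
    by have [_ + _] := ng k; exact.
under eq_fun do rewrite (let: And3 _ _ H := ng _ in H phi tphi).
by move/cvg_lim => <-//; rewrite lim_cst.
Qed.

Lemma annihilatedB g g' : annihilated g -> annihilated g' ->
  (forall x, `|g x - g' x| <= 1) -> annihilated (fun x => g x - g' x).
Proof.
move=> ng ng' gg'; have [mg _ g0] := ng; have [mg' _ g0'] := ng'.
split => //; first exact: measurable_funB.
move=> phi tphi; under eq_integral do rewrite mulrBl EFinB.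
by rewrite integralB//; [rewrite g0// g0'// subee|exact: annihilated_integrable|
  exact: annihilated_integrable].
Qed.

Lemma annihilatedM g phi : annihilated g -> tests phi -> (forall x, `|phi x| <= 1) ->
  annihilated (fun x => g x * phi x).
Proof.
move=> [mg g1 g0] tphi phi1; split.
- by apply: measurable_funM => //; exact: mtests.
- by move=> x; rewrite normrM mulr_ile1.
- move=> psi tpsi; rewrite -[RHS](g0 _ (testsM tphi tpsi)).
  by apply: eq_integral => x _; congr EFin; ring.
Qed.

Let indic01 (A : set T) x : 0 <= (\1_A x : R) <= 1.
Proof. by rewrite indicE; case: (_ \in _); rewrite ?lexx ler01. Qed.

Lemma annihilatedI (D b : set T) : annihilated (\1_D) -> approximable b ->
  annihilated (\1_(D `&` b)).
Proof.
move=> nD [chi [tchi chi1 chib]].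
have -> : \1_(D `&` b) = (fun x => \1_D x * \1_b x) :> (T -> R).
  by apply/funext => x; rewrite indicI.
apply: (@annihilated_cvg (fun k x => \1_D x * chi k x)).
  by move=> k; apply: annihilatedM.
by move=> x; apply: cvgMr; exact: chib.
Qed.

Lemma annihilatedD (D D' : set T) : D' `<=` D ->
  annihilated (\1_D) -> annihilated (\1_D') -> annihilated (\1_(D `\` D')).
Proof.
move=> D'D nD nD'; have -> : \1_(D `\` D') = (fun x => \1_D x - \1_D' x) :> (T -> R).
  apply/funext => x; rewrite !indicE in_setD.
  have [xD'|xD'] := boolP (x \in D'); last by rewrite andbT subr0.
  by rewrite (mem_set (D'D _ (set_mem xD'))) subrr.
apply: annihilatedB => // x.
have /andP[? ?] := indic01 D x; have /andP[? ?] := indic01 D' x.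
rewrite ler_norml; apply/andP; split; lra.
Qed.

Lemma annihilated_near (D_ : nat -> set T) (D : set T) :
  (forall k, annihilated (\1_(D_ k))) ->
  (forall x, \forall k \near \oo, D_ k x <-> D x) -> annihilated (\1_D).
Proof.
move=> nD DD; apply: (annihilated_cvg nD) => x; apply: cvg_near_cst.
apply: filterS (DD x) => k Dk; rewrite !indicE.
have [xD|xD] := boolP (x \in D); first by rewrite mem_set//; exact/Dk/set_mem.
by move: xD; rewrite notin_setE => xD; rewrite memNset// => /Dk.
Qed.

(** Intersections with one approximable set and proper differences are available. Hence the sets
    [B k] are removed from [D] one after the other, the limit removes the whole union, and one last
    difference restores the part inside the union. *)
Lemma annihilatedI_bigcup (D : set T) (B : nat -> set T) :
  annihilated (\1_D) -> (forall k, approximable (B k)) ->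
  annihilated (\1_(D `&` \bigcup_k B k)).
Proof.
move=> nD aB; rewrite -setDD; apply: annihilatedD; [exact: subDsetl|exact: nD|].
pose U m := \bigcup_(k < m) B k.
apply: (@annihilated_near (fun m => D `\` U m)) => [m|x].
  elim: m => [|m ih]; first by rewrite /U bigcup_mkord big_ord0 setD0; exact: nD.
  rewrite /U bigcup_mkord big_ord_recr/= -bigcup_mkord -setDDl.
  have -> (X Y : set T) : X `\` Y = X `\` (X `&` Y) by rewrite setDIr setDv set0U.
  by apply: annihilatedD; [exact: subIsetl|exact: ih|exact: annihilatedI].
have [[k _ Bk]|nB] := pselect ((\bigcup_k B k) x); last first.
  apply: nearW => m; split => -[Dx nU]; split => //.
  by apply: contra_not nB => -[k _ Bk]; exists k.
exists k.+1 => // m /= km; split => -[Dx]; last by case; exists k.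
by case; exists k.
Qed.

(** Outer regularity: [A] differs by a null set from the intersection [D] of all the covers, and the
    indicator of [D] is annihilated as a limit of finite intersections. *)
Lemma annihilated_cover (A : set T) (B : nat -> nat -> set T) :
  annihilated (\1_(setT)) -> measurable A ->
  (forall k j, approximable (B k j)) ->
  (forall k, A `<=` \bigcup_j B k j) ->
  (forall e : R, 0 < e -> exists k, (mu ((\bigcup_j B k j) `\` A) <= e%:E)%E) ->
  forall phi, tests phi -> (\int[mu]_(x in A) (h x * phi x)%:E = 0)%E.
Proof.
move=> nT mA aB AB smallB phi tphi.
pose C k := \bigcup_j B k j; pose D := \bigcap_k C k.
have mB k j : measurable (B k j).
  have [chi [tchi _ chiB]] := aB k j.
  have : measurable_fun setT (\1_(B k j) : T -> R).
    by apply: (@measurable_fun_cvg _ _ _ _ chi) => // i; exact: mtests.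
  move=> /(_ measurableT [set 1]) /(_ (measurable_set1 _)); rewrite setTI.
  congr measurable; apply/seteqP; split => x; rewrite /= indicE.
    by case: (boolP (x \in _)) => [/set_mem//|_ /eqP]; rewrite eq_sym oner_eq0.
  by move=> Bx; rewrite mem_set.
have mC k : measurable (C k) by exact: bigcupT_measurable.
have mD : measurable D by exact: bigcapT_measurable.
have nD : annihilated (\1_D).
  pose V m := \bigcap_(k < m) C k.
  apply: (@annihilated_near V) => [m|x].
    elim: m => [|m ih]; first by rewrite /V bigcap_mkord big_ord0; exact: nT.
    rewrite /V bigcap_mkord big_ord_recr/= -bigcap_mkord.
    by apply: annihilatedI_bigcup.
  have [Dx|/existsNP[k /not_implyP[_ nC]]] := pselect (D x).
    by apply: nearW => m; split => // _ k _; exact: Dx.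
  exists k.+1 => // m /= km; split => [/(_ k km)//|Dx].
  by have := nC (Dx k I).
have AD : A `<=` D by move=> x Ax k _; exact: AB.
have DA0 : mu (D `\` A) = 0%E.
  apply/eqP; rewrite eq_le measure_ge0 andbT; apply/lee_addgt0Pr => e e0.
  rewrite add0e; have [k ke] := smallB e e0; apply: le_trans ke.
  apply: le_measure; rewrite ?inE; [exact: measurableD|exact: (measurableD (mC k) mA)|].
  by apply: setSD => x /(_ k I).
have mhphi : measurable_fun setT (fun x => (h x * phi x)%:E).
  by have /integrableP[] := Ih tphi.
have [_ _ /(_ _ tphi) <-] := nD.
transitivity (\int[mu]_(x in D) (h x * phi x)%:E)%E; last first.
  rewrite integral_mkcond; apply: eq_integral => x _.
  by rewrite patchE indicE; case: (_ \in _); rewrite ?mul1r ?mul0r.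
have ID : mu.-integrable D (fun x => (h x * phi x)%:E).
  exact: integrableS (Ih tphi).
by rewrite (negligible_integral _ mD ID DA0) ?setDD ?setIidr//; exact: measurableD.
Qed.

End annihilated.

Section fundamental_lemma.
Context (R : realType) (n : nat).
Local Notation E := 'cV[R]_n.
Local Notation T := (caratheodory_type (lebesgue_outer R n)).
Local Notation mu := (leb R n).

Let tests : set (T -> R) := [set phi | test_function (phi : E -> R)].

Lemma approximable_box (ab : E * E) : approximable tests (box ab : set T).
Proof.
exists (box_bump ab); split; first by move=> k; exact: test_box_bump.
  by move=> k x; have /andP[b0 b1] := box_bump01 ab k x; rewrite ger0_norm.
by move=> x; exact: box_bump_cvg.
Qed.

Lemma approximable_set0 : approximable tests (set0 : set T).
Proof.
exists (fun _ _ => 0); split; first by move=> k; exact: test_0.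
  by move=> k x; rewrite normr0.
by move=> x; rewrite indic0; exact: cvg_cst.
Qed.

Lemma leb_box_cover (A : set T) (e : R) : (mu A < +oo)%E -> measurable A -> 0 < e ->
  exists B : nat -> set T, [/\ forall j, approximable tests (B j),
    A `<=` \bigcup_j B j & (mu ((\bigcup_j B j) `\` A) <= e%:E)%E].
Proof.
move=> Aoo mA e0; have fA : mu A \is a fin_num by rewrite ge0_fin_numE.
have [_ [J [_ cJ AJ] <-] Jlt] := lb_ereal_inf_adherent e0 fA.
have /countable_injP[f injf] := cJ.
(* As [f] is injective on [J], each [B k] is a single box or empty; this turns the countable cover
   into a sequence. *)
pose B (k : nat) : set T := \bigcup_(j in J `&` [set j | f j = k]) box j.
have BE : \bigcup_k B k = \bigcup_(j in J) box j.
  apply/seteqP; split=> x [j]; first by move=> _ [i [Ji _] ix]; exists i.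
  by move=> Jj jx; exists (f j) => //; exists j.
have B_box k : (exists2 j, J j & B k = box j) \/ B k = set0.
  have [[j [Jj fj]]|nj] := pselect (exists j, J j /\ f j = k).
    left; exists j => //; apply/seteqP; split=> x; last by exists j.
    by move=> [i [Ji fi]]; rewrite (injf i j) ?inE// fi fj.
  by right; apply/seteqP; split => // x [i [Ji fi] _]; apply: nj; exists i.
have aB k : approximable tests (B k).
  case: (B_box k) => [[j _ ->]|->]; first exact: approximable_box.
  exact: approximable_set0.
exists B; split => //; first by rewrite BE.
have mB : measurable (\bigcup_k B k).
  apply: bigcupT_measurable => k; case: (B_box k) => [[j _ ->]|->].
    exact: measurable_box.
  exact: measurable0.
have le : (mu (\bigcup_k B k) <= mu A + e%:E)%E.
  apply: le_trans (ltW Jlt); rewrite BE.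
  exact: (@lebesgue_covering_le R n J id _ cJ).
rewrite measureD//; last by apply: le_lt_trans le _; rewrite lte_add_pinfty ?ltry.
rewrite setIidr ?BE// -BE leeBlDr//.
by rewrite addeC.
Qed.

(** On the part [A] of [0 < h] inside a cube, [A] has finite measure, as covers by boxes require,
    and some test function equals 1. Thus the integral of [h] over [A] is 0 although [h] is positive
    there. *)
Lemma fundamental_lemma_pos (h : E -> R) : measurable_fun setT (h : T -> R) ->
  (forall phi, test_function phi ->
     mu.-integrable setT (fun x : T => (h x * phi x)%:E)) ->
  (forall phi, test_function phi -> (\int[mu]_x (h x * phi x)%:E = 0)%E) ->
  mu.-negligible ([set x | 0 < h x] : set T).
Proof.
move=> mh Ih h0.
rewrite (_ : [set x | 0 < h x] = \bigcup_(M : nat) (cube M%:R `&` [set x | 0 < h x])); last first.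
  apply/seteqP; split=> [x hx|x [M _ []]//].
  have [M M0 xM] := compact_sub_cube (@compact_set1 _ x).
  exists (Num.truncn M).+1 => //; split => //.
  apply: (@le_cube _ _ M); last exact: xM.
  by apply: ltW; exact: truncnS_gt.
apply: negligible_bigcup => M; set A : set T := cube M%:R `&` _.
have mA : measurable A.
  apply: measurableI; first exact: measurable_cube.
  rewrite (_ : [set x | 0 < h x] = setT `&` h @^-1` `]0, +oo[%classic).
    by apply: mh => //; exact: measurable_itv.
  by rewrite setTI; apply/seteqP; split => x /=; rewrite in_itv/= andbT.
have Aoo : (mu A < +oo)%E.
  by apply: (@leb_bounded_lty _ _ _ (const_mx (- M%:R), const_mx M%:R)) => x [].
have nT : annihilated mu tests h (\1_(setT : set T)).
  split => [|x|phi tphi].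
  - exact: measurable_indic.
  - by rewrite indicE; case: (_ \in _); rewrite ?normr1 ?normr0.
  - rewrite -[RHS](h0 _ tphi); apply: eq_integral => x _.
    by rewrite indicT mul1r.
have /choice[B HB] : forall k : nat, exists B : nat -> set T,
    [/\ forall j, approximable tests (B j), A `<=` \bigcup_j B j &
        (mu ((\bigcup_j B j) `\` A) <= (k.+1%:R^-1 : R)%:E)%E].
  by move=> k; apply: leb_box_cover.
pose phi := box_bump (const_mx (- M%:R) : E, const_mx M%:R : E) 0.
have tphi : test_function phi by exact: test_box_bump.
have : (\int[mu]_(x in A) (h x * phi x)%:E = 0)%E.
  apply: (@annihilated_cover _ T R mu tests h _ _ mh Ih A B nT mA) => //.
  - by move=> psi; exact: test_measurable.
  - by move=> psi chi tpsi; apply: test_mul_smooth; exact: test_smooth.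
  - by move=> k j; have [+ _ _] := HB k; exact.
  - by move=> k; have [] := HB k.
  - move=> e e0; have [k ke] : exists k : nat, k.+1%:R^-1 <= e.
      have [k _ /(_ k (leqnn k)) /ltW] := near_infty_natSinv_lt (PosNum e0).
      by exists k.
    by exists k; have [_ _ /le_trans] := HB k; apply; rewrite lee_fin.
move=> Ahphi.
have /ae_eq_integral_abs : (\int[mu]_(x in A) `|(h x)%:E| = 0)%E.
  rewrite -[RHS]Ahphi; apply: eq_integral => x; rewrite inE => -[xM hx].
  by rewrite /phi box_bump_in// mulr1 gee0_abs// lee_fin ltW.
move=> /(_ mA) []; first by apply/measurable_EFinP; exact: measurable_funTS.
move=> N [mN N0 AN]; exists N; split => // x Ax; apply: AN => /= /(_ Ax) [].
by move=> h0'; case: Ax => _ /=; rewrite h0' ltxx.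
Qed.

Lemma fundamental_lemma (h : E -> R) : measurable_fun setT (h : T -> R) ->
  (forall phi, test_function phi ->
     mu.-integrable setT (fun x : T => (h x * phi x)%:E)) ->
  (forall phi, test_function phi -> (\int[mu]_x (h x * phi x)%:E = 0)%E) ->
  {ae mu, forall x, h x = 0}.
Proof.
move=> mh Ih h0.
have N1 := fundamental_lemma_pos mh Ih h0.
have N2 : mu.-negligible ([set x | 0 < - h x] : set T).
  apply: fundamental_lemma_pos => [|phi tphi|phi tphi].
  - exact: measurableT_comp.
  - have := integrableN (Ih _ tphi); congr (integrable _ _ _).
    by apply/funext => x /=; rewrite mulNr.
  - rewrite (eq_integral (fun x : T => (-1)%:E * (h x * phi x)%:E)%E); last first.
      by move=> x _; rewrite -EFinM mulN1r mulNr.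
    by rewrite (integralZl measurableT (Ih _ tphi)) (h0 _ tphi) mule0.
apply: negligibleS (negligibleU N1 N2) => x /= /eqP.
by rewrite neq_lt oppr_gt0 => /orP[]; [right|left].
Qed.

End fundamental_lemma.

(** * Weak gradients and the Dirichlet energy *)

Section weak_gradients.
Context (R : realType) (n : nat).
Local Notation E := 'cV[R]_n.
Local Notation T := (caratheodory_type (lebesgue_outer R n)).
Local Notation mu := (leb R n).
Variable p : R.
Hypothesis p_ge1 : 1 <= p.

Lemma in_Lp_measurable (f : E -> R) : in_Lp p f -> measurable_fun setT (f : T -> R).
Proof. by move=> /(in_LpP _ p_ge1)[]. Qed.

Lemma in_Lp_linear (a : R) (f g : E -> R) : in_Lp p f -> in_Lp p g ->
  in_Lp p (fun x => a * f x + g x).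
Proof.
have p1 : (1 <= p%:E)%E by rewrite lee_fin.
have [_] := @Lfun_submod_closed _ T R mu p%:E p1.
by move=> + Lf Lg => /(_ a _ _ Lf Lg).
Qed.

Lemma ler_1_powR (t : R) : 0 <= t -> t <= 1 + t `^ p.
Proof.
move=> t0; have [t1|t1] := leP t 1; first by rewrite (le_trans t1)// lerDl powR_ge0.
rewrite -[leLHS](powRr1 t0) (le_trans (ler_powR (ltW t1) p_ge1))// lerDr//.
Qed.

(** The product is dominated by [|phi|] plus [B] times the [p]-th power of [|f|], where [B] bounds
    [phi]; all [p >= 1] are treated alike, without conjugate exponents. *)
Lemma Lp_test_integrable (f phi : E -> R) : in_Lp p f ->
  test_function phi -> mu.-integrable setT (fun x : T => (f x * phi x)%:E).
Proof.
move=> /(in_LpP _ p_ge1)[mf If] tphi; have mphi := test_measurable tphi.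
have [B B0 phiB] := test_bounded tphi.
have mfphi : measurable_fun setT (fun x : T => (f x * phi x)%:E).
  by apply/measurable_EFinP; exact: measurable_funM mf mphi.
have I1 : mu.-integrable setT (fun x : T => (`|phi x|)%:E).
  by have := integrable_abse (test_integrable tphi).
have I2 := integrableZl measurableT B If.
have I3 := integrableD measurableT I1 I2.
apply: (le_integrable measurableT mfphi _ I3) => x _.
rewrite /= lee_fin normrM [leRHS]ger0_norm; last first.
  by apply: addr_ge0 => //; apply: mulr_ge0 => //; exact: powR_ge0.
apply: (@le_trans _ _ ((1 + `|f x| `^ p) * `|phi x|)).
  by apply: ler_wpM2r => //; exact: ler_1_powR.
rewrite mulrDl mul1r lerD2l mulrC; apply: ler_wpM2r; last exact: phiB.
exact: powR_ge0.
Qed.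

Definition grad (phi : E -> R) (x : E) : E := \col_i partial i phi x.

Lemma weak_partial_linear (a : R) i (f g F G : E -> R) :
  in_Lp p f -> in_Lp p g -> in_Lp p F -> in_Lp p G ->
  weak_partial i f F -> weak_partial i g G ->
  weak_partial i (fun x => a * f x + g x) (fun x => a * F x + G x).
Proof.
move=> Lf Lg LF LG fF gG psi tpsi; have tdpsi := test_partial i tpsi.
have split (u v w : E -> R) : in_Lp p u -> in_Lp p v -> test_function w ->
    \int[mu]_x ((a * u x + v x) * w x) =
    a * \int[mu]_x (u x * w x) + \int[mu]_x (v x * w x).
  move=> Lu Lv tw; have Iu := Lp_test_integrable Lu tw.
  have Iv := Lp_test_integrable Lv tw.
  rewrite -RintegralZl// -RintegralD//; last exact: (integrableZl measurableT a Iu).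
  by apply: eq_Rintegral => x _; rewrite mulrDl mulrA.
by rewrite !split// fF// gG// mulrN opprD.
Qed.

Lemma is_weak_gradient_linear (a : R) (f g : E -> R) (F G : E -> E) :
  in_Lp p f -> in_Lp p g -> is_weak_gradient p f F -> is_weak_gradient p g G ->
  is_weak_gradient p (fun x => a * f x + g x) (fun x => a *: F x + G x).
Proof.
move=> Lf Lg fF gG i; have [LF fFi] := fF i; have [LG gGi] := gG i.
rewrite (_ : (fun x => (a *: F x + G x) i 0) = fun x => a * F x i 0 + G x i 0).
  by split; [exact: in_Lp_linear|exact: weak_partial_linear].
by apply/funext => x; rewrite !mxE.
Qed.

Lemma is_weak_gradient_unique (f : E -> R) (F G : E -> E) : in_Lp p f ->
  is_weak_gradient p f F -> is_weak_gradient p f G ->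
  {ae mu, forall x, F x = G x}.
Proof.
move=> Lf fF fG.
have H i : {ae mu, forall x, -1 * F x i 0 + G x i 0 = 0}.
  have [LF fFi] := fF i; have [LG gGi] := fG i.
  apply: fundamental_lemma.
  - by apply: in_Lp_measurable; exact: in_Lp_linear.
  - by move=> phi tphi; apply: Lp_test_integrable => //; exact: in_Lp_linear.
  - move=> phi tphi; have Iphi := Lp_test_integrable (in_Lp_linear (-1) LF LG) tphi.
    rewrite -[LHS]fineK; last exact: integrable_fin_num.
    congr EFin.
    (* Both gradients belong to the same function: the combination [-1 * f + f] is 0, so the
       difference of the components integrates to 0 against [phi]. *)
    have := weak_partial_linear (-1) Lf Lf LF LG fFi gGi tphi.
    rewrite /Rintegral => /eqP; rewrite -eqr_oppLR => /eqP <-.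
    under eq_integral do rewrite mulN1r addNr mul0r.
    by rewrite integral0 oppr0.
apply: filterS (filter_forall _ H) => x Hx; apply/matrixP => i j.
by rewrite ord1; have := Hx i; lra.
Qed.

(** Integration by parts: [phi * psi] is a test function, so its partial derivative has integral
    0. *)
Lemma test_weak_gradient (phi : E -> R) : test_function phi -> is_weak_gradient p phi (grad phi).
Proof.
move=> tphi i; rewrite (_ : (fun x => grad phi x i 0) = partial i phi); last first.
  by apply/funext => x; rewrite mxE.
split; first by apply: test_in_Lp => //; exact: test_partial.
move=> psi tpsi.
have I1 := Lp_test_integrable (test_in_Lp p_ge1 tphi) (test_partial i tpsi).
have I2 := Lp_test_integrable (test_in_Lp p_ge1 (test_partial i tphi)) tpsi.
apply/eqP; rewrite -subr_eq0 opprK -RintegralD//; apply/eqP.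
rewrite /Rintegral.
have := integral_partial i (test_mul_smooth (test_smooth tphi) tpsi).
rewrite (_ : partial i (fun x => phi x * psi x) = fun x => phi x * partial i psi x + partial i phi x * psi x).
  by move=> ->.
apply/funext => x; rewrite /partial deriveM; last 2 first.
- exact: test_derivable.
- exact: test_derivable.
by congr (_ + _); rewrite [LHS]mulrC.
Qed.

Lemma test_W1p (phi : E -> R) : test_function phi -> W1p p phi.
Proof.
move=> tphi; split; first exact: test_in_Lp.
by exists (grad phi); exact: test_weak_gradient.
Qed.

Lemma weak_gradientP (f : E -> R) : W1p p f -> is_weak_gradient p f (weak_gradient p f).
Proof. by move=> [_ [G fG]]; apply: (@xgetPex _ (fun=> 0) [set G | is_weak_gradient p f G]); exists G. Qed.

Lemma weak_gradient_ae (f : E -> R) (G : E -> E) : W1p p f -> is_weak_gradient p f G ->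
  {ae mu, forall x, weak_gradient p f x = G x}.
Proof.
by move=> Wf; apply: is_weak_gradient_unique; [case: Wf|exact: weak_gradientP].
Qed.

Lemma weak_gradient_test (phi : E -> R) : test_function phi ->
  {ae mu, forall x, weak_gradient p phi x = grad phi x}.
Proof.
by move=> tphi; apply: weak_gradient_ae; [exact: test_W1p|exact: test_weak_gradient].
Qed.

Lemma weak_gradientB (f phi : E -> R) : W1p p f -> test_function phi ->
  W1p p (fun x => f x - phi x) /\
  {ae mu, forall x, weak_gradient p (fun x => f x - phi x) x = weak_gradient p f x - grad phi x}.
Proof.
move=> Wf tphi; have Lf : in_Lp p f by case: Wf.
have Lphi := test_in_Lp p_ge1 tphi.
have E1 : (fun x => f x - phi x) = (fun x => -1 * phi x + f x).
  by apply/funext => x; rewrite mulN1r addrC.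
have E2 : (fun x => weak_gradient p f x - grad phi x) =
          (fun x => -1 *: grad phi x + weak_gradient p f x).
  by apply/funext => x; rewrite scaleN1r addrC.
have WG : is_weak_gradient p (fun x => f x - phi x) (fun x => weak_gradient p f x - grad phi x).
  rewrite E1 E2; apply: is_weak_gradient_linear => //.
    exact: test_weak_gradient.
  exact: weak_gradientP.
have W : W1p p (fun x => f x - phi x).
  by split; [rewrite E1; exact: in_Lp_linear|eexists; exact: WG].
by split => //; exact: weak_gradient_ae.
Qed.

End weak_gradients.

Lemma ler_sum2 (R : realType) (n : nat) (a b c d : 'I_n -> R) :
  (forall i, a i + b i <= c i + d i) ->
  \sum_i a i + \sum_i b i <= \sum_i c i + \sum_i d i.
Proof. by move=> abcd; rewrite -!big_split/=; apply: ler_sum => i _; exact: abcd. Qed.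

Lemma le_RintegralD2 d (T : measurableType d) (R : realType)
    (mu : {measure set T -> \bar R}) (f1 f2 g1 g2 : T -> R) :
  mu.-integrable setT (EFin \o f1) -> mu.-integrable setT (EFin \o f2) ->
  mu.-integrable setT (EFin \o g1) -> mu.-integrable setT (EFin \o g2) ->
  (forall x, f1 x + f2 x <= g1 x + g2 x) ->
  \int[mu]_x f1 x + \int[mu]_x f2 x <= \int[mu]_x g1 x + \int[mu]_x g2 x.
Proof.
move=> If1 If2 Ig1 Ig2 fg; rewrite -!RintegralD//; apply: le_Rintegral => //.
- exact: (integrableD measurableT If1 If2).
- exact: (integrableD measurableT Ig1 Ig2).
Qed.

Section dirichlet.
Context (R : realType) (n : nat).
Local Notation E := 'cV[R]_n.
Local Notation T := (caratheodory_type (lebesgue_outer R n)).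
Local Notation mu := (leb R n).
Variable p : R.
Hypothesis p_ge1 : 1 <= p.

Let p_gt0 : 0 < p. Proof. exact: lt_le_trans p_ge1. Qed.

Lemma normr_powR_convex (a b s : R) : 0 <= s <= 1 ->
  `|(1 - s) * a + s * b| `^ p <= (1 - s) * `|a| `^ p + s * `|b| `^ p.
Proof.
move=> /andP[s0 s1]; have s1' : 0 <= 1 - s by rewrite subr_ge0.
apply: (@le_trans _ _ (((1 - s) * `|a| + s * `|b|) `^ p)).
  rewrite ge0_ler_powR ?nnegrE ?(ltW p_gt0)//.
    by rewrite addr_ge0// mulr_ge0.
  by rewrite (le_trans (ler_normD _ _))// !normrM (ger0_norm s0) (ger0_norm s1').
have := @convex_powR R p p_ge1 (Itv01 s0 s1) `|b| `|a|.
rewrite !inE/= !in_itv/= !normr_ge0/=.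
by rewrite [(1 - s) * `|a| + _]addrC [leRHS]addrC => /(_ isT isT).
Qed.

Lemma normr_powRD (a b : R) : `|a + b| `^ p <= 2 `^ p * (`|a| `^ p + `|b| `^ p).
Proof.
have h : 0 <= (2^-1 : R) <= 1 by apply/andP; split; lra.
have := normr_powR_convex (2 * a) (2 * b) h.
rewrite (_ : 1 - 2^-1 = 2^-1); last by lra.
have two0 : (2 : R) != 0 by rewrite pnatr_eq0.
rewrite !(mulKf two0) !normrM !powRM// (ger0_norm (ler0n R 2)) => /le_trans; apply.
rewrite -!mulrDr; apply: ler_piMl; last lra.
by rewrite mulr_ge0 ?addr_ge0 ?powR_ge0.
Qed.

(** Comparable, with constants depending on [n] and [p], to the [p]-th power of the length of the
    gradient. Summing over coordinates reduces convexity and submodularity to inequalities between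
    real numbers. *)
Definition dirichlet (phi : E -> R) (x : E) : R :=
  \sum_(i < n) `|partial i phi x| `^ p.

Definition dirichlet_energy (phi : E -> R) : R := \int[mu]_x dirichlet phi x.

Lemma dirichlet_ge0 (phi : E -> R) x : 0 <= dirichlet phi x.
Proof. by apply: sumr_ge0 => i _; exact: powR_ge0. Qed.

Lemma dirichlet_energy_ge0 (phi : E -> R) : 0 <= dirichlet_energy phi.
Proof. by apply: Rintegral_ge0 => x _; exact: dirichlet_ge0. Qed.

Lemma test_powR_integrable (phi : E -> R) : test_function phi ->
  mu.-integrable setT (fun x : T => (`|phi x| `^ p)%:E).
Proof. by move=> tphi; have /(in_LpP _ p_ge1)[] := test_in_Lp p_ge1 tphi. Qed.

Lemma dirichlet_integrable (phi : E -> R) : test_function phi ->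
  mu.-integrable setT (EFin \o (dirichlet phi : T -> R)).
Proof.
move=> tphi; rewrite (_ : EFin \o _ = fun x : T => (\sum_(i < n) (`|partial i phi x| `^ p)%:E)%E).
  by apply: integrable_sum => // i _; exact/test_powR_integrable/test_partial.
by apply/funext => x; rewrite /= /dirichlet -sumEFin.
Qed.

Lemma dirichlet_energyZ (a : R) (phi : E -> R) : test_function phi ->
  dirichlet_energy (fun x => a * phi x) = `|a| `^ p * dirichlet_energy phi.
Proof.
move=> tphi; rewrite /dirichlet_energy -RintegralZl//; last exact: dirichlet_integrable.
apply: eq_Rintegral => x _; rewrite /dirichlet mulr_sumr; apply: eq_bigr => i _.
by rewrite /partial deriveMl ?normrM ?powRM//; exact: test_derivable.
Qed.

Lemma dirichlet_translate (a : E) (phi : E -> R) x :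
  dirichlet (fun y => phi (y + a)) x = dirichlet phi (x + a).
Proof. by apply: eq_bigr => i _; rewrite /partial derive_translate. Qed.

Lemma dirichlet_energy_translate (a : E) (phi : E -> R) : test_function phi ->
  dirichlet_energy (fun x => phi (x + a)) = dirichlet_energy phi.
Proof.
move=> tphi; have /integrableP[/measurable_EFinP mphi _] := dirichlet_integrable tphi.
have E1 : dirichlet (fun x => phi (x + a)) = (fun x => dirichlet phi (x + a)).
  by apply/funext => x; exact: dirichlet_translate.
by rewrite /dirichlet_energy E1; exact: (congr1 fine (integral_translate a mphi)).
Qed.

Lemma dirichlet_energy_convex (s : R) (phi psi : E -> R) : 0 <= s <= 1 ->
  test_function phi -> test_function psi ->
  dirichlet_energy (fun x => (1 - s) * phi x + s * psi x) <=
  (1 - s) * dirichlet_energy phi + s * dirichlet_energy psi.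
Proof.
move=> s01 tphi tpsi; have Iphi := dirichlet_integrable tphi.
have Ipsi := dirichlet_integrable tpsi.
have t1 : test_function (fun x => (1 - s) * phi x) by exact: test_scale.
have t2 : test_function (fun x => s * psi x) by exact: test_scale.
have J1 : mu.-integrable setT (EFin \o (fun x : T => (1 - s) * dirichlet phi x)).
  exact: (integrableZl measurableT (1 - s) Iphi).
have J2 : mu.-integrable setT (EFin \o (fun x : T => s * dirichlet psi x)).
  exact: (integrableZl measurableT s Ipsi).
have J : mu.-integrable setT
    (EFin \o (fun x : T => (1 - s) * dirichlet phi x + s * dirichlet psi x)).
  exact: (integrableD measurableT J1 J2).
rewrite /dirichlet_energy -(RintegralZl (1 - s) measurableT Iphi).
rewrite -(RintegralZl s measurableT Ipsi) -(RintegralD measurableT J1 J2).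
apply: (le_Rintegral measurableT (dirichlet_integrable (test_add t1 t2)) J).
move=> x _; rewrite /dirichlet !mulr_sumr -big_split/=; apply: ler_sum => i _.
rewrite /partial deriveD; [|exact: test_derivable|exact: test_derivable].
rewrite !deriveMl; [|exact: test_derivable|exact: test_derivable].
exact: normr_powR_convex.
Qed.

(* From [max f g = g + (f - g)^+] and [min f g = f - (f - g)^+]. *)
Definition smooth_max (e : R) (f g : E -> R) (x : E) := g x + smooth_pos e (f x - g x).
Definition smooth_min (e : R) (f g : E -> R) (x : E) := f x - smooth_pos e (f x - g x).

Lemma test_closure2 (f g F : E -> R) : smooth_closure F ->
  test_function f -> test_function g ->
  (forall x, f x = 0 -> g x = 0 -> F x = 0) -> test_function F.
Proof.
move=> sF tf tg fgF; have [sf [M fM]] := (test_functionP f).1 tf.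
have [sg [N gN]] := (test_functionP g).1 tg.
apply/test_functionP; split; first exact: smooth_closureW.
exists (Num.max M N) => x xMN; apply: fgF.
  by apply: fM; apply: contra_not xMN; apply: le_cube; rewrite le_max lexx.
by apply: gN; apply: contra_not xMN; apply: le_cube; rewrite le_max lexx orbT.
Qed.

Section smooth_lattice.
Variables (e : R) (f g : E -> R).
Hypotheses (e_gt0 : 0 < e) (tf : test_function f) (tg : test_function g).

Let closure_pos : smooth_closure (fun x => smooth_pos e (f x - g x)).
Proof.
apply: closure_comp; first exact: smooth1_smooth_pos.
by apply: test_base; exact: test_sub.
Qed.

Lemma test_smooth_max : test_function (smooth_max e f g).
Proof.
apply: (test_closure2 _ tf tg) => [|x fx0 gx0].
  by apply: closure_add; [exact: test_base|exact: closure_pos].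
by rewrite /smooth_max fx0 gx0 subrr smooth_pos_le0 ?addr0.
Qed.

Lemma test_smooth_min : test_function (smooth_min e f g).
Proof.
apply: (test_closure2 _ tf tg) => [|x fx0 gx0]; last first.
  by rewrite /smooth_min fx0 gx0 subrr smooth_pos_le0 ?subr0.
have : smooth_closure (fun x => f x + -1 * smooth_pos e (f x - g x)).
  apply: closure_add; first exact: test_base.
  by apply: closure_mul; [exact: closure_cst|exact: closure_pos].
by congr smooth_closure; apply/funext => x; rewrite mulN1r.
Qed.

Lemma smooth_max_ge x : Num.max (f x) (g x) - e <= smooth_max e f g x.
Proof.
have h1 := smooth_pos_geB e_gt0 (f x - g x); have h2 := smooth_pos_ge0 e (f x - g x).
move: (e_gt0); rewrite /smooth_max lerBlDr ge_max => ?; apply/andP; split; lra.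
Qed.

Lemma smooth_min_ge x : Num.min (f x) (g x) <= smooth_min e f g x.
Proof.
rewrite /smooth_min; have [h|h] := leP (f x) (g x).
  by rewrite smooth_pos_le0 ?subr0// subr_le0.
by have := @smooth_pos_le R e e_gt0 (f x - g x); rewrite subr_ge0 (ltW h) => /(_ isT); lra.
Qed.

(* The two gradients are convex combinations with exchanged weights, whence
   submodularity. *)
Lemma partial_smooth_lattice x : exists2 s : R, 0 <= s <= 1 & forall i,
  partial i (smooth_max e f g) x = (1 - s) * partial i g x + s * partial i f x /\
  partial i (smooth_min e f g) x = (1 - s) * partial i f x + s * partial i g x.
Proof.
exists (derive1 (smooth_pos e) (f x - g x)); first exact: derive_smooth_pos.
move=> i; have df := @test_derivable _ _ f i x tf; have dg := @test_derivable _ _ g i x tg.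
have dfg := @test_derivable _ _ _ i x (test_sub tf tg).
have db := @smooth1_derivable _ _ (smooth1_smooth_pos e_gt0) (f x - g x).
have [dc Dc] := derivable_compr dfg db.
rewrite /partial; split.
  rewrite (deriveD dg dc) Dc (deriveB df dg); ring.
by rewrite (deriveB df dc) Dc (deriveB df dg); ring.
Qed.

Lemma dirichlet_energy_submodular :
  dirichlet_energy (smooth_max e f g) + dirichlet_energy (smooth_min e f g) <=
  dirichlet_energy f + dirichlet_energy g.
Proof.
have Imax := dirichlet_integrable test_smooth_max.
have Imin := dirichlet_integrable test_smooth_min.
have If := dirichlet_integrable tf; have Ig := dirichlet_integrable tg.
apply: (le_RintegralD2 Imax Imin If Ig) => x; apply: ler_sum2 => i.
have [s s01 Es] := partial_smooth_lattice x; have [-> ->] := Es i.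
have := normr_powR_convex (partial i g x) (partial i f x) s01.
have := normr_powR_convex (partial i f x) (partial i g x) s01.
move: (partial i f x) (partial i g x) => a b; lra.
Qed.

End smooth_lattice.
End dirichlet.

(** * Ball averages *)

Section riemann_sums.
Context d (T : measurableType d) (R : realType) (mu : {measure set T -> \bar R}).
Variables (X : Type) (F : X -> T -> R) (U : T -> set T) (e : R) (c0 : T).
Hypothesis mU : forall c, measurable (U c).
Hypothesis FU : forall x y c, U c y -> `|F x y - F x c| <= e.

(** The cell of each center is cut off from what remains of [A]. The weights are the measures of the
    cells: they do not depend on [x], and they add up exactly to the measure of [A]. *)
Lemma riemann_sum (s : seq T) (A : set T) : measurable A -> (mu A < +oo)%E ->
  (forall x, mu.-integrable A (EFin \o F x)) ->
  (forall y, A y -> exists2 k, (k < size s)%N & U (nth c0 s k) y) ->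
  exists l : nat -> R, [/\ forall k, 0 <= l k,
    \sum_(k < size s) l k = fine (mu A) &
    forall x, `|\int[mu]_(y in A) F x y - \sum_(k < size s) l k * F x (nth c0 s k)| <=
      e * fine (mu A)].
Proof.
elim: s A => [|c s ih] A mA Aoo IA As.
  have A0 : A = set0 by apply/seteqP; split => // y /As[].
  exists (fun=> 0); split => // [|x]; first by rewrite big_ord0 A0 measure0.
  by rewrite big_ord0 A0 measure0 Rintegral_set0 subrr normr0 mulr0.
have mAU : measurable (A `&` U c) by exact: measurableI.
have mAD : measurable (A `\` U c) by exact: measurableD.
have fin B : measurable B -> B `<=` A -> mu B \is a fin_num.
  move=> mB BA; rewrite ge0_fin_numE//; apply: le_lt_trans Aoo.
  by apply: le_measure; rewrite ?inE.
have fAU := fin _ mAU (@subIsetl _ _ _); have fAD := fin _ mAD (@subDsetl _ _ _).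
have IAU x := integrableS mA mAU (@subIsetl _ _ _) (IA x).
have IAD x := integrableS mA mAD (@subDsetl _ _ _) (IA x).
have muA : fine (mu A) = fine (mu (A `&` U c)) + fine (mu (A `\` U c)).
  by rewrite (measureDI mu mA (mU c)) fineD// addrC.
have AoD : (mu (A `\` U c) < +oo)%E by rewrite -ge0_fin_numE.
have AsD y : (A `\` U c) y -> exists2 k, (k < size s)%N & U (nth c0 s k) y.
  by move=> [Ay nUy]; have [[|k] ks Uk] := As y Ay; [case: nUy|exists k].
have [l [l0 lA lF]] := ih _ mAD AoD IAD AsD.
exists (fun k => if k is k'.+1 then l k' else fine (mu (A `&` U c))); split.
- by case=> [|k] //; rewrite fine_ge0.
- by rewrite big_ord_recl/= lA muA.
move=> x; rewrite big_ord_recl/= muA.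
have -> : \int[mu]_(y in A) F x y =
    \int[mu]_(y in A `&` U c) F x y + \int[mu]_(y in A `\` U c) F x y.
  rewrite -{1}(setUIDK A (U c)) Rintegral_setU//; first by rewrite setUIDK; exact: IA.
  by apply/disj_setPS => y [[_ Uy] [_]].
rewrite [in X in X <= _]opprD addrACA mulrDr.
apply: (le_trans (ler_normD _ _)); apply: lerD; last exact: lF.
rewrite [X in `|_ - X|]mulrC -(Rintegral_cst mu mAU (F x c)) -(Rintegral_cst mu mAU e).
have IF := IAU x.
have Icst r : mu.-integrable (A `&` U c) (EFin \o cst r).
  apply: measurable_bounded_integrable => //; first by rewrite -ge0_fin_numE.
  by exists `|r|; split; [exact: num_real|move=> M rM y _; exact: ltW].
rewrite -RintegralB//; last exact: Icst.
have IB : mu.-integrable (A `&` U c) (EFin \o (fun y => F x y - F x c)).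
  exact: (integrableB mAU IF (Icst (F x c))).
apply: (le_trans (le_normr_Rintegral mAU IB)).
apply: le_Rintegral => //; [exact: (integrable_abse IB)|exact: Icst|].
by move=> y [_ Uy]; exact: FU.
Qed.

End riemann_sums.

Section ball_averages.
Context (R : realType) (n : nat).
Local Notation E := 'cV[R]_n.
Local Notation T := (caratheodory_type (lebesgue_outer R n)).
Local Notation mu := (leb R n).
Implicit Types (x y v : E) (r : R).

Lemma euclidE (m : nat) (x : 'M[R]_(n, m)) :
  euclid x = Num.sqrt (\sum_j \sum_i x i j ^+ 2).
Proof.
rewrite /euclid /dotmx /mxtrace; congr Num.sqrt; apply: eq_bigr => j _.
by rewrite mxE; apply: eq_bigr => i _; rewrite !mxE expr2.
Qed.

Lemma ler_entry_euclid (m : nat) (x : 'M[R]_(n, m)) i j : `|x i j| <= euclid x.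
Proof.
rewrite euclidE -sqrtr_sqr ler_sqrt.
  rewrite (bigD1 j)//= (bigD1 i)//= -addrA lerDl addr_ge0//.
    by apply: sumr_ge0 => k _; exact: sqr_ge0.
  by apply: sumr_ge0 => k _; apply: sumr_ge0 => l _; exact: sqr_ge0.
by apply: sumr_ge0 => k _; apply: sumr_ge0 => l _; exact: sqr_ge0.
Qed.

Definition eball x r : set E := [set y | euclid (y - x) < r].

Lemma eball_open x r : open (eball x r).
Proof.
have sE : smooth_closure (fun y : E => \sum_(j < 1) \sum_(i < n) (y + - x) i j ^+ 2).
  rewrite (_ : (fun _ => _) = fun y => \sum_(i < n) (y + - x) i 0 ^+ 2); last first.
    by apply/funext => y; rewrite big_ord1.
  apply: (@closure_translate _ _ (fun y => \sum_(i < n) y i 0 ^+ 2)).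
  elim: (index_enum 'I_n) => [|i s ih].
    rewrite (_ : (fun _ => _) = fun=> 0); first exact: closure_cst.
    by apply/funext => y; rewrite big_nil.
  rewrite (_ : (fun _ => _) = fun y => y i 0 * y i 0 + \sum_(i <- s) y i 0 ^+ 2).
    apply: closure_add => //; apply: closure_mul; exact: closure_coord.
  by apply/funext => y; rewrite big_cons expr2.
have [cE _ _] := smooth_closure_step sE.
have cE' : continuous (fun y : E => euclid (y - x)).
  move=> y; rewrite (_ : (fun _ => _) = Num.sqrt \o (fun y : E => \sum_(j < 1) \sum_(i < n) (y + - x) i j ^+ 2)).
    by apply: continuous_comp; [exact: cE|exact: sqrt_continuous].
  by apply/funext => z; rewrite /= euclidE.
rewrite (_ : eball x r = (fun y : E => euclid (y - x)) @^-1` [set t | t < r]) //.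
apply: open_comp; last exact: open_lt.
by move=> y _; exact: cE'.
Qed.

Lemma measurable_eball x r : measurable (eball x r : set T).
Proof. exact/open_measurable_leb/eball_open. Qed.

Lemma eball_translate x r : eball x r = translate (- x) @^-1` (eball 0 r).
Proof. by apply/seteqP; split => y; rewrite /eball /translate/= subr0. Qed.

Lemma leb_eball x r : mu (eball x r) = mu (eball 0 r).
Proof. by rewrite eball_translate leb_translate. Qed.

Lemma eball_sub_box x r :
  eball x r `<=` box (x - const_mx r, x + const_mx r).
Proof.
move=> y yx i; rewrite !mxE; have := ler_entry_euclid (y - x) i 0.
by move=> /le_trans/(_ (ltW yx)); rewrite !mxE ler_distl.
Qed.

Lemma leb_eball_lty x r : (mu (eball x r) < +oo)%E.
Proof. exact: leb_bounded_lty (@eball_sub_box x r). Qed.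

Lemma leb_eball_gt0 x r : 0 < r -> 0 < fine (mu (eball x r)).
Proof.
move=> r0; apply: fine_gt0; rewrite leb_eball_lty andbT.
apply: leb_open_gt0; first exact: eball_open.
exists x; rewrite /eball/= subrr euclidE big1 ?sqrtr0// => i _.
by rewrite big1// => j _; rewrite mxE expr0n.
Qed.

(** With the center moved into the argument, the domain is fixed and a single partition of
    [eball 0 r] serves all [x]. *)
Lemma ball_averageE (f : E -> R) x r : measurable_fun setT (f : T -> R) ->
  ball_average f x r = (\int[mu]_(y in eball 0 r) f (x + y)) / fine (mu (eball 0 r)).
Proof.
move=> mf; rewrite /ball_average -/(eball x r) leb_eball; congr (_ / _).
rewrite /Rintegral; congr fine; rewrite integral_mkcond [RHS]integral_mkcond.
have mg : measurable_fun setT (f \_ (eball x r) : T -> R).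
  apply/(measurable_restrictT _ (measurable_eball x r)).
  exact: measurable_funTS.
apply: (@etrans _ _ (\int[mu]_y ((f \_ (eball x r)) y)%:E)%E).
  by apply: eq_integral => y _; rewrite !patchE; case: ifP.
rewrite -(integral_translate x mg); apply: eq_integral => y _.
have xy : (y + x \in eball x r) = (y \in eball 0 r).
  by apply/idP/idP; rewrite !inE /eball/= addrK subr0.
by rewrite !patchE xy addrC; case: ifP.
Qed.

End ball_averages.

(** * Energy of convex combinations *)

Section convex_combinations.
Context (R : realType) (n : nat).
Local Notation E := 'cV[R]_n.
Local Notation T := (caratheodory_type (lebesgue_outer R n)).
Local Notation mu := (leb R n).
Variable p : R.
Hypothesis p_ge1 : 1 <= p.

(** Convexity for two functions, iterated: with [S] the sum of the first weights and [u] the partial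
    sum, the next sum is [S + l N] times a convex combination of [u / S] and [phi N]. The case
    [S = 0], where [u] vanishes, is apart. *)
Lemma dirichlet_energy_comb (N : nat) (l : nat -> R) (phi : nat -> E -> R) (M : R) :
  (forall k, 0 <= l k) -> 0 <= M ->
  (forall k, test_function (phi k)) -> (forall k, dirichlet_energy p (phi k) <= M) ->
  test_function (fun x => \sum_(k < N) l k * phi k x) /\
  dirichlet_energy p (fun x => \sum_(k < N) l k * phi k x) <=
    (\sum_(k < N) l k) `^ p * M.
Proof.
move=> l0 M0 tphi phiM; have p0 : 0 < p by exact: lt_le_trans p_ge1.
elim: N => [|N [tu uM]].
  rewrite (_ : (fun _ => _) = fun=> 0 * phi 0%N (0 : E)); last first.
    by apply/funext => x; rewrite big_ord0 mul0r.
  have t0 : test_function (fun _ : E => 0 : R) by exact: test_0.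
  have E0 : (fun=> 0 * phi 0%N (0 : E)) = (fun x : E => 0 * 0) :> (E -> R).
    by apply/funext => x; rewrite !mul0r.
  rewrite E0; split; first exact: (test_scale 0 t0).
  rewrite (dirichlet_energyZ p_ge1 0 t0) normr0 powR0 ?gt_eqF// mul0r.
  by rewrite mulr_ge0// powR_ge0.
set u : E -> R := fun x => _ in tu uM; set S := \sum_(k < N) l k in uM.
have uE : (fun x => \sum_(k < N.+1) l k * phi k x) = (fun x => u x + l N * phi N x).
  by apply/funext => x; rewrite big_ord_recr.
rewrite uE big_ord_recr/= -/S.
have tcphi : test_function (fun x => l N * phi N x) by exact: test_scale.
split; first exact: test_add.
have S0 : 0 <= S by exact: sumr_ge0.
have [SE|SN] := eqVneq S 0.
  have -> : (fun x => u x + l N * phi N x) = (fun x => l N * phi N x).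
    apply/funext => x; rewrite /u big1 ?add0r// => k _.
    have /psumr_eq0P/(_ k isT) -> := SE; first by rewrite mul0r.
    by move=> i _.
  rewrite SE add0r dirichlet_energyZ// ger0_norm//.
  by rewrite ler_wpM2l// powR_ge0.
have {SN}S0 : 0 < S by rewrite lt_neqAle eq_sym SN.
have Sc0 : 0 < S + l N by rewrite ltr_pwDl.
pose s := l N / (S + l N).
have s01 : 0 <= s <= 1.
  by rewrite /s divr_ge0 ?(ltW Sc0)//= ler_pdivrMr// mul1r lerDr ltW.
have tv : test_function (fun x => S^-1 * u x) by exact: test_scale.
have -> : (fun x => u x + l N * phi N x) =
    (fun x => (S + l N) * ((1 - s) * (S^-1 * u x) + s * phi N x)).
  apply/funext => x; rewrite /s; field.
  by rewrite !gt_eqF.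
rewrite dirichlet_energyZ//; last by apply: test_add; exact: test_scale.
rewrite (gtr0_norm Sc0) ler_wpM2l ?powR_ge0//.
apply: (le_trans (dirichlet_energy_convex p_ge1 s01 tv (tphi N))).
have vM : dirichlet_energy p (fun x => S^-1 * u x) <= M.
  rewrite dirichlet_energyZ// gtr0_norm ?invr_gt0//.
  rewrite (_ : S^-1 `^ p = (S `^ p)^-1); last by rewrite -powR_inv1 ?ltW// -powRrM mulN1r powRN.
  by rewrite ler_pdivrMl ?powR_gt0.
have /andP[s0 s1] := s01.
apply: (@le_trans _ _ ((1 - s) * M + s * M)); last by rewrite -mulrDl subrK mul1r.
apply: lerD; apply: ler_wpM2l; [by rewrite subr_ge0|exact: vM|exact: s0|exact: phiM].
Qed.

Lemma test_lipschitz_norm (phi : E -> R) : test_function phi ->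
  exists2 L, 0 <= L & forall (x v : E) (e : R), (forall i, `|v i 0| <= e) ->
    `|phi (x + v) - phi x| <= L * e.
Proof.
move=> tphi.
have /choice[M HM] : forall i, exists M, 0 <= M /\
    forall x (h : R), `|phi (x + h *: delta_mx i 0) - phi x| <= M * `|h|.
  by move=> i; have [M M0 HM] := test_lipschitz i tphi; exists M.
exists (\sum_i M i); first by apply: sumr_ge0 => i _; have [] := HM i.
move=> x v e ve.
have vE : v = \sum_i v i 0 *: delta_mx i 0.
  by rewrite {1}(matrix_sum_delta v); apply: eq_bigr => i _; rewrite big_ord1.
rewrite {1}vE mulr_suml; elim: (index_enum 'I_n) x => [|i s ih] x.
  by rewrite !big_nil addr0 subrr normr0.
rewrite !big_cons addrA.
set y := x + v i 0 *: delta_mx i 0.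
rewrite -(subrK (phi y) (phi (y + _))) -addrA.
apply: (le_trans (ler_normD _ _)); rewrite [leRHS]addrC; apply: lerD; first exact: ih.
have [M0 /(_ x (v i 0)) h] := HM i; apply: (le_trans h).
exact: ler_wpM2l.
Qed.

(** The rate is uniform in [x]. It identifies test functions with their precise representatives, and
    it allows a radius to be fixed before the point. *)
Lemma ball_average_test (phi : E -> R) : test_function phi ->
  exists2 L, 0 <= L & forall x r, 0 < r -> `|ball_average phi x r - phi x| <= L * r.
Proof.
move=> tphi; have [L L0 HL] := test_lipschitz_norm tphi; exists L => // x r r0.
have mB : measurable (eball 0 r : set T) by exact: measurable_eball.
have Boo := leb_eball_lty (0 : E) r; have B0 := leb_eball_gt0 (0 : E) r0.
rewrite (ball_averageE _ _ (test_measurable tphi)).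
have Itr : mu.-integrable (eball 0 r : set T) (fun y : T => (phi (x + y))%:E).
  apply: (integrableS measurableT) => //.
  have := test_integrable (test_translate x tphi).
  by congr (is_true (integrable _ _ _)); apply/funext => y; rewrite /= addrC.
have Icst (c : R) : mu.-integrable (eball 0 r : set T) (EFin \o cst c).
  apply: measurable_bounded_integrable => //.
  by exists `|c|; split; [exact: num_real|move=> M rM y _; exact: ltW].
have mulfB (a b c : R) : 0 < c -> (`|a / c - b| <= L * r) = (`|a - b * c| <= L * r * c).
  move=> c0; have -> : a / c - b = (a - b * c) / c by field; rewrite gt_eqF.
  by rewrite normrM (gtr0_norm (_ : 0 < c^-1)) ?invr_gt0// ler_pdivrMr.
rewrite (mulfB _ _ _ B0).
rewrite -(Rintegral_cst mu mB (phi x)) -(Rintegral_cst mu mB (L * r)).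
rewrite -RintegralB//; last exact: Icst.
have IB : mu.-integrable (eball 0 r : set T) (EFin \o (fun y : T => phi (x + y) - phi x)).
  exact: (integrableB mB Itr (Icst (phi x))).
apply: (le_trans (le_normr_Rintegral mB IB)).
apply: (le_Rintegral mB (integrable_abse IB) (Icst (L * r))) => y yr.
apply: HL => i; have := ler_entry_euclid (y - 0) i 0; rewrite subr0 => /le_trans; apply.
by move: yr; rewrite /eball/= subr0 => /ltW.
Qed.

End convex_combinations.

Lemma Lnorm_le_Rintegral d (T : measurableType d) (R : realType)
    (mu : {measure set T -> \bar R}) (p : R) (g h : T -> R) (eta : R) : 1 <= p -> 0 < eta ->
  measurable_fun setT g -> measurable_fun setT h -> {ae mu, forall x, `|g x| <= `|h x|} ->
  ('N[mu]_p%:E[EFin \o h] < (eta `^ p^-1)%:E)%E ->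
  \int[mu]_y `|g y| `^ p <= eta.
Proof.
move=> p_ge1 eta0 mg mh gh hlt; have p_gt0 : 0 < p by exact: lt_le_trans p_ge1.
have mpow (k : T -> R) : measurable_fun setT k -> measurable_fun setT (fun x => `|k x| `^ p).
  by move=> mk; apply: (measurableT_comp (measurable_powR p)); exact: measurableT_comp.
have : ('N[mu]_p%:E[EFin \o h] `^ p <= eta%:E)%E.
  have -> : eta%:E = ((eta `^ p^-1)%:E `^ p)%E.
    by rewrite poweR_EFin -powRrM mulVf ?gt_eqF// powRr1// ltW.
  apply: gt0_ler_poweR; rewrite ?(ltW p_gt0)//.
  - by rewrite in_itv/= leey Lnorm_ge0.
  - by rewrite in_itv/= leey lee_fin powR_ge0.
  - exact: ltW.
rewrite poweR_Lnorm ?gt_eqF// => hle.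
have gle : (\int[mu]_y (`|g y| `^ p)%:E <= eta%:E)%E.
  apply: le_trans hle; apply: (ae_ge0_le_integral measurableT) => //.
  - by apply/measurable_EFinP; exact: mpow.
  - by move=> x _; exact: poweR_ge0.
  - rewrite (_ : (fun _ => _) = EFin \o (fun x : T => `|h x| `^ p)).
      by apply/measurable_EFinP; exact: mpow.
    by apply/funext => x.
  - apply: filterS gh => x ghx _ /=; rewrite lee_fin.
    by rewrite ge0_ler_powR ?nnegrE// ltW.
have fin : (\int[mu]_y (`|g y| `^ p)%:E)%E \is a fin_num.
  rewrite ge0_fin_numE ?(le_lt_trans gle) ?ltry//.
  by apply: integral_ge0 => x _; rewrite lee_fin powR_ge0.
by rewrite /Rintegral -lee_fin fineK.
Qed.

(** * Averages of functions in [L_p] and approximation by test functions *)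

Section sobolev_averages.
Context (R : realType) (n : nat).
Local Notation E := 'cV[R]_n.
Local Notation T := (caratheodory_type (lebesgue_outer R n)).
Local Notation mu := (leb R n).
Variable p : R.
Hypothesis p_ge1 : 1 <= p.

Let p_gt0 : 0 < p. Proof. exact: lt_le_trans p_ge1. Qed.

Lemma finite_eball_cover (r e : R) : 0 < e ->
  exists s : seq E, forall y, cube r y -> exists2 k, (k < size s)%N & eball (nth 0 s k) e y.
Proof.
move=> e0; have := @compact_cube R n r.
rewrite compact_cover => /(_ E (cube r) (fun c => eball c e)) [c _|y yr|D _ cD].
- exact: eball_open.
- by exists y => //; rewrite /eball/= subrr euclidE big1 ?sqrtr0// => i _;
    rewrite big1// => j _; rewrite mxE expr0n.
- exists (finmap.enum_fset D) => y /cD [c /= cD' cy].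
  by exists (index c (finmap.enum_fset D)); [rewrite index_mem|rewrite nth_index].
Qed.

(* Riemann sums of a ball average are convex combinations of translates. *)
Lemma average_comb (psi : E -> R) (r t : R) : test_function psi -> 0 < r -> 0 < t ->
  exists chi, [/\ test_function chi, dirichlet_energy p chi <= dirichlet_energy p psi &
    forall x, `|chi x - ball_average psi x r| <= t].
Proof.
move=> tpsi r0 t0; have [L L0 HL] := test_lipschitz_norm tpsi.
pose e := t / (L + 1); have L1 : 0 < L + 1 by rewrite ltr_wpDl.
have e0 : 0 < e by rewrite divr_gt0.
have Le : L * e <= t by rewrite /e mulrA ler_pdivrMr// mulrC ler_pM2l// lerDl.
have [s Hs] := finite_eball_cover r e0.
have mB : measurable (eball 0 r : set T) by exact: measurable_eball.
have Boo := leb_eball_lty (0 : E) r; have B0 := leb_eball_gt0 (0 : E) r0.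
pose U (c : T) : set T := eball c e.
have mU c : measurable (U c) by exact: measurable_eball.
pose F (x : E) (y : T) := psi (x + y).
have FU x y c : U c y -> `|F x y - F x c| <= t.
  move=> yc; apply: le_trans Le; rewrite /F.
  have -> : x + y = x + c + (y - c) by rewrite -addrA [c + _]addrC subrK.
  apply: HL => i; apply: (le_trans (ler_entry_euclid _ _ _)).
  exact: ltW yc.
have IF x : mu.-integrable (eball 0 r : set T) (EFin \o F x).
  apply: (integrableS measurableT mB (@subsetT _ _)).
  have := test_integrable (test_translate x tpsi).
  by congr (is_true (integrable _ _ _)); apply/funext => y; rewrite /F /= addrC.
have cov y : (eball 0 r : set T) y -> exists2 k, (k < size s)%N & U (nth (0 : E) s k) y.
  move=> yr; apply: Hs; apply/cubeP => i.
  have := ler_entry_euclid (y - 0) i 0; rewrite subr0 => /le_trans; apply.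
  by move: yr; rewrite /eball/= subr0 => /ltW.
have [l [l0 lB lF]] := riemann_sum mU FU mB Boo IF cov.
set B := fine _ in lB lF B0.
pose l' k := B^-1 * l k.
have tphi k : test_function (fun x => psi (x + nth 0 s k)) by exact: test_translate.
have phiM k : dirichlet_energy p (fun x => psi (x + nth 0 s k)) <= dirichlet_energy p psi.
  by rewrite dirichlet_energy_translate.
have l'0 k : 0 <= l' k by rewrite mulr_ge0// invr_ge0 ltW.
have [tchi chiM] := dirichlet_energy_comb p_ge1 (size s) l'0 (dirichlet_energy_ge0 p psi) tphi phiM.
have suml' : \sum_(k < size s) l' k = 1.
  by rewrite -mulr_sumr lB mulVf// gt_eqF.
exists (fun x => \sum_(k < size s) l' k * psi (x + nth 0 s k)); split.
- exact: tchi.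
- by apply: (le_trans chiM); rewrite suml' powR1 mul1r.
move=> x; rewrite (ball_averageE _ _ (test_measurable tpsi)) distrC -/B.
have -> : \sum_(k < size s) l' k * psi (x + nth 0 s k) =
    (\sum_(k < size s) l k * F x (nth (0 : E) s k)) / B.
  rewrite mulr_suml; apply: eq_bigr => k _; rewrite /l' /F; ring.
rewrite -mulrBl normrM (gtr0_norm (_ : 0 < B^-1)) ?invr_gt0// ler_pdivrMr//.
exact: lF.
Qed.

Lemma integrable_cst_eball (k : R) (x : E) r : mu.-integrable (eball x r : set T) (EFin \o cst k).
Proof.
apply: measurable_bounded_integrable; [exact: measurable_eball|exact: leb_eball_lty|by []|].
by exists `|k|; split; [exact: num_real|move=> M rM y _; exact: ltW].
Qed.

Lemma Lp_integrable_eball (f : E -> R) (x : E) r : in_Lp p f ->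
  mu.-integrable (eball x r : set T) (EFin \o (f : T -> R)).
Proof.
move=> /(in_LpP _ p_ge1)[mf If]; have mB : measurable (eball x r : set T) by exact: measurable_eball.
have I1 := integrable_cst_eball 1 x r.
have I2 := integrableS measurableT mB (@subsetT _ _) If.
have I3 := integrableD mB I1 I2.
apply: (le_integrable mB _ _ I3).
  by apply/measurable_EFinP; exact: measurable_funTS.
move=> y _; rewrite /= lee_fin; apply: le_trans (ler_norm _); exact: ler_1_powR.
Qed.

Lemma normr_le_powR (k t : R) : 0 < k -> `|t| <= k + k * k^-1 `^ p * `|t| `^ p.
Proof.
move=> k0; have c0 : 0 <= k * k^-1 `^ p by rewrite mulr_ge0 ?powR_ge0// ltW.
have [h|h] := leP `|t| k; first by rewrite (le_trans h)// lerDl mulr_ge0// powR_ge0.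
rewrite -[leLHS]add0r lerD ?(ltW k0)// -mulrA -powRM ?invr_ge0 ?(ltW k0)//.
rewrite -[leLHS](mulVKf (lt0r_neq0 k0)) ler_pM2l//.
have h1 : 1 <= k^-1 * `|t| by rewrite ler_pdivlMl// mulr1 ltW.
by rewrite -[leLHS]powRr1 ?(le_trans ler01)// ler_powR.
Qed.

(** The pointwise bound [normr_le_powR] is [s <= 1 + s^p] for [s = |t| / k]. Once [k] and [r] are
    fixed, a small integral of the [p]-th power makes all averages at most [2 * k], uniformly in
    [x]. *)
Lemma ball_average_Lp (f : E -> R) (k r : R) x : in_Lp p f -> 0 < k -> 0 < r ->
  `|ball_average f x r| <=
    k + k * k^-1 `^ p * (\int[mu]_y `|f y| `^ p) / fine (mu (eball 0 r)).
Proof.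
move=> Lf k0 r0; have [mf If] := (in_LpP f p_ge1).1 Lf.
have mB : measurable (eball x r : set T) by exact: measurable_eball.
have B0 := leb_eball_gt0 x r0.
pose c := k * k^-1 `^ p; pose g (y : T) := c * `|f y| `^ p.
have c0 : 0 <= c by rewrite mulr_ge0 ?powR_ge0// ltW.
have Ig : mu.-integrable setT (EFin \o g) := integrableZl measurableT _ If.
have Icst := integrable_cst_eball k x r.
have IgB := integrableS measurableT mB (@subsetT _ _) Ig.
have Ikg : mu.-integrable (eball x r : set T) (EFin \o (fun y => k + g y)).
  exact: (integrableD mB Icst IgB).
have IfB := Lp_integrable_eball x r Lf.
have mulfB (a b V : R) : 0 < V -> `|a| <= k * V + b -> `|a / V| <= k + b / V.
  move=> V0 h; rewrite normrM (gtr0_norm (_ : 0 < V^-1)) ?invr_gt0// ler_pdivrMr//.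
  by rewrite mulrDl divfK ?gt_eqF.
rewrite /ball_average -/(eball x r) -(leb_eball x).
apply: mulfB => //.
apply: (le_trans (le_normr_Rintegral mB IfB)).
apply: (@le_trans _ _ (\int[mu]_(y in eball x r) (k + g y))).
  by apply: (le_Rintegral mB (integrable_abse IfB) Ikg) => y _; exact: normr_le_powR.
rewrite (RintegralD mB Icst IgB) (Rintegral_cst mu mB k) lerD2l.
rewrite -(RintegralZl _ measurableT If).
have sub : (\int[mu]_(y in eball x r) (g y)%:E <= \int[mu]_y (g y)%:E)%E.
  have mg : measurable_fun setT (EFin \o g) by have /integrableP[] := Ig.
  have g0 (y : T) : setT y -> (0 <= (EFin \o g) y)%E.
    by move=> _; rewrite lee_fin mulr_ge0// powR_ge0.
  exact: (ge0_subset_integral mu mB measurableT mg g0 (@subsetT _ _)).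
exact: (fine_le (integrable_fin_num mB IgB) (integrable_fin_num measurableT Ig) sub).
Qed.

Lemma ball_averageB (f g : E -> R) x r : in_Lp p f -> in_Lp p g ->
  ball_average (fun y => f y - g y) x r = ball_average f x r - ball_average g x r.
Proof.
move=> Lf Lg; have mB : measurable (eball x r : set T) by exact: measurable_eball.
rewrite /ball_average -mulrBl; congr (_ / _).
exact: (RintegralB mB (Lp_integrable_eball x r Lf) (Lp_integrable_eball x r Lg)).
Qed.

Lemma euclid_measurable (G : T -> E) : (forall i, measurable_fun setT (fun x => G x i 0)) ->
  measurable_fun setT (fun x => euclid (G x)).
Proof.
move=> mG; rewrite (_ : (fun _ => _) = Num.sqrt \o (fun x : T => \sum_i G x i 0 ^+ 2)); last first.
  by apply/funext => x; rewrite /= euclidE big_ord1.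
apply: measurableT_comp; first exact: (continuous_measurable_fun (@sqrt_continuous R)).
by apply: measurable_sum => i; exact: measurable_funX.
Qed.

Lemma W01p_approx (f : E -> R) (eta : R) : W01p p f -> 0 < eta ->
  exists phi, [/\ test_function phi,
    \int[mu]_y `|f y - phi y| `^ p <= eta &
    forall i, \int[mu]_y `|weak_gradient p f y i 0 - partial i phi y| `^ p <= eta].
Proof.
move=> [Wf fapp] eta0; have eta1 : 0 < eta `^ p^-1 by rewrite powR_gt0.
have [phi tphi nlt] := fapp _ eta1; exists phi.
have [Wg gae] := weak_gradientB p_ge1 Wf tphi.
have Gg := weak_gradientP Wg.
have mg : measurable_fun setT ((fun x => f x - phi x) : T -> R).
  by apply: (in_Lp_measurable p_ge1); case: Wg.
have mG i : measurable_fun setT ((fun x => weak_gradient p (f \- phi) x i 0) : T -> R).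
  by apply: (in_Lp_measurable p_ge1); have [] := Gg i.
have meu : measurable_fun setT (fun x : T => euclid (weak_gradient p (f \- phi) x)).
  exact: euclid_measurable.
have [n1 n2] : ('N[mu]_p%:E[EFin \o ((f \- phi)%R : T -> R)] < (eta `^ p^-1)%:E)%E /\
    ('N[mu]_p%:E[EFin \o (fun x : T => euclid (weak_gradient p ((f \- phi)%R) x))] < (eta `^ p^-1)%:E)%E.
  split; apply: le_lt_trans nlt; rewrite /normW1p; [apply: leeDl|apply: leeDr]; exact: Lnorm_ge0.
split => // [|i].
  apply: (Lnorm_le_Rintegral p_ge1 eta0 mg mg _ n1).
  exact: (aeW mu (fun x => lexx _)).
have Lfi : in_Lp p (fun x => weak_gradient p f x i 0) by have [] := weak_gradientP Wf i.
have mfi := in_Lp_measurable p_ge1 Lfi.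
have mphi := test_measurable (test_partial i tphi).
apply: (Lnorm_le_Rintegral p_ge1 eta0 _ meu _ n2); first exact: (measurable_funB mfi mphi).
apply: (@filterS _ _ (ae_filter_ringOfSetsType mu) _ _ _ gae) => x ->.
have := ler_entry_euclid (weak_gradient p f x - grad phi x) i 0.
by rewrite !mxE => /le_trans; apply; exact: ler_norm.
Qed.

End sobolev_averages.

(** * Capacity of increasing unions *)

Section capacity_of_unions.
Context (R : realType) (n : nat).
Local Notation E := 'cV[R]_n.
Local Notation T := (caratheodory_type (lebesgue_outer R n)).
Local Notation mu := (leb R n).
Variable p : R.
Hypothesis p_ge1 : 1 <= p.

Let p_gt0 : 0 < p. Proof. exact: lt_le_trans p_ge1. Qed.

(** The strict inequality makes [1 < psi x] define an open set containing [A], to which compactness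
    of [K] can be applied. *)
Definition dominating (A : set E) : set (E -> R) :=
  [set psi | test_function psi /\ forall x, A x -> 1 < psi x].

(** A real infimum, with the default value 0 if no test function dominates [A]; hence the
    nonemptiness required to approach it. *)
Definition dirichlet_capacity (A : set E) : R :=
  inf [set dirichlet_energy p psi | psi in dominating A].

Lemma dirichlet_capacity_le (A : set E) (psi : E -> R) : dominating A psi ->
  dirichlet_capacity A <= dirichlet_energy p psi.
Proof.
move=> Apsi; apply: ge_inf; last by exists psi.
by exists 0 => _ [phi _ <-]; exact: dirichlet_energy_ge0.
Qed.

Lemma dirichlet_capacity_adherent (A : set E) (e : R) : dominating A !=set0 -> 0 < e ->
  exists2 psi, dominating A psi & dirichlet_energy p psi <= dirichlet_capacity A + e.
Proof.
move=> [phi Aphi] e0.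
have hinf : has_inf [set dirichlet_energy p psi | psi in dominating A].
  split; first by exists (dirichlet_energy p phi); exists phi.
  by exists 0 => _ [psi _ <-]; exact: dirichlet_energy_ge0.
by have [_ [psi Apsi <-] lt] := inf_adherent e0 hinf; exists psi => //; exact: ltW.
Qed.

Lemma dirichlet_capacity_scale (A : set E) (t : R) (psi : E -> R) : 0 < t ->
  test_function psi -> (forall x, A x -> t < psi x) ->
  t `^ p * dirichlet_capacity A <= dirichlet_energy p psi.
Proof.
move=> t0 tpsi Apsi.
have : dirichlet_capacity A <= dirichlet_energy p (fun x => t^-1 * psi x).
  apply: dirichlet_capacity_le; split; first exact: test_scale.
  by move=> x Ax; rewrite ltr_pdivlMl// mulr1 Apsi.
rewrite dirichlet_energyZ// gtr0_norm ?invr_gt0//.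
rewrite (_ : t^-1 `^ p = (t `^ p)^-1); last first.
  by rewrite -powR_inv1 ?ltW// -powRrM mulN1r powRN.
by rewrite ler_pdivlMl ?powR_gt0.
Qed.

Lemma powR_near1 (s : R) : 0 < s < 1 -> exists2 k, 0 < k < 1 &
  forall k', 0 < k' <= k -> 1 - s <= (1 - k') `^ p.
Proof.
move=> /andP[s0 s1]; pose t := (1 - s) `^ p^-1.
have s1' : 0 < 1 - s by rewrite subr_gt0.
have t0 : 0 < t by rewrite powR_gt0.
have tp : t `^ p = 1 - s by rewrite -powRrM mulVf ?gt_eqF// powRr1// ltW.
have t1 : t < 1.
  rewrite ltNge; apply/negP => t1.
  have : 1 <= t `^ p.
    by have := @ge0_ler_powR R p (ltW p_gt0) 1 t; rewrite !nnegrE powR1 ler01 (ltW t0) => ->.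
  by rewrite tp; lra.
exists (1 - t); first by apply/andP; split; lra.
move=> k' /andP[k0 k1]; rewrite -tp ge0_ler_powR ?nnegrE ?(ltW p_gt0)//; lra.
Qed.

(* The smooth minimum of [g] and [f N.+1] exceeds almost [1] on [A N], so its
   energy is almost at least the capacity of [A N]; submodularity then bounds the
   energy of the maximum without accumulating the capacities. *)
Lemma finite_union_dominating (A : nat -> set E) (f : nat -> E -> R) (e : nat -> R) (M : R) :
  0 <= M -> (forall j, dirichlet_capacity (A j) <= M) ->
  (forall j, A j `<=` A j.+1) -> (forall j, dominating (A j) (f j)) ->
  (forall j, dirichlet_energy p (f j) <= dirichlet_capacity (A j) + e j) ->
  forall (N : nat) (k : R), 0 < k < 1 ->
  exists g, [/\ test_function g,
    forall j x, (j <= N)%N -> 1 < f j x -> 1 - k < g x &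
    dirichlet_energy p g <= dirichlet_capacity (A N) + \sum_(j < N.+1) e j + k].
Proof.
move=> M0 AM AS Af fe; elim=> [|N ih] k /andP[k0 k1].
  exists (f 0%N); split; first by have [] := Af 0%N.
    by move=> j x; rewrite leqn0 => /eqP-> ?; lra.
  by rewrite big_ord1; have := fe 0%N; lra.
(* The loss [k] is halved: [k' <= k / 2] pays for the induction hypothesis, and [s * M <= k / 2]
   pays for replacing the factor [1 - k'] to the power [p] by 1 in front of the capacity of
   [A N]. *)
pose s := k / (2 * (M + 1)).
have M1 : 0 < 2 * (M + 1) by lra.
have s01 : 0 < s < 1.
  by rewrite /s divr_gt0//= ltr_pdivrMr// mul1r; lra.
have sM : s * M <= k / 2.
  rewrite /s mulrAC ler_pdivrMr//.
  have -> : k / 2 * (2 * (M + 1)) = k * M + k by field.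
  by lra.
have [k1' /andP[k10 k11] Hk] := powR_near1 s01.
pose k' := Num.min k1' (k / 2).
have k'0 : 0 < k' by rewrite lt_min k10/=; lra.
have k'k1 : k' <= k1' by rewrite ge_min lexx.
have k'k2 : k' <= k / 2 by rewrite ge_min lexx orbT.
have k'1 : k' < 1 by lra.
have [|g [tg gV gE]] := ih k'; first by rewrite k'0.
have [tf fA] := Af N.+1.
exists (smooth_max k' g (f N.+1)); split; first exact: test_smooth_max.
  move=> j x jN fj1; have h := @smooth_max_ge R n k' g (f N.+1) k'0 x; apply: lt_le_trans h.
  rewrite ltrBrDr lt_max; move: jN; rewrite leq_eqVlt => /orP[/eqP jN|jN].
    by apply/orP; right; rewrite -jN; lra.
  by apply/orP; left; have := gV j x jN fj1; lra.
have minE : (1 - k') `^ p * dirichlet_capacity (A N) <=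
    dirichlet_energy p (smooth_min k' g (f N.+1)).
  apply: dirichlet_capacity_scale; [by lra|exact: test_smooth_min|].
  move=> x ANx; have h := @smooth_min_ge R n k' g (f N.+1) k'0 x; apply: lt_le_trans h.
  rewrite lt_min; apply/andP; split.
    by apply: (gV N) => //; have [_] := Af N; exact.
  by have := fA x (AS _ _ ANx); lra.
have sub := dirichlet_energy_submodular p_ge1 k'0 tg tf.
have c0 : 0 <= dirichlet_capacity (A N).
  apply: lb_le_inf; first by exists (dirichlet_energy p (f N)); exists (f N).
  by move=> _ [psi _ <-]; exact: dirichlet_energy_ge0.
have pw : 1 - s <= (1 - k') `^ p by apply: Hk; rewrite k'0.
have sc : s * dirichlet_capacity (A N) <= k / 2.
  by apply: le_trans sM; have /andP[/ltW ? _] := s01; exact: ler_wpM2l.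
have fN := fe N.+1.
have pc := ler_wpM2r c0 pw.
rewrite big_ord_recr/=.
move: (\sum_(i < N.+1) e i) gE => Se gE.
move: (dirichlet_energy p _) sub minE => eM; move: (dirichlet_energy p _) => em sub minE.
move: (dirichlet_energy p g) (dirichlet_energy p (f N.+1)) gE fN sub => eg ef gE fN sub.
move: (dirichlet_capacity (A N)) (dirichlet_capacity (A N.+1)) gE fN minE sc pc => cN cN1 gE fN minE sc pc.
move: ((1 - k') `^ p * cN) minE pc => q minE pc.
have pc' : cN - s * cN <= q by rewrite -{1}[cN]mul1r -mulrBl.
move: (s * cN) pc' sc => sN pc' sc.
lra.
Qed.

(** The open sets [1 < f j x] cover [K], so finitely many of them suffice and no limit of functions
    has to be taken: the function built for a finite union already is a test function. *)
Lemma increasing_union_dominating (K : set E) (A : nat -> set E) (M eps : R) :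
  compact K -> 0 <= M -> 0 < eps -> (forall j, A j `<=` A j.+1) ->
  K `<=` \bigcup_j A j ->
  (forall j, exists2 psi, dominating (A j) psi & dirichlet_energy p psi <= M) ->
  exists2 w, test_function w &
    (forall x, K x -> 2^-1 < w x) /\ dirichlet_energy p w <= M + eps.
Proof.
move=> cK M0 eps0 AS KA AM.
have AMc j : dirichlet_capacity (A j) <= M.
  by have [psi Apsi psiM] := AM j; apply: le_trans psiM; exact: dirichlet_capacity_le.
(* These errors add up to less than [eps / 2]; the other half is left for [k], whose bound by [2^-1]
   yields the level [2^-1] on [K]. *)
pose e (j : nat) := eps / 2 ^+ j.+2.
have e0 j : 0 < e j by rewrite divr_gt0// exprn_gt0.
have /choice[f Hf] : forall j, exists psi, dominating (A j) psi /\
    dirichlet_energy p psi <= dirichlet_capacity (A j) + e j.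
  move=> j; have [|psi ? ?] := @dirichlet_capacity_adherent (A j) (e j) _ (e0 j).
    by have [psi ? _] := AM j; exists psi.
  by exists psi.
pose V j := [set x | 1 < f j x].
have oV j : open (V j).
  rewrite (_ : V j = f j @^-1` [set t | 1 < t]) //.
  apply: open_comp; last exact: open_gt.
  by move=> x _; have [[tf _] _] := Hf j; exact: test_continuous.
have KV : K `<=` \bigcup_j V j.
  by move=> x /KA[j _ Ajx]; exists j => //; have [[_ h] _] := Hf j; exact: h.
move: cK; rewrite compact_cover => /(_ nat setT V (fun j _ => oV j) KV) [D _ KD].
pose N := \max_(j <- finmap.enum_fset D) j.
pose k := Num.min 2^-1 (eps / 2).
have k0 : 0 < k < 1.
  by rewrite lt_min gt_min invr_gt0 ltr0n divr_gt0//= invf_lt1 ?ltr1n.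
have [g [tg gV gE]] := finite_union_dominating M0 AMc AS (fun j => (Hf j).1) (fun j => (Hf j).2) N k0.
have k2 : k <= 2^-1 by rewrite ge_min lexx.
have ke : k <= eps / 2 by rewrite ge_min lexx orbT.
exists g => //; split.
  move=> x /KD[j /= jD Vjx]; have jN : (j <= N)%N by exact: leq_bigmax_seq.
  by have := gV j x jN Vjx; lra.
have sume m : \sum_(j < m) e j = eps / 2 - eps / 2 ^+ m.+1.
  elim: m => [|m ihm]; first by rewrite big_ord0 expr1 subrr.
  rewrite big_ord_recr/= ihm /e [2 ^+ m.+2]exprS.
  have : 2 ^+ m.+1 != 0 :> R by rewrite expf_neq0// pnatr_eq0.
  move: (2 ^+ m.+1) => q q0; field; exact: q0.
have : 0 < eps / 2 ^+ N.+2 by rewrite divr_gt0// exprn_gt0.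
have := AMc N; move: gE; rewrite sume; move: (eps / _ ^+ _) => q.
move: (dirichlet_energy p g) (dirichlet_capacity (A N)) => a b.
lra.
Qed.

End capacity_of_unions.

Lemma Rintegral_sum_powR_le d (T : measurableType d) (R : realType)
    (mu : {measure set T -> \bar R}) (p a b : R) (N : nat) (u v : 'I_N -> T -> R) :
  1 <= p ->
  (forall i, mu.-integrable setT (fun x => (`|u i x + v i x| `^ p)%:E)) ->
  (forall i, mu.-integrable setT (fun x => (`|u i x| `^ p)%:E)) ->
  (forall i, mu.-integrable setT (fun x => (`|v i x| `^ p)%:E)) ->
  (forall i, \int[mu]_x (`|u i x| `^ p) <= a) ->
  (forall i, \int[mu]_x (`|v i x| `^ p) <= b) ->
  \int[mu]_x (\sum_i `|u i x + v i x| `^ p) <= N%:R * (2 `^ p * (a + b)).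
Proof.
move=> p1 Iuv Iu Iv ua vb.
have sumI s : mu.-integrable setT (EFin \o (fun x => \sum_(i <- s) `|u i x + v i x| `^ p)).
  rewrite (_ : _ \o _ = fun x => (\sum_(i <- s) (`|u i x + v i x| `^ p)%:E)%E).
    by apply: integrable_sum.
  by apply/funext => x; rewrite /= -sumEFin.
have Ig i : mu.-integrable setT (EFin \o (fun x => `|u i x| `^ p + `|v i x| `^ p)).
  exact: (integrableD measurableT (Iu i) (Iv i)).
have one i : \int[mu]_x (`|u i x + v i x| `^ p) <= 2 `^ p * (a + b).
  apply: (@le_trans _ _ (\int[mu]_x (2 `^ p * (`|u i x| `^ p + `|v i x| `^ p)))).
    apply: (le_Rintegral measurableT (Iuv i) (integrableZl measurableT _ (Ig i))) => x _.
    exact: normr_powRD.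
  rewrite (RintegralZl _ measurableT (Ig i)).
  rewrite (RintegralD measurableT (Iu i) (Iv i)).
  by apply: ler_wpM2l; [exact: powR_ge0|exact: lerD].
have bound s : \int[mu]_x (\sum_(i <- s) `|u i x + v i x| `^ p) <= (size s)%:R * (2 `^ p * (a + b)).
  elim: s => [|i s ih].
    under eq_Rintegral do rewrite big_nil.
    by rewrite Rintegral_cst// !mul0r.
  under eq_Rintegral do rewrite big_cons.
  rewrite (RintegralD measurableT (Iuv i) (sumI s)) /= -addn1 natrD addrC mulrDl mul1r.
  exact: lerD.
apply: (le_trans (bound _)); rewrite le_eqVlt; apply/orP; left; apply/eqP; congr (_%:R * _).
by rewrite /index_enum -enumT size_enum_ord.
Qed.

(** * Correcting an approximation where it is too small *)

Section capacity_defects.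
Context (R : realType) (n : nat).
Local Notation E := 'cV[R]_n.
Local Notation T := (caratheodory_type (lebesgue_outer R n)).
Local Notation mu := (leb R n).
Variable p : R.
Hypothesis p_ge1 : 1 <= p.

Let p_gt0 : 0 < p. Proof. exact: lt_le_trans p_ge1. Qed.

Lemma dirichlet_energyB_le (G : E -> E) (f g : E -> R) (a b : R) :
  test_function f -> test_function g -> (forall i, in_Lp p (fun x => G x i 0)) ->
  (forall i, \int[mu]_y `|G y i 0 - partial i f y| `^ p <= a) ->
  (forall i, \int[mu]_y `|G y i 0 - partial i g y| `^ p <= b) ->
  dirichlet_energy p (fun x => f x - g x) <= n%:R * (2 `^ p * (a + b)).
Proof.
move=> tf tg LG fa gb; have tfg := test_sub tf tg.
pose u i (x : T) := partial i f x - G x i 0.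
pose v i (x : T) := G x i 0 - partial i g x.
have Lu i : in_Lp p (u i).
  rewrite (_ : u i = fun x => -1 * G x i 0 + partial i f x).
    apply: in_Lp_linear => //; apply: test_in_Lp => //; exact: test_partial.
  by apply/funext => x; rewrite /u mulN1r addrC.
have Lv i : in_Lp p (v i).
  rewrite (_ : v i = fun x => -1 * partial i g x + G x i 0).
    apply: in_Lp_linear => //; apply: test_in_Lp => //; exact: test_partial.
  by apply/funext => x; rewrite /v mulN1r addrC.
have Iu i := ((in_LpP (u i) p_ge1).1 (Lu i)).2.
have Iv i := ((in_LpP (v i) p_ge1).1 (Lv i)).2.
have uvE i (x : T) : u i x + v i x = partial i (fun x => f x - g x) x.
  rewrite /u /v /partial deriveB; try exact: test_derivable.
  by rewrite addrA subrK.
have Iuv i : mu.-integrable setT (fun x : T => (`|u i x + v i x| `^ p)%:E).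
  have := test_powR_integrable p_ge1 (test_partial i tfg).
  by congr (is_true (integrable _ _ _)); apply/funext => x; rewrite uvE.
have ua i : \int[mu]_x (`|u i x| `^ p) <= a.
  rewrite (_ : (fun x => _) = fun y : T => `|G y i 0 - partial i f y| `^ p); first exact: fa.
  by apply/funext => x; rewrite /u distrC.
have EE : dirichlet p (fun x => f x - g x) = (fun x : T => \sum_i `|u i x + v i x| `^ p).
  by apply/funext => x; rewrite /dirichlet; apply: eq_bigr => i _; rewrite uvE.
rewrite /dirichlet_energy EE; exact: (Rintegral_sum_powR_le p_ge1 Iuv Iu Iv ua gb).
Qed.

(** On each set [A j], a radius [r] is fixed at which the average of [f - phi] exceeds [d]; [f] is
    replaced by a test function [psi] and the average by a combination [chi] of translates of
    [psi - phi]. Radius and [psi] depend on [j], but the energy of [chi] is controlled by [eta]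
    alone. *)
Lemma capacity_defect (f phi : E -> R) (K : set E) (d eta eps : R) :
  W01p p f -> test_function phi -> compact K -> 0 < d -> 0 < eta -> 0 < eps ->
  (forall x, K x -> 1 <= precise f x) -> (forall x, K x -> phi x <= 1 - 3 * d) ->
  (forall i, \int[mu]_y `|weak_gradient p f y i 0 - partial i phi y| `^ p <= eta) ->
  exists2 w, test_function w & (forall x, K x -> 2^-1 < w x) /\
    dirichlet_energy p w <= (2 / d) `^ p * (n%:R * (2 `^ p * (eta + eta))) + eps.
Proof.
move=> Wf tphi cK d0 eta0 eps0 Kf Kphi gradphi.
(* The averages of [f] and [phi] differ by more than [(1 - d) - (1 - 2 * d) = d], and the two
   approximations cost [2 * (d / 8)] and [d / 8]: [chi] exceeds [5 * d / 8], more than the [d / 2]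
   needed. *)
have arith (bp bf bs ch ph Lr : R) : `|bp - ph| <= Lr -> 1 - d < bf -> Lr <= d ->
    ph <= 1 - 3 * d -> `|ch - (bs - bp)| <= d / 8 -> `|bf - bs| <= 2 * (d / 8) -> d < 2 * ch.
  by rewrite !ler_norml => /andP[_ h1] h2 h3 h4 /andP[h5 _] /andP[_ h6]; lra.
have Lf : in_Lp p f by case: Wf => -[].
have LG i : in_Lp p (fun x => weak_gradient p f x i 0).
  by have [W1f _] := Wf; have [] := weak_gradientP W1f i.
pose A (j : nat) : set E :=
  [set x | K x /\ forall r, 0 < r < j.+1%:R^-1 -> 1 - d < ball_average f x r].
apply: (@increasing_union_dominating R n p p_ge1 K A) => //.
- by rewrite mulr_ge0 ?powR_ge0// !mulr_ge0 ?powR_ge0 ?addr_ge0// ltW.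
- move=> j x [Kx Ax]; split => // r /andP[r0 rj]; apply: Ax; rewrite r0/=.
  by apply: lt_le_trans rj _; rewrite lef_pV2 ?posrE ?ltr0n// ler_nat.
(* The default value 0 of [precise] is below 1, so the averages do converge at every point of
   [K]. *)
- move=> x Kx; have := Kf x Kx; rewrite /precise; case: (pselect _) => [cv|ncv]; last by rewrite ler10.
  move=> lim1.
  have lt1 : 1 - d < lim (ball_average f x @ 0^'+) by apply: lt_le_trans lim1; lra.
  have [e /= e0 He] := cvgr_gt _ cv _ lt1.
  have [j _ Hj] := near_infty_natSinv_lt (PosNum e0).
  exists j => //; split => // r /andP[r0 rj]; apply: He => //=.
  by rewrite sub0r normrN gtr0_norm// (lt_trans rj)// (Hj j) /=.
move=> j.
have [L L0 HL] := ball_average_test tphi.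
have L1 : 0 < L + 1 by lra.
(* The first term makes the condition defining [A j] apply at radius [r]; the second keeps the
   averages of [phi] within [d] of [phi]. *)
pose r := Num.min (j.+1%:R^-1 / 2) (d / (L + 1)).
have j0 : (0 : R) < j.+1%:R^-1 by rewrite invr_gt0 ltr0n.
have r0 : 0 < r by rewrite lt_min !divr_gt0.
have rj : r < j.+1%:R^-1.
  by apply: le_lt_trans (_ : j.+1%:R^-1 / 2 < _); [rewrite ge_min lexx|rewrite ltr_pdivrMr// ltr_pMr// ltr1n].
have Lr : L * r <= d.
  apply: (@le_trans _ _ ((L + 1) * (d / (L + 1)))).
    by apply: ler_pM => //; [exact: ltW|lra|rewrite ge_min lexx orbT].
  by rewrite mulrC divfK ?gt_eqF.
pose k := d / 8; have k0 : 0 < k by rewrite divr_gt0.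
pose c := k * k^-1 `^ p.
have c0 : 0 < c by rewrite mulr_gt0// powR_gt0// invr_gt0.
have B0 := leb_eball_gt0 (0 : E) r0.
(* The second term, which depends on [r], makes the averages of [f - psi] at most [2 * k]; the first
   keeps the gradient error of [psi] below [eta] whatever [j] is. *)
pose eta' := Num.min eta (k * fine (mu (eball (0 : E) r)) / c).
have eta'0 : 0 < eta' by rewrite lt_min eta0 divr_gt0// mulr_gt0.
have [psi [tpsi fpsi gpsi]] := W01p_approx p_ge1 Wf eta'0.
have tchi := test_sub tpsi tphi.
have [chi [tc chiE Hchi]] := average_comb p_ge1 tchi r0 k0.
have gpsi' i : \int[mu]_y `|weak_gradient p f y i 0 - partial i psi y| `^ p <= eta.
  by apply: (le_trans (gpsi i)); rewrite ge_min lexx.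
have dE : dirichlet_energy p (fun x => psi x - phi x) <= n%:R * (2 `^ p * (eta + eta)).
  exact: (dirichlet_energyB_le tpsi tphi LG gpsi' gradphi).
exists (fun x => 2 / d * chi x); last first.
  rewrite dirichlet_energyZ// ger0_norm ?divr_ge0 ?(ltW d0)//.
  by apply: ler_wpM2l; [exact: powR_ge0|exact: le_trans chiE dE].
split; first exact: test_scale.
move=> x [Kx Ax].
have Lpsi : in_Lp p psi by exact: test_in_Lp.
have Lphi : in_Lp p phi by exact: test_in_Lp.
have Lfpsi : in_Lp p (fun y => f y - psi y).
  rewrite (_ : (fun y => _) = fun y => -1 * psi y + f y); first exact: in_Lp_linear.
  by apply/funext => y; rewrite mulN1r addrC.
have h1 := ball_average_Lp p_ge1 x Lfpsi k0 r0.
have h1' : `|ball_average (fun y => f y - psi y) x r| <= 2 * k.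
  apply: (le_trans h1); rewrite mulr_natl mulr2n lerD2l ler_pdivrMr//.
  rewrite -/c mulrC -ler_pdivlMr// (le_trans fpsi)//.
  by rewrite ge_min lexx orbT.
move: h1'; rewrite (ball_averageB p_ge1 x r Lf Lpsi).
have h2 := HL x r r0; have h3 := Ax r; rewrite r0 rj in h3; have {}h3 := h3 isT.
have := Hchi x; rewrite (ball_averageB p_ge1 x r Lpsi Lphi).
have := Kphi x Kx; move: h2 h3 Lr.
move: (ball_average phi x r) (ball_average f x r) (ball_average psi x r) => bp bf bs.
by rewrite mulrAC ltr_pdivlMr// mul1r; exact: arith.
Qed.

End capacity_defects.

Import HBNNSimple.

(** * Comparison of the energies *)

Section inverse_power_integrals.
Context (R : realType).

Lemma ereal_shrink (t : R) (x : \bar R) : 0 <= t -> (t%:E < x)%E ->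
  exists2 th : R, 0 < th < 1 & (t%:E < th%:E * x)%E.
Proof.
move=> t0; case: x => [x| |] //; last first.
  move=> _; exists 2^-1; first by rewrite invr_gt0 ltr0n invf_lt1 ?ltr1n.
  by rewrite gt0_muley ?ltry// lte_fin invr_gt0.
rewrite lte_fin => tx; have x0 : 0 < x by exact: le_lt_trans tx.
exists ((1 + t / x) / 2).
  have h1 : 0 <= t / x by rewrite divr_ge0// ltW.
  have h2 : t / x < 1 by rewrite ltr_pdivrMr// mul1r.
  by apply/andP; split; lra.
rewrite -EFinM lte_fin mulrAC ltr_pdivlMr// mulrDl mul1r divfK ?gt_eqF//; lra.
Qed.

Lemma powR_invK (a r : R) : 0 <= a -> r != 0 -> (a `^ r^-1) `^ r = a.
Proof. by move=> a0 r0; rewrite -powRrM mulVf// powRr1. Qed.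

(* Below the inverse of a simple function, [N] may be replaced by a function
   bounded away from [0], for which additive errors are relative errors. No
   measurability of [N] is needed. *)
Lemma integral_inv_pow_usc d (T : measurableType d) (mu : {measure set T -> \bar R})
    (D : set T) (N : T -> \bar R) (k t : R) : 0 < k -> 0 <= t ->
  (forall u, (0 <= N u)%E) -> (t%:E < \int[mu]_(u in D) (N u `^ k)^-1)%E ->
  exists2 e, 0 < e & forall N' : T -> \bar R,
    (forall u, (0 <= N' u)%E) ->
    (forall u, D u -> (N' u <= (1 + e)%:E * (N u + e%:E))%E) ->
    (t%:E < \int[mu]_(u in D) (N' u `^ k)^-1)%E.
Proof.
move=> k0 t0 N0; have kN0 : k != 0 by rewrite gt_eqF.
have F0 (M : T -> \bar R) : (forall u, (0 <= M u)%E) -> forall u, D u -> (0 <= (M u `^ k)^-1)%E.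
  by move=> M0 u _; rewrite inve_ge0 poweR_ge0.
rewrite (ge0_integralE mu (F0 _ N0)) => /ereal_sup_gt[_ [s /= sN <-] ts].
have [th /andP[th0 th1] tth] := ereal_shrink t0 ts.
have [B B0 sB] : exists2 B, 0 < B & forall u, s u <= B.
  have [M [_ sM]] := simple_bounded s.
  exists (`|M| + 1) => [|u]; first by rewrite ltr_pwDr.
  have := sM (`|M| + 1); rewrite ltr_pwDr ?ler_norm// => /(_ isT u I).
  by apply: le_trans; exact: ler_norm.
have s0 u : 0 <= s u by exact: fun_ge0.
(* Where [s] is positive, [N] is at most [nu], the inverse of [s] to the power [k^-1], and [nu >= c]
   since [s <= B]. Shrinking [s] by [th] tolerates that [N'] exceeds [nu] by the factor [q > 1]. *)
pose q := th^-1 `^ k^-1; pose c := B^-1 `^ k^-1.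
have c0 : 0 < c by rewrite powR_gt0// invr_gt0.
have qk : q `^ k = th^-1 by rewrite powR_invK// invr_ge0 ltW.
have q1 : 1 < q.
  rewrite ltNge; apply/negP => q1.
  have : q `^ k <= 1.
    have := @ge0_ler_powR R k (ltW k0) q 1.
    by rewrite !nnegrE powR1 ler01 powR_ge0 => ->.
  by rewrite qk invf_le1// leNgt th1.
(* For [e <= 1] and [nu >= c], expanding [(1 + e) * (nu + e)] gives an excess over [nu] of at most
   [e * b * nu], which must not exceed [(q - 1) * nu]. *)
pose b := 1 + 2 / c.
have b0 : 0 < b by rewrite addr_gt0// divr_gt0.
pose e := Num.min 1 ((q - 1) / b).
have e0 : 0 < e by rewrite lt_min ltr01 divr_gt0// subr_gt0.
have e1 : e <= 1 by rewrite ge_min lexx.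
have eb : e * b <= q - 1 by rewrite -ler_pdivlMr// ge_min lexx orbT.
have key nu : c <= nu -> (1 + e) * (nu + e) <= q * nu.
  move=> cnu; have nu0 : 0 < nu by exact: lt_le_trans cnu.
  have h1 : e <= e / c * nu.
    by rewrite mulrAC ler_pdivlMr// ler_pM2l.
  have h2 : e * e <= e / c * nu.
    by apply: le_trans h1; rewrite ger_pMl.
  have h3 : e * b * nu <= (q - 1) * nu by rewrite ler_pM2r.
  have h4 : e * b * nu = e * nu + 2 * (e / c * nu).
    by rewrite /b; field; rewrite gt_eqF.
  move: h1 h2 h3; rewrite h4; move: (e / c * nu) => y; rewrite mulrBl mul1r !mulrDl !mulrDr !mul1r.
  move: (e * nu) (q * nu) (e * e) => *; lra.
exists e => // N' N'0 NN'.
apply: lt_le_trans tth _.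
rewrite (ge0_integralE mu (F0 _ N'0)) -sintegralrM.
apply: ereal_sup_ubound; exists (scale_nnsfun s (ltW th0)) => //= u.
have := sN u; rewrite !patchE; case: ifPn => [/set_mem Du|_]; last first.
  rewrite !lee_fin => su; have -> : s u = 0 by apply/eqP; rewrite eq_le su s0.
  by rewrite mulr0.
have [->|su0] := eqVneq (s u) 0; first by rewrite mulr0 => _; exact: F0.
have {}su0 : 0 < s u by rewrite lt_neqAle eq_sym su0 s0.
have pw0 (M : T -> \bar R) : (M u `^ k)%E \in [pred x | (0 <= x)%E].
  by rewrite inE poweR_ge0.
have Vsu (r : R) : 0 < r -> (r%:E^-1)%E = (r^-1)%:E by move=> r0; rewrite inver gt_eqF.
rewrite inve_pge ?pw0//; last by rewrite inE lee_fin.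
rewrite Vsu// => Nsu.
pose nu := (s u)^-1 `^ k^-1.
have nu0 : 0 < nu by rewrite powR_gt0// invr_gt0.
have cnu : c <= nu.
  by rewrite ge0_ler_powR ?nnegrE ?invr_ge0 ?(ltW k0) ?(ltW B0)// lef_pV2 ?posrE.
have Nnu : (N u <= nu%:E)%E.
  have -> : N u = ((N u `^ k) `^ k^-1)%E by rewrite -poweRrM mulfV// poweRe1.
  rewrite -poweR_EFin; apply: gt0_ler_poweR => //.
  - by rewrite invr_ge0 ltW.
  - by rewrite in_itv/= poweR_ge0 leey.
  - by rewrite in_itv/= lee_fin leey invr_ge0 ltW.
have N'nu : (N' u <= (q * nu)%:E)%E.
  apply: (le_trans (NN' u Du)).
  apply: (@le_trans _ _ ((1 + e)%:E * (nu%:E + e%:E))%E).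
    by apply: lee_wpmul2l; [rewrite lee_fin; lra|exact: leeD2r].
  by rewrite -EFinD -EFinM lee_fin key.
rewrite inve_pge ?pw0//; last by rewrite inE lee_fin mulr_ge0// ltW.
rewrite Vsu ?mulr_gt0//.
have -> : (th * s u)^-1 = (q * nu) `^ k.
  by rewrite invfM powRM ?powR_ge0// qk powR_invK// invr_ge0 ltW.
rewrite -poweR_EFin; apply: gt0_ler_poweR => //.
- exact: ltW.
- by rewrite in_itv/= N'0 leey.
- by rewrite in_itv/= lee_fin leey mulr_ge0 ?powR_ge0.
Qed.

(** The energy is a decreasing function of the spherical integral, so an upper bound [i] for it is a
    lower bound for the integral, with threshold the inverse of [i] to the power [r^-1]. The
    threshold is finite even if [I] or [i] is infinite. *)
Lemma inv_poweR_lt (I : \bar R) (r : R) (i : \bar R) : 0 < r -> (0 <= I)%E ->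
  ((I `^ r)^-1 < i)%E ->
  exists2 t : R, 0 <= t & (t%:E < I)%E /\
    forall J, (t%:E < J)%E -> ((J `^ r)^-1 < i)%E.
Proof.
move=> r0 I0 Ii; have rN0 : r != 0 by rewrite gt_eqF.
have i0 : (0 < i)%E.
  by apply: le_lt_trans Ii; rewrite inve_ge0 poweR_ge0.
have pw0 (x : \bar R) : (x `^ r)%E \in [pred x | (0 <= x)%E] by rewrite inE poweR_ge0.
have i0' : i \in [pred x | (0 <= x)%E] by rewrite inE ltW.
have V0 : (0 <= i^-1)%E by rewrite inve_ge0 ltW.
have fV : (i^-1)%E \is a fin_num.
  by apply: fin_numV; rewrite gt_eqF// (lt_trans _ i0)// ltNyr.
pose t := fine i^-1 `^ r^-1.
have tr : (t%:E `^ r)%E = (i^-1)%E.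
  by rewrite poweR_EFin powR_invK ?fineK// fine_ge0.
have t0 : 0 <= t by exact: powR_ge0.
have H J' : (0 <= J')%E -> (t%:E < J')%E = (((J' `^ r)^-1) < i)%E.
  move=> J0; rewrite inve_plt// -tr; apply/idP/idP.
    move=> tJ; rewrite ltNge; apply/negP => h.
    suff : (J' <= t%:E)%E by rewrite leNgt tJ.
    have := @gt0_ler_poweR R r^-1 _ (J' `^ r)%E (t%:E `^ r)%E.
    rewrite -!poweRrM mulfV// !poweRe1 ?lee_fin//; apply => //.
    - by rewrite invr_ge0 ltW.
    - by rewrite in_itv/= poweR_ge0 leey.
    - by rewrite in_itv/= lee_fin powR_ge0 leey.
  move=> h; rewrite ltNge; apply/negP => Jt.
  suff : (J' `^ r <= t%:E `^ r)%E by rewrite leNgt h.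
  apply: gt0_ler_poweR => //.
  - exact: ltW.
  - by rewrite in_itv/= J0 leey.
  - by rewrite in_itv/= lee_fin t0 leey.
exists t => //; split; first by rewrite H.
move=> J' tJ; rewrite -H//; apply: ltW; apply: le_lt_trans tJ.
by rewrite lee_fin.
Qed.

End inverse_power_integrals.

(** * Sublinearity and measurability of support functions *)

Section support_functions.
Context (R : realType) (n m : nat) (Q : set 'rV[R]_m).
Hypothesis Q_body : convex_body_with_origin Q.

Local Notation h := (support_function Q).
Local Notation dotmx := Defs.dotmx.

Lemma dotmx_rowE (x y : 'rV[R]_m) : dotmx x y = \sum_j x 0 j * y 0 j.
Proof.
rewrite /dotmx /mxtrace; apply: eq_bigr => j _.
by rewrite mxE big_ord1 mxE.
Qed.

Lemma body_bounded : exists2 B, 0 <= B & forall y, Q y -> forall j, `|y 0 j| <= B.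
Proof.
have [/compact_bounded[N [_ QN]] _ _ _] := Q_body.
exists (`|N| + 1); first exact: addr_ge0.
move=> y Qy j; have := QN (`|N| + 1) _ y Qy; rewrite ltr_pwDr ?ler_norm// => /(_ isT).
by apply: le_trans; rewrite [leRHS]/Num.Def.normr/= mx_normrE; exact: (le_bigmax _ _ (0, j)).
Qed.

Lemma dotmx_le (B : R) (x y : 'rV[R]_m) : (forall j, `|y 0 j| <= B) ->
  dotmx x y <= B * \sum_j `|x 0 j|.
Proof.
move=> yB; rewrite dotmx_rowE mulr_sumr; apply: ler_sum => j _.
apply: (le_trans (ler_norm _)); rewrite normrM mulrC; exact: ler_wpM2r.
Qed.

Lemma support_function_ub (x y : 'rV[R]_m) : Q y -> dotmx x y <= h x.
Proof.
move=> Qy; have [B B0 QB] := body_bounded.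
apply: ub_le_sup; last by exists y.
by exists (B * \sum_j `|x 0 j|) => _ [z /QB zB <-]; exact: dotmx_le.
Qed.

Lemma support_function_le (x : 'rV[R]_m) (c : R) :
  (forall y, Q y -> dotmx x y <= c) -> h x <= c.
Proof.
move=> xc; apply: ge_sup; last by move=> _ [y Qy <-]; exact: xc.
by have [_ _ _ Q0] := Q_body; exists (dotmx x 0); exists 0.
Qed.

Lemma support_function_ge0 (x : 'rV[R]_m) : 0 <= h x.
Proof.
have [_ _ _ Q0] := Q_body; have := support_function_ub x Q0.
by rewrite dotmx_rowE big1// => j _; rewrite mxE mulr0.
Qed.

Lemma support_functionD (x y : 'rV[R]_m) : h (x + y) <= h x + h y.
Proof.
apply: support_function_le => z Qz.
have -> : dotmx (x + y) z = dotmx x z + dotmx y z.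
  by rewrite !dotmx_rowE -big_split/=; apply: eq_bigr => j _; rewrite mxE mulrDl.
by apply: lerD; exact: support_function_ub.
Qed.

Lemma support_functionZ (t : R) (x : 'rV[R]_m) : 0 <= t -> h (t *: x) <= t * h x.
Proof.
move=> t0; apply: support_function_le => z Qz.
have -> : dotmx (t *: x) z = t * dotmx x z.
  by rewrite !dotmx_rowE mulr_sumr; apply: eq_bigr => j _; rewrite mxE mulrA.
by apply: ler_wpM2l => //; exact: support_function_ub.
Qed.

(** The entries of a unit matrix [u] are at most 1 in absolute value, so [C] does not depend on [u].
    This uniformity lets one competitor serve all directions at once. *)
Lemma support_function_bound : exists2 C, 0 <= C &
  forall (u : 'M[R]_(n, m)), euclid u = 1 -> forall z : 'cV[R]_n,
    h (z^T *m u) <= C * \sum_i `|z i 0|.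
Proof.
have [B B0 QB] := body_bounded; exists (B * m%:R); first by rewrite mulr_ge0.
move=> u u1 z; apply: support_function_le => y Qy.
apply: (le_trans (dotmx_le _ (QB y Qy))); rewrite -mulrA; apply: ler_wpM2l => //.
apply: (@le_trans _ _ (\sum_(j < m) \sum_i `|z i 0|)); last first.
  by rewrite sumr_const card_ord mulr_natl.
apply: ler_sum => j _; rewrite mxE; apply: (le_trans (ler_norm_sum _ _ _)).
apply: ler_sum => i _; rewrite mxE normrM ler_piMr//.
by rewrite -u1; exact: ler_entry_euclid.
Qed.

(** A supremum of continuous functions is lower semicontinuous. Columns replace rows because boxes
    are sets of columns. *)
Lemma open_support_function_gt (a : R) : open [set y : 'cV[R]_m | a < h y^T].
Proof.
rewrite (_ : [set _ | _] = \bigcup_(q in Q) [set y : 'cV[R]_m | a < dotmx y^T q]).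
  apply: bigcup_open => q Qq.
  have sl : smooth_closure (fun y : 'cV[R]_m => \sum_j y j 0 * q 0 j).
    elim: (index_enum 'I_m) => [|j s ih].
      rewrite (_ : (fun _ => _) = fun=> 0); first exact: closure_cst.
      by apply/funext => y; rewrite big_nil.
    rewrite (_ : (fun _ => _) = fun y : 'cV[R]_m => y j 0 * q 0 j + \sum_(j <- s) y j 0 * q 0 j).
      apply: closure_add => //; apply: closure_mul; [exact: closure_coord|exact: closure_cst].
    by apply/funext => y; rewrite big_cons.
  have [cl _ _] := smooth_closure_step sl.
  rewrite (_ : [set _ | _] = (fun y : 'cV[R]_m => \sum_j y j 0 * q 0 j) @^-1` [set t | a < t]).
    by apply: open_comp; [move=> y _; exact: cl|exact: open_gt].
  have yE (y : 'cV[R]_m) : dotmx y^T q = \sum_j y j 0 * q 0 j.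
    by rewrite dotmx_rowE; apply: eq_bigr => j _; rewrite mxE.
  by apply/seteqP; split => y; rewrite /= yE.
apply/seteqP; split => y /=; last first.
  by move=> [q Qq] /= /lt_le_trans; apply; exact: support_function_ub.
move=> ah; apply: contrapT => hn.
suff : h y^T <= a by rewrite leNgt ah.
apply: support_function_le => q Qq; rewrite leNgt; apply/negP => aq.
by apply: hn; exists q.
Qed.

(** An open set is a countable union of boxes with rational corners, and the preimage of a box by
    [G] only involves the coordinates of [G]. *)
Lemma measurable_support_function d (T : measurableType d) (G : T -> 'rV[R]_m) :
  (forall j, measurable_fun setT (fun x => G x 0 j)) ->
  measurable_fun setT (fun x => h (G x)).
Proof.
move=> mG; apply: (measurability _ (RGenOInfty.measurableE R)) => //.
move=> _ [_ [a ->] <-]; rewrite setTI.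
pose U := [set y : 'cV[R]_m | a < h y^T].
pose B (q : 'cV[rat]_m * 'cV[rat]_m) : set 'cV[R]_m :=
  box (map_mx ratr q.1, map_mx ratr q.2).
rewrite (_ : _ @^-1` _ = \bigcup_q (if `[< B q `<=` U >] then [set x | B q (G x)^T] else set0)).
  apply: countable_bigcupT_measurable => [|q]; first exact: countableP.
  case: ifP => _; last exact: measurable0.
  rewrite (_ : [set x | _] = \bigcap_(j in [set: 'I_m])
      ((fun x => G x 0 j) @^-1` `[ratr (q.1 j 0), ratr (q.2 j 0)]%classic)).
    apply: fin_bigcap_measurable => // j _.
    by rewrite -[X in measurable X]setTI; apply: mG => //; exact: measurable_itv.
  apply/seteqP; split => x /=.
    by move=> Bx j _; have := Bx j; rewrite /= !mxE in_itv.
  by move=> Bx j; have := Bx j Logic.I; rewrite /= !mxE in_itv.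
apply/seteqP; split=> [x|x [q _]]; last first.
  case: ifPn => // /asboolP BU /= /BU.
  by rewrite /U/= trmxK in_itv/= andbT.
rewrite /= in_itv/= andbT => ah.
have Ux : U (G x)^T by rewrite /U/= trmxK.
have [q [qx qU]] := open_rat_box (@open_support_function_gt a) Ux.
by exists q => //; rewrite asboolT.
Qed.

End support_functions.

Lemma Lnorm_le_ae d (T : measurableType d) (R : realType)
    (mu : {measure set T -> \bar R}) (p : R) (g h : T -> R) : 0 < p ->
  measurable_fun setT g -> measurable_fun setT h ->
  {ae mu, forall x, `|g x| <= `|h x|} ->
  ('N[mu]_p%:E[EFin \o g] <= 'N[mu]_p%:E[EFin \o h])%E.
Proof.
move=> p0 mg mh gh; rewrite unlock.
have mpow (k : T -> R) : measurable_fun setT k -> measurable_fun setT (fun x => (`|(k x)%:E| `^ p)%E).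
  move=> mk; rewrite (_ : (fun _ => _) = EFin \o (fun x => `|k x| `^ p)).
    apply/measurable_EFinP; apply: (measurableT_comp (measurable_powR p)); exact: measurableT_comp.
  by apply/funext => x.
apply: gt0_ler_poweR.
- by rewrite invr_ge0 ltW.
- by rewrite in_itv/= leey integral_ge0// => x _; exact: poweR_ge0.
- by rewrite in_itv/= leey integral_ge0// => x _; exact: poweR_ge0.
apply: (ae_ge0_le_integral measurableT) => //; try exact: mpow.
- by move=> x _; exact: poweR_ge0.
- by move=> x _; exact: poweR_ge0.
apply: filterS gh => x ghx _ /=; rewrite lee_fin.
by rewrite ge0_ler_powR ?nnegrE// ltW.
Qed.

Lemma Lnorm_scale_le d (T : measurableType d) (R : realType)
    (mu : {measure set T -> \bar R}) (p c : R) (h : T -> R) : 0 < p -> 0 <= c ->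
  measurable_fun setT h ->
  ('N[mu]_p%:E[EFin \o (fun x => (c * h x)%R)] = c%:E * 'N[mu]_p%:E[EFin \o h])%E.
Proof.
move=> p0 c0 mh; rewrite unlock.
have -> : (\int[mu]_x `|(EFin \o (fun x => (c * h x)%R)) x| `^ p =
    (c `^ p)%:E * \int[mu]_x `|(EFin \o h) x| `^ p)%E.
  have mp : measurable_fun setT (fun x => `|(EFin \o h) x| `^ p)%E.
    rewrite (_ : (fun _ => _) = EFin \o (fun x => `|h x| `^ p)).
      apply/measurable_EFinP; apply: (measurableT_comp (measurable_powR p)); exact: measurableT_comp.
    by apply/funext => x.
  have p0' x : setT x -> (0 <= `|(EFin \o h) x| `^ p)%E by move=> _; exact: poweR_ge0.
  have c0' : (0 <= (c `^ p)%:E)%E by rewrite lee_fin powR_ge0.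
  rewrite -(ge0_integralZl mu measurableT mp p0' c0').
  by apply: eq_integral => x _ /=; rewrite normrM powRM// (ger0_norm c0) EFinM.
rewrite poweRM ?lee_fin ?powR_ge0//; last by apply: integral_ge0 => x _; exact: poweR_ge0.
by rewrite poweR_EFin -powRrM mulfV ?gt_eqF// powRr1.
Qed.

Lemma Lnorm_le_powR d (T : measurableType d) (R : realType)
    (mu : {measure set T -> \bar R}) (p c : R) (h : T -> R) : 0 < p -> 0 <= c ->
  mu.-integrable setT (fun x => (`|h x| `^ p)%:E) ->
  \int[mu]_x (`|h x| `^ p) <= c `^ p -> ('N[mu]_p%:E[EFin \o h] <= c%:E)%E.
Proof.
move=> p0 c0 Ih hc; rewrite unlock.
have -> : (\int[mu]_x `|(EFin \o h) x| `^ p = (\int[mu]_x (`|h x| `^ p))%R%:E)%E.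
  by rewrite /Rintegral fineK//; exact: (integrable_fin_num measurableT Ih).
rewrite poweR_EFin lee_fin.
have -> : c = (c `^ p) `^ p^-1 by rewrite -powRrM mulfV ?gt_eqF// powRr1.
rewrite ge0_ler_powR ?nnegrE ?powR_ge0 ?invr_ge0 ?(ltW p0)//.
by apply: Rintegral_ge0 => x _; exact: powR_ge0.
Qed.

Lemma powR_sum_le (R : realType) (n : nat) (p : R) (a : 'I_n -> R) : 0 < p ->
  (forall i, 0 <= a i) -> (\sum_i a i) `^ p <= n%:R `^ p * \sum_i a i `^ p.
Proof.
move=> p0 a0; set S := \sum_i a i `^ p.
have S0 : 0 <= S by apply: sumr_ge0 => i _; exact: powR_ge0.
have aS i : a i <= S `^ p^-1.
  have -> : a i = (a i `^ p) `^ p^-1 by rewrite -powRrM mulfV ?gt_eqF// powRr1.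
  rewrite ge0_ler_powR ?nnegrE ?powR_ge0 ?invr_ge0 ?(ltW p0)//.
  by rewrite /S (bigD1 i)//= lerDl sumr_ge0// => j _; exact: powR_ge0.
apply: (@le_trans _ _ ((n%:R * S `^ p^-1) `^ p)).
  rewrite ge0_ler_powR ?nnegrE ?(ltW p0)//.
  - exact: sumr_ge0.
  - by rewrite mulr_ge0 ?powR_ge0.
  apply: (@le_trans _ _ (\sum_(i < n) S `^ p^-1)); first exact: ler_sum.
  by rewrite sumr_const card_ord mulr_natl.
by rewrite powRM ?powR_ge0// -powRrM mulVf ?gt_eqF// powRr1.
Qed.

Section test_functions_in_W01p.
Context (R : realType) (n : nat).
Local Notation E := 'cV[R]_n.
Local Notation T := (caratheodory_type (lebesgue_outer R n)).
Local Notation mu := (leb R n).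

Lemma precise_test (g : E -> R) : test_function g -> precise g = g.
Proof.
move=> tg; apply/funext => x; have [L L0 HL] := ball_average_test tg.
have cv : ball_average g x r @[r --> 0^'+] --> g x.
  apply/cvgrPdist_le => e e0; near=> r; rewrite distrC.
  have r0 : 0 < r by near: r; exact: nbhs_right_gt.
  apply: (le_trans (HL x r r0)).
  have re : r <= e / (L + 1) by near: r; apply: nbhs_right_le; rewrite divr_gt0// ltr_wpDl.
  have L1 : 0 < L + 1 by rewrite ltr_wpDl.
  apply: (@le_trans _ _ ((L + 1) * r)); first by rewrite ler_pM2r// lerDl.
  by rewrite mulrC -ler_pdivlMr.
rewrite /precise; case: (pselect _) => [cv'|ncv]; last by case: ncv; apply/cvg_ex; exists (g x).
exact/cvg_lim.
Unshelve. all: by end_near.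
Qed.

(** The function approximates itself; what remains is that the weak gradient chosen for the zero
    function vanishes almost everywhere. *)
Lemma test_W01p (p : R) (g : E -> R) : 1 <= p -> test_function g -> W01p p g.
Proof.
move=> p1 tg; have p0 : 0 < p by exact: lt_le_trans p1.
split; first exact: test_W1p.
move=> eps eps0; exists g => //.
have -> : (g \- g)%R = (fun=> 0 : R) by apply/funext => x /=; rewrite subrr.
have t0 : test_function (fun _ : E => 0 : R) by exact: test_0.
have W0 := test_W1p p1 t0.
have N0 : ('N[mu]_p%:E[EFin \o (fun _ : T => 0%R : R)] <= 0)%E.
  apply: (Lnorm_le_powR p0 (lexx 0)).
    by rewrite normr0 powR0 ?gt_eqF//; exact: integrable0.
  by rewrite normr0 powR0 ?gt_eqF// Rintegral_cst// mul0r.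
have mG i : measurable_fun setT ((fun x => weak_gradient p (fun=> 0) x i 0) : T -> R).
  by apply: (in_Lp_measurable p1); have [] := weak_gradientP W0 i.
have ae0 : {ae mu, forall x : T, `|euclid (weak_gradient p (fun=> 0) x)| <= `|(0 : R)|}.
  apply: (@filterS _ _ (ae_filter_ringOfSetsType mu) _ _ _ (weak_gradient_test p1 t0)) => x ->.
  rewrite (_ : grad (fun=> 0) x = 0); last by apply/matrixP => i j; rewrite !mxE /partial derive_cst.
  by rewrite euclidE big1 ?sqrtr0// => i _; rewrite big1// => j _; rewrite mxE expr0n.
have N1 := Lnorm_le_ae p0 (euclid_measurable mG) (measurable_cst (0 : R)) ae0.
apply: (@le_lt_trans _ _ (0 + 0)%E); last by rewrite adde0 lte_fin.
by apply: leeD; [exact: N0|exact: le_trans N1 N0].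
Qed.

End test_functions_in_W01p.

Section Lnorm_estimates.
Context d (T : measurableType d) (R : realType) (mu : {measure set T -> \bar R}) (p : R).
Hypothesis p_ge1 : 1 <= p.

Let p_gt0 : 0 < p. Proof. exact: lt_le_trans p_ge1. Qed.

Let measurable_pow (k : T -> R) : measurable_fun setT k ->
  measurable_fun setT (fun x => (`|k x| `^ p)%:E).
Proof.
move=> mk; apply/measurable_EFinP; apply: (measurableT_comp (measurable_powR p)).
exact: measurableT_comp.
Qed.

(** [S] is the error term of the pointwise gradient comparison: [a] will be the gradient error of
    [phi], and [b] the gradient of the correction. Being proportional to [eta + rho], the bound
    tolerates any constant. *)
Lemma Lnorm_sum_le (N : nat) (C c eta rho : R) (a b : 'I_N -> T -> R) : 0 <= C -> 0 <= c ->
  (forall i, measurable_fun setT (a i)) -> (forall i, measurable_fun setT (b i)) ->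
  (forall i, mu.-integrable setT (fun x => (`|a i x| `^ p)%:E)) ->
  (forall i, mu.-integrable setT (fun x => (`|b i x| `^ p)%:E)) ->
  (forall i, \int[mu]_x (`|a i x| `^ p) <= eta) ->
  (forall i, \int[mu]_x (`|b i x| `^ p) <= rho) ->
  C `^ p * (N%:R `^ p * (N%:R * (2 `^ p * (eta + rho)))) <= c `^ p ->
  let S x := C * \sum_i (`|a i x| + `|b i x|) in
  measurable_fun setT S /\ ('N[mu]_p%:E[EFin \o S] <= c%:E)%E.
Proof.
move=> C0 c0 ma mb Ia Ib aeta brho Cc S.
pose a' i x := `|a i x|; pose b' i x := `|b i x|.
have ma' i : measurable_fun setT (a' i) by exact: measurableT_comp.
have mb' i : measurable_fun setT (b' i) by exact: measurableT_comp.
have mab i : measurable_fun setT (fun x => a' i x + b' i x) := measurable_funD (ma' i) (mb' i).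
have mS : measurable_fun setT S.
  apply: measurable_funM; first exact: measurable_cst.
  exact: measurable_sum.
split=> //.
have Ia' i : mu.-integrable setT (fun x => (`|a' i x| `^ p)%:E).
  by rewrite /a'; under [X in integrable _ _ X]funext do rewrite normr_id; exact: Ia.
have Ib' i : mu.-integrable setT (fun x => (`|b' i x| `^ p)%:E).
  by rewrite /b'; under [X in integrable _ _ X]funext do rewrite normr_id; exact: Ib.
have Iab i : mu.-integrable setT (fun x => (`|a' i x + b' i x| `^ p)%:E).
  have Is := integrableZl measurableT (2 `^ p) (integrableD measurableT (Ia' i) (Ib' i)).
  apply: (le_integrable measurableT _ _ Is); first exact: measurable_pow.
  move=> x _; rewrite /= lee_fin ger0_norm ?powR_ge0//.
  by apply: le_trans (ler_norm _); exact: normr_powRD.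
have aeta' i : \int[mu]_x (`|a' i x| `^ p) <= eta.
  by under eq_Rintegral do rewrite normr_id; exact: aeta.
have brho' i : \int[mu]_x (`|b' i x| `^ p) <= rho.
  by under eq_Rintegral do rewrite normr_id; exact: brho.
have sumI : mu.-integrable setT (fun x => (\sum_i `|a' i x + b' i x| `^ p)%:E).
  rewrite (_ : (fun _ => _) = fun x => (\sum_i (`|a' i x + b' i x| `^ p)%:E)%E).
    by apply: integrable_sum.
  by apply/funext => x; rewrite -sumEFin.
have sumLe := Rintegral_sum_powR_le p_ge1 Iab Ia' Ib' aeta' brho'.
pose k := C `^ p * N%:R `^ p.
have k0 : 0 <= k by rewrite mulr_ge0 ?powR_ge0.
have Spt x : `|S x| `^ p <= k * \sum_i `|a' i x + b' i x| `^ p.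
  have ab0 i : 0 <= a' i x + b' i x by rewrite addr_ge0 ?normr_ge0.
  have sab0 : 0 <= \sum_i (a' i x + b' i x) by exact: sumr_ge0.
  rewrite /S ger0_norm ?(mulr_ge0 C0 sab0)// (powRM _ C0 sab0) /k -mulrA.
  apply: ler_wpM2l; first exact: powR_ge0.
  apply: (le_trans (powR_sum_le p_gt0 ab0)); apply: ler_wpM2l; first exact: powR_ge0.
  by apply: ler_sum => i _; rewrite (ger0_norm (ab0 i)).
have Ik := integrableZl measurableT k sumI.
have IS : mu.-integrable setT (fun x => (`|S x| `^ p)%:E).
  apply: (le_integrable measurableT _ _ Ik); first exact: measurable_pow.
  move=> x _; rewrite /= lee_fin ger0_norm ?powR_ge0//.
  by apply: le_trans (ler_norm _); exact: Spt.
apply: (Lnorm_le_powR p_gt0 c0 IS); apply: le_trans Cc.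
apply: (@le_trans _ _ (k * \int[mu]_x (\sum_i `|a' i x + b' i x| `^ p))).
  rewrite -(RintegralZl _ measurableT sumI).
  by apply: (le_Rintegral measurableT IS Ik) => x _; exact: Spt.
by rewrite mulrA -/k; apply: ler_wpM2l.
Qed.

Lemma Lnorm_triangle_ae (A : R) (H F S : T -> R) : 0 <= A ->
  measurable_fun setT H -> measurable_fun setT F -> measurable_fun setT S ->
  {ae mu, forall x, `|H x| <= A * (F x + S x)} ->
  ('N[mu]_p%:E[EFin \o H] <= A%:E * ('N[mu]_p%:E[EFin \o F] + 'N[mu]_p%:E[EFin \o S]))%E.
Proof.
move=> A0 mH mF mS HFS.
have mFS : measurable_fun setT (fun x => F x + S x) := measurable_funD mF mS.
have mAFS : measurable_fun setT (fun x => A * (F x + S x)).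
  by apply: measurable_funM; first exact: measurable_cst.
have ptle : {ae mu, forall x, `|H x| <= `|A * (F x + S x)|}.
  by apply: filterS HFS => x /le_trans; apply; exact: ler_norm.
apply: (le_trans (Lnorm_le_ae p_gt0 mH mAFS ptle)).
rewrite (Lnorm_scale_le mu p_gt0 A0 mFS); apply: lee_wpmul2l; first by rewrite lee_fin.
exact: (minkowski_EFin mu mF mS p_ge1).
Qed.

End Lnorm_estimates.

Section energy_comparison.
Context (R : realType) (n m : nat) (p : R) (Q : set 'rV[R]_m).
Local Notation E := 'cV[R]_n.
Local Notation T := (caratheodory_type (lebesgue_outer R n)).
Local Notation mu := (leb R n).
Local Notation h := (support_function Q).
Hypothesis p_ge1 : 1 <= p.
Hypothesis Q_body : convex_body_with_origin Q.

Let p_gt0 : 0 < p. Proof. exact: lt_le_trans p_ge1. Qed.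

(** By sublinearity, [h] at [a] is at most [h] at [c] plus [h] at [a - c]. Only the terms in [a - c]
    and [b] undergo the lossy bound by [C]; the main term keeps the factor [A], which will be close
    to 1. *)
Lemma support_function_lattice (C A s t : R) (u : 'M[R]_(n, m)) (a b c : E) :
  (forall z : E, h (z^T *m u) <= C * \sum_i `|z i 0|) ->
  0 <= t <= A -> 0 <= s <= 1 ->
  h ((t *: ((1 - s) *: b + s *: a))^T *m u) <=
  A * (h (c^T *m u) + C * \sum_i (`|a i 0 - c i 0| + `|b i 0|)).
Proof.
move=> hC /andP[t0 tA] /andP[s0 s1].
have h0 z := support_function_ge0 Q_body z.
have s1' : 0 <= 1 - s by rewrite subr_ge0.
rewrite !linearZ/= linearD/= !linearZ/= -scalemxAl mulmxDl -!scalemxAl.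
apply: (le_trans (support_functionZ Q_body _ t0)).
apply: ler_pM => //; apply: (le_trans (support_functionD Q_body _ _)).
have ha : h (a^T *m u) <= h (c^T *m u) + C * \sum_i `|a i 0 - c i 0|.
  have -> : a^T *m u = c^T *m u + (a - c)^T *m u.
    by rewrite -mulmxDl -linearD/= addrC subrK.
  apply: (le_trans (support_functionD Q_body _ _)); rewrite lerD2l.
  by apply: (le_trans (hC _)); rewrite le_eqVlt; apply/orP; left; apply/eqP;
    congr (_ * _); apply: eq_bigr => i _; rewrite !mxE.
have hb := hC b; have hb0 := h0 (b^T *m u); have ha0 := h0 (a^T *m u).
have := support_functionZ Q_body (b^T *m u) s1'.
have := support_functionZ Q_body (a^T *m u) s0.
have e1 : s * h (a^T *m u) <= h (a^T *m u) by rewrite ler_piMl.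
have e2 : (1 - s) * h (b^T *m u) <= h (b^T *m u) by rewrite ler_piMl// gerBl.
rewrite big_split/= mulrDr; lra.
Qed.

Lemma measurable_support_gradient (G : T -> E) (u : 'M[R]_(n, m)) :
  (forall i, measurable_fun setT (fun x => G x i 0)) ->
  measurable_fun setT (fun x => h ((G x)^T *m u)).
Proof.
move=> mG; apply: (measurable_support_function Q_body) => j.
rewrite (_ : (fun _ => _) = fun x : T => \sum_i G x i 0 * u i j); last first.
  by apply/funext => x; rewrite mxE; apply: eq_bigr => i _; rewrite mxE.
by apply: measurable_sum => i; apply: measurable_funM.
Qed.

Lemma gradient_norm_lattice (C A c eta rho : R) (f phi psi g : E -> R) (u : 'M[R]_(n, m)) :
  W1p p f -> test_function phi -> test_function psi -> test_function g ->
  0 <= C -> 0 <= A -> 0 <= c -> euclid u = 1 ->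
  (forall u : 'M[R]_(n, m), euclid u = 1 -> forall z : E, h (z^T *m u) <= C * \sum_i `|z i 0|) ->
  (forall x, exists t s, [/\ 0 <= t <= A, 0 <= s <= 1 & forall i,
     partial i g x = t * ((1 - s) * partial i psi x + s * partial i phi x)]) ->
  (forall i, \int[mu]_y `|weak_gradient p f y i 0 - partial i phi y| `^ p <= eta) ->
  (forall i, \int[mu]_y `|partial i psi y| `^ p <= rho) ->
  C `^ p * (n%:R `^ p * (n%:R * (2 `^ p * (eta + rho)))) <= c `^ p ->
  (gradient_norm p Q g u <= A%:E * (gradient_norm p Q f u + c%:E))%E.
Proof.
move=> Wf tphi tpsi tg C0 A0 c0 u1 hC gE etaP rhoP Cc.
pose G := weak_gradient p f.
have LG i : in_Lp p (fun x => G x i 0) by have [] := weak_gradientP Wf i.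
pose a i (x : T) := G x i 0 - partial i phi x.
pose b i (x : T) := partial i psi x.
have La i : in_Lp p (a i).
  rewrite (_ : a i = fun x => -1 * partial i phi x + G x i 0).
    apply: (in_Lp_linear p_ge1 _ _ (LG i)); exact/(test_in_Lp p_ge1)/test_partial.
  by apply/funext => x; rewrite /a mulN1r addrC.
have Lb i : in_Lp p (b i) by exact/(test_in_Lp p_ge1)/test_partial.
have mGi i : measurable_fun setT (fun x : T => G x i 0) := in_Lp_measurable p_ge1 (LG i).
have ma i := in_Lp_measurable p_ge1 (La i).
have mb i := in_Lp_measurable p_ge1 (Lb i).
have Ia i := ((in_LpP _ p_ge1).1 (La i)).2.
have Ib i := ((in_LpP _ p_ge1).1 (Lb i)).2.
have [mS NS] := Lnorm_sum_le p_ge1 C0 c0 ma mb Ia Ib etaP rhoP Cc.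
pose S (x : T) := C * \sum_i (`|a i x| + `|b i x|).
pose F (x : T) := h ((G x)^T *m u).
have mF : measurable_fun setT F := measurable_support_gradient u mGi.
have mg : measurable_fun setT (fun x : T => h ((weak_gradient p g x)^T *m u)).
  apply: measurable_support_gradient => i.
  by apply: (in_Lp_measurable p_ge1); have [] := weak_gradientP (test_W1p p_ge1 tg) i.
have ptle : {ae mu, forall x : T, `|h ((weak_gradient p g x)^T *m u)| <= A * (F x + S x)}.
  apply: (@filterS _ _ (ae_filter_ringOfSetsType mu) _ _ _ (weak_gradient_test p_ge1 tg)) => x ->.
  have [t [s [tA s01 gtE]]] := gE x.
  have -> : grad g x = t *: ((1 - s) *: grad psi x + s *: grad phi x).
    by apply/matrixP => i j; rewrite !mxE gtE.
  rewrite (ger0_norm (support_function_ge0 Q_body _)).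
  apply: (le_trans (support_function_lattice (grad phi x) (grad psi x) (G x) (hC u u1) tA s01)).
  rewrite le_eqVlt; apply/orP; left; apply/eqP; congr (A * (_ + C * _)).
  by apply: eq_bigr => i _; rewrite !mxE distrC.
have le1 := Lnorm_triangle_ae p_ge1 A0 mg mF mS ptle.
rewrite /gradient_norm; apply: (le_trans le1).
by apply: lee_wpmul2l; [rewrite lee_fin|exact: leeD2l].
Qed.

End energy_comparison.

(** * Competitors in [classD] and comparison of the infima *)

Section classes.
Context (R : realType) (n m : nat) (p : R) (Q : set 'rV[R]_m) (K : set 'cV[R]_n).
Local Notation E := 'cV[R]_n.
Local Notation T := (caratheodory_type (lebesgue_outer R n)).
Local Notation mu := (leb R n).
Hypothesis p_ge1 : 1 <= p.
Hypothesis Q_body : convex_body_with_origin Q.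
Hypothesis K_compact : compact K.

Let p_gt0 : 0 < p. Proof. exact: lt_le_trans p_ge1. Qed.

Lemma dirichlet_energy_ge (i : 'I_n) (psi : E -> R) : test_function psi ->
  \int[mu]_y `|partial i psi y| `^ p <= dirichlet_energy p psi.
Proof.
move=> tpsi; have I1 := test_powR_integrable p_ge1 (test_partial i tpsi).
apply: (le_Rintegral measurableT I1 (dirichlet_integrable p_ge1 tpsi)) => x _.
by rewrite /dirichlet (bigD1 i)//= lerDl sumr_ge0// => j _; exact: powR_ge0.
Qed.

(** On [K] either [phi] exceeds [1 - 3 * t] or [2 * w] exceeds 1; smoothing the maximum costs [t],
    so [1 - 4 * t] is exceeded. The factor lifts this level to [1 + 2 * t], strictly above the level
    [1 + t] from which the truncation is 1: this margin provides the neighborhood. *)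
Lemma classD_truncation (t : R) (phi w : E -> R) : 0 < t -> t <= 10^-1 ->
  test_function phi -> test_function w ->
  (forall x, K x -> phi x <= 1 - 3 * t -> 2^-1 < w x) ->
  classD p K (fun x => smooth_trunc t ((1 + 2 * t) / (1 - 4 * t) *
    smooth_max t phi (fun x => 2 * w x) x)).
Proof.
move=> t0 t1 tphi tw Kw.
set psi := fun x => 2 * w x; have tpsi : test_function psi by exact: test_scale.
have ts := test_smooth_max t0 tphi tpsi.
set s := smooth_max t phi psi in ts *; set a := (1 + 2 * t) / (1 - 4 * t).
have a4 : 0 < 1 - 4 * t by lra.
have a0 : 0 < a by rewrite divr_gt0//; lra.
have tg := test_smooth_trunc t0 a ts.
have cas : continuous (fun x => a * s x) by exact: test_continuous (test_scale a ts).
split.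
- exact: test_W01p.
- by move=> x; rewrite precise_test//; exact: (smooth_trunc01 t0).
exists [set x | 1 + t < a * s x]; split.
- rewrite (_ : [set _ | _] = (fun x => a * s x) @^-1` [set y | 1 + t < y])//.
  by apply: open_comp; [move=> x _; exact: cas|exact: open_gt].
- move=> x Kx /=; have hs := @smooth_max_ge R n t phi psi t0 x.
  have h1 : 1 - 4 * t < s x.
    apply: lt_le_trans hs; rewrite ltrBrDr lt_max.
    have [h|h] := leP (phi x) (1 - 3 * t); last by apply/orP; left; lra.
    by apply/orP; right; have := Kw x Kx h; rewrite /psi; lra.
  apply: (@lt_le_trans _ _ (1 + 2 * t)); first lra.
  rewrite /a mulrAC ler_pdivlMr//; apply: ler_wpM2l; [lra|exact: ltW].
- by move=> x /= h; rewrite precise_test//; apply: (smooth_trunc_eq1 t0); exact: ltW.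
Qed.

Lemma classD_approx (f : E -> R) (e : R) : classB p K f -> 0 < e ->
  exists2 g, classD p K g & forall u : 'M[R]_(n, m), euclid u = 1 ->
    (gradient_norm p Q g u <= (1 + e)%:E * (gradient_norm p Q f u + e%:E))%E.
Proof.
move=> [Wf Kf] e0.
(* The truncated maximum multiplies gradients by at most [(1 + 2 * t) / ((1 - 4 * t) * (1 - t))]. To
   first order in [t], this is at most [1 + e] when [t * (7 + 5 * e) <= e], and the quadratic term
   has the favorable sign. *)
pose t := Num.min 10^-1 (e / (7 + 5 * e)).
have e7 : 0 < 7 + 5 * e by lra.
have t0 : 0 < t by rewrite lt_min invr_gt0 ltr0n divr_gt0.
have t1 : t <= 10^-1 by rewrite ge_min lexx.
have te : t * (7 + 5 * e) <= e by rewrite -ler_pdivlMr// ge_min lexx orbT.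

have [C C0 hC] := support_function_bound n Q_body.
pose N : R := n%:R; pose P : R := 2 `^ p.
have P0 : 0 <= P by exact: powR_ge0.
have N0 : 0 <= N by exact: ler0n.
(* [r] and [L] depend on [e] through [t] but not on [eta]: the energy of [w] is at most [r * eta]
   and the total error [L * eta], so [eta] can be chosen last to make it at most [e] to the power
   [p]. The summand 1 accounts for the extra [eta] lost in the increasing union. *)
pose r := (2 / t) `^ p * (N * (P * 2)) + 1.
have r0 : 0 <= r by rewrite addr_ge0// mulr_ge0 ?powR_ge0// mulr_ge0// mulr_ge0.
pose L := C `^ p * (N `^ p * (N * (P * (1 + P * r)))).
have L0 : 0 <= L by rewrite !mulr_ge0 ?powR_ge0// addr_ge0// mulr_ge0.
pose eta := e `^ p / (L + 1).
have eta0 : 0 < eta by rewrite divr_gt0 ?powR_gt0// ltr_wpDl.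
have [phi [tphi _ gphi]] := W01p_approx p_ge1 Wf eta0.
have cK' : compact (K `&` [set x | phi x <= 1 - 3 * t]).
  apply: compact_closedI => //.
  rewrite (_ : [set _ | _] = phi @^-1` [set y | y <= 1 - 3 * t])//.
  by apply: closed_comp; [move=> x _; exact: test_continuous|exact: closed_le].
have [w tw [Kw wE]] := capacity_defect p_ge1 Wf tphi cK' t0 eta0 eta0
  (fun x Kx => Kf x Kx.1) (fun x Kx => Kx.2) gphi.
have wE' : dirichlet_energy p w <= r * eta.
  apply: (le_trans wE); rewrite le_eqVlt; apply/orP; left; apply/eqP.
  by rewrite /r -/N -/P; ring.
pose psi x := 2 * w x; have tpsi : test_function psi by exact: test_scale.
have psiE i : \int[mu]_y `|partial i psi y| `^ p <= P * (r * eta).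
  apply: (le_trans (dirichlet_energy_ge i tpsi)).
  by rewrite (dirichlet_energyZ p_ge1 2 tw) ger0_norm//; exact: ler_wpM2l.
exists (fun x => smooth_trunc t ((1 + 2 * t) / (1 - 4 * t) * smooth_max t phi psi x)).
  by apply: classD_truncation => // x Kx h; apply: Kw.
move=> u u1; have ts := test_smooth_max t0 tphi tpsi.
have a4 : 0 < 1 - 4 * t by lra.
have a0 : 0 <= (1 + 2 * t) / (1 - 4 * t) by rewrite divr_ge0//; [lra|exact: ltW].
have tg := test_smooth_trunc t0 ((1 + 2 * t) / (1 - 4 * t)) ts.
apply: (gradient_norm_lattice p_ge1 Q_body Wf.1 tphi tpsi tg C0 _ (ltW e0) u1 hC _ gphi psiE).
- by rewrite addr_ge0// ltW.
- move=> x; have [q /andP[q0 q1] Eq] := partial_smooth_trunc t0 x a0 ts.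
  have [s s01 Es] := @partial_smooth_lattice R n t phi psi t0 tphi tpsi x.
  exists q, s; split => //; last by move=> i; rewrite Eq (Es i).1.
  rewrite q0 (le_trans q1)//.
  have P1 := smooth_pos_geB t0 1; have P10 := smooth_pos_gt0 t (@ltr01 R).
  rewrite ler_pdivrMr// ler_pdivrMr//.
  apply: (@le_trans _ _ ((1 + e) * (1 - t) * (1 - 4 * t))).
    have -> : (1 + e) * (1 - t) * (1 - 4 * t) =
      1 + 2 * t + (e - t * (7 + 5 * e)) + (1 + e) * (4 * t * t) by ring.
    by rewrite -addrA lerDl addr_ge0 ?subr_ge0// !mulr_ge0// ?ltW//; lra.
  by apply: ler_wpM2r; [exact: ltW|apply: ler_wpM2l => //; lra].
- rewrite -/N -/P; have -> : C `^ p * (N `^ p * (N * (P * (eta + P * (r * eta))))) = L * eta.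
    by rewrite /L; ring.
  by rewrite /eta mulrCA ler_piMr ?powR_ge0// ler_pdivrMr ?mul1r ?lerDl// ltr_wpDl.
Qed.

(** If the infimum were larger than the energy of [f], it would give a strict lower bound [t] for
    the spherical integral of [f]. This bound survives small perturbations of the gradient norms, so
    the competitor of [classD_approx] would have energy below the infimum. *)
Lemma affine_energy_classD_le (f : E -> R) : (0 < n * m)%N -> classB p K f ->
  (ereal_inf [set affine_energy p Q g | g in classD p K] <= affine_energy p Q f)%E.
Proof.
move=> nm0 Bf; rewrite leNgt; apply/negP => lt.
have k0 : (0 : R) < (n * m)%:R by rewrite ltr0n.
have r0 : 0 < p / (n * m)%:R by rewrite divr_gt0.
have N0 (g : E -> R) (u : 'M[R]_(n, m)) : (0 <= gradient_norm p Q g u)%E by exact: Lnorm_ge0.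
have I0 : (0 <= \int[hausdorff R n m (n * m).-1]_(u in @sphere R n m)
       (gradient_norm p Q f u `^ (n * m)%:R)^-1)%E.
  by apply: integral_ge0 => u _; rewrite inve_ge0 poweR_ge0.
have [t t0 [tI Ht]] := inv_poweR_lt r0 I0 lt.
have [e e0 He] := @integral_inv_pow_usc R _ _ (hausdorff R n m (n * m).-1)
  (@sphere R n m) (gradient_norm p Q f) _ _ k0 t0 (N0 f) tI.
have [g Dg gf] := classD_approx Bf e0.
have := Ht _ (He _ (N0 g) gf); rewrite ltNge => /negP; apply.
by apply: ereal_inf_lbound; exists g.
Qed.

Lemma classD_subA : classD p K `<=` classA p K.
Proof.
move=> f [Wf f01 [U [_ KU Uf]]]; split => // x; rewrite indicE.
have [/set_mem Kx|_] := boolP (x \in K); first by rewrite Uf//; exact: KU.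
by have /andP[] := f01 x.
Qed.

Lemma classA_subB : classA p K `<=` classB p K.
Proof.
move=> f [Wf Kf]; split => // x Kx; have := Kf x.
by rewrite indicE mem_set.
Qed.

End classes.

Theorem theorem3p3 (R : realType) (n m : nat) (p : R)
    (Q : set 'rV[R]_m) (K : set 'cV[R]_n)
    (n_gt0 : (0 < n)%N) (m_gt0 : (0 < m)%N) (p_range : 1 <= p < n%:R)
    (Q_body : convex_body_with_origin Q) (K_compact : compact K) :
  affine_capacity p Q K =
    ereal_inf [set affine_energy p Q f | f in classB p K] /\
  affine_capacity p Q K =
    ereal_inf [set affine_energy p Q f | f in classD p K].
Proof.
have p_ge1 : 1 <= p by case/andP: p_range.
have nm_gt0 : (0 < n * m)%N by rewrite muln_gt0 n_gt0.
have BA : (ereal_inf [set affine_energy p Q f | f in classB p K] <= affine_capacity p Q K)%E.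
  by apply/ereal_inf_le_tmp/image_subset/classA_subB.
have AD : (affine_capacity p Q K <= ereal_inf [set affine_energy p Q f | f in classD p K])%E.
  by apply/ereal_inf_le_tmp/image_subset/classD_subA.
have DB : (ereal_inf [set affine_energy p Q f | f in classD p K] <=
    ereal_inf [set affine_energy p Q f | f in classB p K])%E.
  by apply: le_ereal_inf_tmp => _ [f Bf <-]; exact: affine_energy_classD_le.
by split; apply/eqP; rewrite eq_le ?BA ?AD ?andbT/=; [exact: le_trans AD DB|exact: le_trans DB BA].
Qed.
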